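(* The semi-discrete EDG transport scheme (defined in the context, with $u_h\in V_h$ the velocity solution of the EDG-HDG Stokes--Darcy discretization) has a unique solution $\boldsymbol{c}_h\in\boldsymbol{C}_h$.
   Context: **Domain, flow and transport problems.** $\dim\in\{2,3\}$; $\Omega\subset\mathbb{R}^{\dim}$ is a bounded polygonal domain with outward unit normal $n$, divided into two non-overlapping polygonal subdomains $\Omega^s,\Omega^d$ separated by the interface $\Gamma^I$. $\Gamma^j$ is the exterior boundary of $\Omega^j$ (the part of $\partial\Omega$ on the boundary of $\Omega^j$) and $n^j$ the outward unit normal of $\Omega^j$, $j=s,d$; on $\Gamma^I$, $n=n^s=-n^d$. $(w)^t:=w-(w\cdot n)n$ is the tangential component, $\varepsilon(u)=(\nabla u+\nabla u^T)/2$, $\chi^d$ is the characteristic function of $\Omega^d$, and $\mu,\kappa,\alpha>0$ are constants. The Stokes--Darcy problem for the velocity $u$ and pressure $p$, with $u^j,p^j$ the restrictions to $\Omega^j$, is: $-\nabla\cdot 2\mu\varepsilon(u)+\nabla p=f^s$ in $\Omega^s$; $\kappa^{-1}u+\nabla p=0$ in $\Omega^d$; $-\nabla\cdot u=\chi^d f^d$ in $\Omega$; $u=0$ on $\Gamma^s$; $u\cdot n=0$ on $\Gamma^d$; and on $\Gamma^I$: $u^s\cdot n=u^d\cdot n$, $p^s-2\mu\varepsilon(u^s)n\cdot n=p^d$, $-2\mu(\varepsilon(u^s)n)^t=\alpha\kappa^{-1/2}(u^s)^t$. It is coupled to the transport problem for the concentration $c$ over the time interval $(0,T]$: $\phi\,\partial_tc+\nabla\cdot(cu-D(u)\nabla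 c)=f$ in $\Omega\times(0,T]$, $D(u)\nabla c\cdot n=0$ on $\partial\Omega\times(0,T]$, $c(x,0)=c_0(x)$ in $\Omega$, with $f$ a source/sink term and $c_0$ a suitably smooth initial condition. Here $\phi$ is the porosity: $\phi=1$ in $\Omega^s$ and a constant in $(0,1]$ in $\Omega^d$. The diffusion/dispersion tensor $D$ satisfies, for constants $D_{\min}>0$, $C>0$ and all $u,v,x\in\mathbb{R}^{\dim}$: $D_{\min}|x|^2\le D(u)x\cdot x$, $|D(u)|\le C(1+|u|)$, $|D(u)-D(v)|\le C|u-v|$. **Mesh.** For $j=s,d$, $\mathcal{T}^j$ is a shape-regular triangulation of $\Omega^j$ into non-overlapping elements $K$, the two meshes matching at $\Gamma^I$; $\mathcal{T}=\mathcal{T}^s\cup\mathcal{T}^d$; $h_K$ is the diameter of $K$; $n$ (or $n^j$ for $K\in\mathcal{T}^j$) is also the outward unit normal on $\partial K$. $\mathcal{F}$, $\Gamma_0$ are the set and union of all facets, $\mathcal{F}^j,\Gamma_0^j$ the set and union of facets in $\overline{\Omega}^j$. $(\cdot,\cdot)_D$ and $\langle\cdot,\cdot\rangle_D$ are $L^2$ inner products on $\dim$- and $(\dim-1)$-dimensional sets. $P_m(D)$ is the space of polynomials of degree $m$ on $D$. **EDG-HDG flow discretization (degree $k$).** $V_h=\{v_h\in[L^2(\Omega)]^{\dim}: v_h|_K\in[P_k(K)]^{\dim}\ \forall K\in\mathcal{T}\}$, $Q_h=\{q_h\in L^2(\Omega): q_h|_K\in P_{k-1}(K)\ \forall K\in\mathcal{T}\}\cap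 L_0^2(\Omega)$ ($L_0^2$: zero mean), $\bar V_h=\{\bar v_h\in[L^2(\Gamma_0^s)]^{\dim}:\bar v_h|_F\in[P_k(F)]^{\dim}\ \forall F\in\mathcal{F}^s,\ \bar v_h=0\text{ on }\Gamma^s\}\cap[C^0(\Gamma_0^s)]^{\dim}$, $\bar Q_h^j=\{\bar q_h\in L^2(\Gamma_0^j):\bar q_h|_F\in P_k(F)\ \forall F\in\mathcal{F}^j\}$. $\boldsymbol{V}_h=V_h\times\bar V_h$, $\boldsymbol{Q}_h=Q_h\times\bar Q_h^s\times\bar Q_h^d$. Find $(\boldsymbol{u}_h,\boldsymbol{p}_h)\in\boldsymbol{V}_h\times\boldsymbol{Q}_h$ with $a_h(\boldsymbol{u}_h,\boldsymbol{v}_h)+b_h(\boldsymbol{p}_h,\boldsymbol{v}_h)+b_h(\boldsymbol{q}_h,\boldsymbol{u}_h)=(f^s,v_h)_{\Omega^s}+(f^d,q_h)_{\Omega^d}$ for all $(\boldsymbol{v}_h,\boldsymbol{q}_h)\in\boldsymbol{V}_h\times\boldsymbol{Q}_h$, where $$a_h(\boldsymbol{u},\boldsymbol{v})=\sum_{K\in\mathcal{T}^s}\Big[(2\mu\varepsilon(u),\varepsilon(v))_K+\langle\tfrac{2\beta_f\mu}{h_K}(u-\bar u),v-\bar v\rangle_{\partial K}-\langle2\mu\varepsilon(u)n^s,v-\bar v\rangle_{\partial K}-\langle2\mu\varepsilon(v)n^s,u-\bar u\rangle_{\partial K}\Big]+(\kappa^{-1}u,v)_{\Omega^d}+\langle\alpha\kappa^{-1/2}\bar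 u^t,\bar v^t\rangle_{\Gamma^I},$$ $$b_h(\boldsymbol{p},\boldsymbol{v})=-\sum_{K\in\mathcal{T}}(p,\nabla\cdot v)_K+\sum_{j=s,d}\sum_{K\in\mathcal{T}^j}\langle\bar p^j,v\cdot n^j\rangle_{\partial K}-\langle\bar p^s-\bar p^d,\bar v\cdot n\rangle_{\Gamma^I}.$$ For a sufficiently large penalty parameter $\beta_f>0$ there is a unique solution; $u_h$, the first component of $\boldsymbol{u}_h=(u_h,\bar u_h)$, is called the velocity solution. **Semi-discrete EDG transport scheme (degree $\ell$).** $C_h=\{c_h\in L^2(\Omega):c_h|_K\in P_\ell(K)\ \forall K\in\mathcal{T}\}$, $\bar C_h=\{\bar c_h\in L^2(\Gamma_0):\bar c_h|_F\in P_\ell(F)\ \forall F\in\mathcal{F}\}\cap C^0(\Gamma_0)$, $\boldsymbol{C}_h=C_h\times\bar C_h$. For each $t>0$ find $\boldsymbol{c}_h(t)=(c_h(t),\bar c_h(t))\in\boldsymbol{C}_h$ with $$\sum_{K\in\mathcal{T}}(\phi\,\partial_tc_h(t),w_h)_K+B_h(u_h;\boldsymbol{c}_h(t),\boldsymbol{w}_h)=\sum_{K\in\mathcal{T}}(f(t),w_h)_K\quad\forall\boldsymbol{w}_h=(w_h,\bar w_h)\in\boldsymbol{C}_h,$$ with the initial condition imposed by taking $c_h(0)$ to be the $L^2$-projection of $c_0$ into $C_h$. Here $B_h=B_h^a+B_h^d$, $$B_h^a(u;\boldsymbol{c},\boldsymbol{w})=\sum_{K\in\mathcal{T}}\Big[-(c\,u,\nabla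 w)_K+\langle c\,u\cdot n,w-\bar w\rangle_{\partial K}-\langle u\cdot n\,(c-\bar c),w-\bar w\rangle_{\partial K^{\rm in}}\Big],$$ $$B_h^d(u;\boldsymbol{c},\boldsymbol{w})=\sum_{K\in\mathcal{T}}\Big[(D(u)\nabla c,\nabla w)_K-\langle[D(u)\nabla c]\cdot n,w-\bar w\rangle_{\partial K}+\tfrac{\beta_c}{h_K}\langle[D(u)n](c-\bar c),(w-\bar w)n\rangle_{\partial K}-\langle[D(u)\nabla w]\cdot n,c-\bar c\rangle_{\partial K}\Big],$$ $\partial K^{\rm in}$ is the portion of $\partial K$ where $u_h\cdot n<0$, and $\beta_c>0$ is a penalty parameter. *)

(* Defs.v *)
From HB Require Import structures.
From mathcomp Require Import all_boot all_order all_algebra.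
(* mpoly's notations clash with those of mathcomp-analysis; it is imported
   first because it also defines a module named Measure. *)
From mathcomp Require mpoly.
Import -(notations) mpoly.
From mathcomp Require Import all_classical all_reals all_analysis.

Import Order.TTheory GRing.Theory Num.Theory numFieldNormedType.Exports.

Set Implicit Arguments.
Unset Strict Implicit.
Unset Printing Implicit Defensive.

Local Open Scope classical_set_scope.
Local Open Scope ring_scope.

Section lebesgue_tuple.
Context {R : realType}.

Definition cons_tuple n (p : measurableTypeR R * n.-tuple R) : n.+1.-tuple R :=
  [the n.+1.-tuple R of p.1 :: p.2].

Lemma measurable_cons_tuple n : measurable_fun setT (@cons_tuple n).
Proof.
apply: measurable_cons; first exact: measurable_fst.
exact: measurable_snd.
Qed.

Section step.
Context (n : nat) (m : {sigma_finite_measure set (n.-tuple R) -> \bar R}).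

Definition lebesgue_step : set (n.+1.-tuple R) -> \bar R :=
  pushforward (@lebesgue_measure R \x m)%E (@cons_tuple n).

Let lebesgue_step0 : lebesgue_step set0 = 0%E.
Proof. by rewrite /lebesgue_step /pushforward preimage_set0 measure0. Qed.

Let lebesgue_step_ge0 A : (0 <= lebesgue_step A)%E.
Proof. by rewrite /lebesgue_step /pushforward measure_ge0. Qed.

Let lebesgue_step_sigma_additive : semi_sigma_additive lebesgue_step.
Proof.
exact: (@measure_semi_sigma_additive _ _ _
  (measure_function_pushforward__canonical__measure_function_Measure
     (@lebesgue_measure R \x m)%E (@measurable_cons_tuple n))).
Qed.

HB.instance Definition _ := isMeasure.Build _ _ _ lebesgue_step
  lebesgue_step0 lebesgue_step_ge0 lebesgue_step_sigma_additive.

Lemma lebesgue_step_sigma_finite : sigma_finite setT lebesgue_step.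
Proof.
have /sigma_finiteP[F [TF ndF Foo]] := sigma_finiteT (@lebesgue_measure R).
have /sigma_finiteP[G [TG ndG Goo]] := sigma_finiteT m.
pose uncons (t : n.+1.-tuple R) : measurableTypeR R * n.-tuple R :=
  (thead t, [tuple of behead t]).
have muncons : measurable_fun setT uncons.
  apply: measurable_fun_pair; first exact: measurable_tnth.
  exact: measurable_behead.
have consK : cancel (@cons_tuple n) uncons.
  by move=> [x t]; rewrite /uncons theadE; congr pair; apply/val_inj.
exists (fun k => uncons @^-1` (F k `*` G k)).
  apply/seteqP; split=> // t _.
  have [i _ Fi] : (\bigcup_i F i) (thead t) by rewrite -TF.
  have [j _ Gj] : (\bigcup_i G i) [tuple of behead t] by rewrite -TG.
  exists (maxn i j) => //; split=> /=.
    by apply: (subsetPset _ _ (ndF _ _ (leq_maxl i j))).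
  by apply: (subsetPset _ _ (ndG _ _ (leq_maxr i j))).
move=> k; have [mFk Fkoo] := Foo k; have [mGk Gkoo] := Goo k; split.
  rewrite -[X in measurable X]setTI; apply: muncons => //.
  exact: measurableX.
rewrite /lebesgue_step /pushforward -comp_preimage.
rewrite (_ : uncons \o _ = id); last by apply/funext => p /=; rewrite consK.
by rewrite preimage_id product_measure1E// lte_mul_pinfty// ge0_fin_numE.
Qed.

HB.instance Definition _ := Measure_isSigmaFinite.Build _ _ _
  lebesgue_step lebesgue_step_sigma_finite.

End step.

Fixpoint lebesgue_tuple n : {sigma_finite_measure set (n.-tuple R) -> \bar R} :=
  if n is m.+1 then lebesgue_step (lebesgue_tuple m)
  else @dirac _ (0.-tuple R) [tuple] R.

End lebesgue_tuple.

(* The library norm on matrices is the maximum norm, hence the Euclidean one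
   is spelled out. *)

Section euclidean.
Context {R : realType} {d : nat}.
Implicit Types (x y n : 'cV[R]_d) (A B : 'M[R]_d) (Om : set 'cV[R]_d).

Definition dotv x y : R := \sum_(i < d) x i 0 * y i 0.

Definition normv x : R := Num.sqrt (dotv x x).

Definition dotm A B : R := \sum_(i < d) \sum_(j < d) A i j * B i j.

Definition normm A : R := Num.sqrt (dotm A A).

Definition tangential n x : 'cV[R]_d := x - dotv x n *: n.

Definition bdry Om : set 'cV[R]_d := closure Om `\` interior Om.

Definition col_of_tuple (t : d.-tuple R) : 'cV[R]_d := \col_i tnth t i.

Definition vol_int (A : set 'cV[R]_d) (g : 'cV[R]_d -> R) : R :=
  \int[lebesgue_tuple d]_(t in col_of_tuple @^-1` A) g (col_of_tuple t).

Definition sqnormL2 Om (g : 'cV[R]_d -> R) : \bar R :=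
  (\int[lebesgue_tuple d]_t
     ((\1_Om (col_of_tuple t) * g (col_of_tuple t)) ^+ 2)%:E)%E.

(* Functions in L^2(Om) are represented by functions on the whole space whose
   values outside Om are irrelevant. *)
Definition inL2 Om (g : 'cV[R]_d -> R) : Prop :=
  measurable_fun setT
    (fun t : d.-tuple R => \1_Om (col_of_tuple t) * g (col_of_tuple t)) /\
  (sqnormL2 Om g < +oo)%E.

Definition dispersion_tensor (D : 'cV[R]_d -> 'M[R]_d) (Dmin C : R) : Prop :=
  [/\ 0 < Dmin, 0 < C,
      forall u x, Dmin * normv x ^+ 2 <= dotv (D u *m x) x,
      forall u, normm (D u) <= C * (1 + normv u) &
      forall u v, normm (D u - D v) <= C * normv (u - v)].

End euclidean.

Section polynomials.
Context {R : realType} {d : nat}.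
Implicit Types (p : mpoly d R) (u : 'I_d -> mpoly d R) (x : 'cV[R]_d).

(* [mpoly.msize] is the total degree plus one. *)
Definition inP (m : nat) p : Prop := (mpoly.msize p <= m.+1)%N.

Definition peval p x : R := meval (fun i => x i 0) p.

Definition pgrad p x : 'cV[R]_d := \col_i peval (mderiv i p) x.

Definition veval u x : 'cV[R]_d := \col_i peval (u i) x.

Definition vdiv u x : R := \sum_(i < d) peval (mderiv i (u i)) x.

Definition vsymgrad u x : 'M[R]_d :=
  \matrix_(i, j)
    ((peval (mderiv j (u i)) x + peval (mderiv i (u j)) x) / 2%:R).

End polynomials.

(* The vertices of a mesh are indexed by a finite type V, with positions pt;
   elements and facets are identified with their sets of vertices. *)

Section simplices.
Context {R : realType} {d : nat} {V : finType} (pt : V -> 'cV[R]_d).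
Implicit Types (S K F : {set V}) (T : {set {set V}}).

Definition hull S : set 'cV[R]_d :=
  [set x | exists a : V -> R,
     [/\ forall v, v \in S -> 0 <= a v,
         \sum_(v in S) a v = 1 &
         x = \sum_(v in S) a v *: pt v]].

Definition open_hull S : set 'cV[R]_d :=
  [set x | exists a : V -> R,
     [/\ forall v, v \in S -> 0 < a v,
         \sum_(v in S) a v = 1 &
         x = \sum_(v in S) a v *: pt v]].

Definition affinely_independent S : Prop :=
  forall a : V -> R,
    \sum_(v in S) a v = 0 -> \sum_(v in S) a v *: pt v = 0 ->
    forall v, v \in S -> a v = 0.

Definition nondegenerate K : Prop := #|K| = d.+1 /\ affinely_independent K.

Definition diam K : R :=
  sup [set r | exists x y, [/\ hull K x, hull K y & r = normv (x - y)]].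

(* Diameter of the largest ball contained in K. *)
Definition indiam K : R :=
  2%:R * sup [set r | 0 <= r /\
    exists x, forall y, normv (y - x) <= r -> hull K y].

Definition facets T : {set {set V}} :=
  [set F : {set V} | (#|F| == d) && [exists K in T, F \subset K]].

Definition skeleton T : set 'cV[R]_d :=
  \bigcup_(F in [set F | F \in facets T]) hull F.

(* The facet of K opposite to the vertex v is K :\ v. *)
Definition normal K (v : V) : 'cV[R]_d :=
  xget 0 [set n | [/\ dotv n n = 1,
    forall w w', w \in K :\ v -> w' \in K :\ v -> dotv n (pt w - pt w') = 0 &
    forall w, w \in K :\ v -> dotv n (pt v - pt w) < 0]].

(* Elements are integrated over their interiors, because the data are given on
   the open sets Om only. *)
Definition elem_int K (g : 'cV[R]_d -> R) : R := vol_int (open_hull K) g.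

Definition ref_simplex m : set (m.-tuple R) :=
  [set t | (forall i, 0 <= tnth t i) /\ \sum_(i < m) tnth t i <= 1].

(* Surface integral over a facet with vertices s_0, ..., s_(d-1): pullback to
   the reference simplex, with the square root of the Gram determinant of the
   edges s_(i+1) - s_0 as surface element. *)
Definition facet_int F (g : 'cV[R]_d -> R) : R :=
  let s := [seq pt v | v <- enum F] in
  let e i := s`_i.+1 - s`_0 in
  Num.sqrt (\det (\matrix_(i < d.-1, j < d.-1) dotv (e i) (e j))) *
  \int[lebesgue_tuple d.-1]_(t in @ref_simplex d.-1)
     g (s`_0 + \sum_(i < d.-1) tnth t i *: e i).

(* The integrand receives the outward unit normal of K and the facet. *)
Definition bdry_int K (g : 'cV[R]_d -> {set V} -> 'cV[R]_d -> R) : R :=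
  \sum_(v in K) facet_int (K :\ v) (g (normal K v) (K :\ v)).

Definition poly_on (m : nat) F (g : 'cV[R]_d -> R) : Prop :=
  exists2 p : mpoly d R, inP m p & forall x, hull F x -> g x = peval p x.

End simplices.

Section domains.
Context {R : realType} {d : nat}.
Implicit Types Om : set 'cV[R]_d.

(* Polygonal (polyhedral if d = 3) bounded domain. *)
Definition polygonal_domain Om : Prop :=
  [/\ Om !=set0, connected Om &
      exists (N : nat) (pt : 'I_N -> 'cV[R]_d) (T : {set {set 'I_N}}),
        (forall K, K \in T -> nondegenerate pt K) /\
        Om = interior (\bigcup_(K in [set K | K \in T]) hull pt K)].

Definition domain_decomposition Om Oms Omd : Prop :=
  [/\ polygonal_domain Om, polygonal_domain Oms, polygonal_domain Omd,
      Oms `&` Omd = set0 & closure Oms `|` closure Omd = closure Om].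

End domains.

Record is_mesh {R : realType} {d : nat} {V : finType} (pt : V -> 'cV[R]_d)
    (Oms Omd : set 'cV[R]_d) (Ts Td : {set {set V}}) (sigma : R) : Prop := {
  mesh_inj : injective pt;
  mesh_simplex : forall K, K \in Ts :|: Td -> nondegenerate pt K;
  mesh_s : \bigcup_(K in [set K | K \in Ts]) hull pt K = closure Oms;
  mesh_d : \bigcup_(K in [set K | K \in Td]) hull pt K = closure Omd;
  mesh_conforming : forall K K', K \in Ts :|: Td -> K' \in Ts :|: Td ->
    hull pt K `&` hull pt K' = hull pt (K :&: K');
  mesh_shape_regular : forall K, K \in Ts :|: Td ->
    diam pt K <= sigma * indiam pt K }.

(* A function that is polynomial on every element is a family of polynomials
   indexed by elements; only its members at elements of the mesh matter.
   Facet functions that are continuous on the skeleton are functions on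
   points, the others are families indexed by facets. *)

Section spaces.
Context {R : realType} {d : nat} {V : finType} (pt : V -> 'cV[R]_d).
Context (Om Oms : set 'cV[R]_d) (Ts Td : {set {set V}}).
Local Notation T := (Ts :|: Td).

Definition inVh (k : nat) (v : {set V} -> 'I_d -> mpoly d R) : Prop :=
  forall K, K \in T -> forall i, inP k (v K i).

Definition inQh (k : nat) (q : {set V} -> mpoly d R) : Prop :=
  (forall K, K \in T -> inP k.-1 (q K)) /\
  \sum_(K in T) elem_int pt K (peval (q K)) = 0.

Definition inVbarh (k : nat) (vb : 'cV[R]_d -> 'cV[R]_d) : Prop :=
  [/\ forall F, F \in facets (d := d) Ts ->
        forall i, poly_on pt k F (fun x => vb x i 0),
      forall x, (bdry Om `&` bdry Oms) x -> vb x = 0 &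
      {within skeleton pt Ts, continuous vb}].

Definition inQbarh (k : nat) (Tj : {set {set V}})
    (qb : {set V} -> 'cV[R]_d -> R) : Prop :=
  forall F, F \in facets (d := d) Tj -> poly_on pt k F (qb F).

Definition inCh (l : nat) (c : {set V} -> mpoly d R) : Prop :=
  forall K, K \in T -> inP l (c K).

Definition inCbarh (l : nat) (cb : 'cV[R]_d -> R) : Prop :=
  (forall F, F \in facets (d := d) T -> poly_on pt l F cb) /\
  {within skeleton pt T, continuous cb}.

End spaces.

Section flow.
Context {R : realType} {d : nat} {V : finType} (pt : V -> 'cV[R]_d).
Context (Om Oms Omd : set 'cV[R]_d) (Ts Td : {set {set V}}).
Context (k : nat) (mu kappa alpha betaf : R).
Context (fs : 'cV[R]_d -> 'cV[R]_d) (fd : 'cV[R]_d -> R).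
Local Notation T := (Ts :|: Td).
Local Notation vfield := ({set V} -> 'I_d -> mpoly d R).
Local Notation field := ({set V} -> mpoly d R).
Local Notation vtrace := ('cV[R]_d -> 'cV[R]_d).
Local Notation ftrace := ({set V} -> 'cV[R]_d -> R).

Definition interface : set 'cV[R]_d := bdry Oms `&` bdry Omd.

(* The normal on the interface is the outward normal of the Stokes side, and
   an interface facet belongs to exactly one element of Ts. *)
Definition interface_int (g : 'cV[R]_d -> {set V} -> 'cV[R]_d -> R) : R :=
  \sum_(K in Ts) \sum_(v in K | `[< hull pt (K :\ v) `<=` interface >])
    facet_int pt (K :\ v) (g (normal pt K v) (K :\ v)).

Definition ah (u : vfield) (ub : vtrace) (v : vfield) (vb : vtrace) : R :=
  \sum_(K in Ts)
    (elem_int pt K (fun x =>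
       2%:R * mu * dotm (vsymgrad (u K) x) (vsymgrad (v K) x))
     + bdry_int pt K (fun n F x => 2%:R * betaf * mu / diam pt K *
         dotv (veval (u K) x - ub x) (veval (v K) x - vb x))
     - bdry_int pt K (fun n F x =>
         dotv ((2%:R * mu) *: (vsymgrad (u K) x *m n)) (veval (v K) x - vb x))
     - bdry_int pt K (fun n F x =>
         dotv ((2%:R * mu) *: (vsymgrad (v K) x *m n)) (veval (u K) x - ub x)))
  + \sum_(K in Td) elem_int pt K (fun x =>
      kappa^-1 * dotv (veval (u K) x) (veval (v K) x))
  + interface_int (fun n F x =>
      alpha * (Num.sqrt kappa)^-1 *
      dotv (tangential n (ub x)) (tangential n (vb x))).

Definition bh (p : field) (pbs pbd : ftrace) (v : vfield) (vb : vtrace) : R :=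
  - (\sum_(K in T) elem_int pt K (fun x => peval (p K) x * vdiv (v K) x))
  + (\sum_(K in Ts) bdry_int pt K (fun n F x => pbs F x * dotv (veval (v K) x) n)
     + \sum_(K in Td)
         bdry_int pt K (fun n F x => pbd F x * dotv (veval (v K) x) n))
  - interface_int (fun n F x => (pbs F x - pbd F x) * dotv (vb x) n).

Definition flow_solution (u : vfield) (ub : vtrace)
    (p : field) (pbs pbd : ftrace) : Prop :=
  [/\ inVh Ts Td k u, inVbarh pt Om Oms Ts k ub,
      inQh pt Ts Td k p, inQbarh pt k Ts pbs /\ inQbarh pt k Td pbd &
      forall v vb q qbs qbd,
        inVh Ts Td k v -> inVbarh pt Om Oms Ts k vb ->
        inQh pt Ts Td k q -> inQbarh pt k Ts qbs -> inQbarh pt k Td qbd ->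
        ah u ub v vb + bh p pbs pbd v vb + bh q qbs qbd u ub =
        \sum_(K in Ts) elem_int pt K (fun x => dotv (fs x) (veval (v K) x))
        + \sum_(K in Td) elem_int pt K (fun x => fd x * peval (q K) x)].

End flow.

Section transport.
Context {R : realType} {d : nat} {V : finType} (pt : V -> 'cV[R]_d).
Context (Om : set 'cV[R]_d) (Ts Td : {set {set V}}).
Context (l : nat) (phid betac : R) (D : 'cV[R]_d -> 'M[R]_d).
Context (u : {set V} -> 'I_d -> mpoly d R).
Context (Tend : R) (f : R -> 'cV[R]_d -> R) (c0 : 'cV[R]_d -> R).
Local Notation T := (Ts :|: Td).
Local Notation field := ({set V} -> mpoly d R).
Local Notation trace := ('cV[R]_d -> R).

Definition Bha (c : field) (cb : trace) (w : field) (wb : trace) : R :=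
  \sum_(K in T)
    (- elem_int pt K (fun x =>
         dotv (peval (c K) x *: veval (u K) x) (pgrad (w K) x))
     + bdry_int pt K (fun n F x =>
         peval (c K) x * dotv (veval (u K) x) n * (peval (w K) x - wb x))
     - bdry_int pt K (fun n F x =>
         if dotv (veval (u K) x) n < 0 then
           dotv (veval (u K) x) n * (peval (c K) x - cb x) *
           (peval (w K) x - wb x)
         else 0)).

Definition Bhd (c : field) (cb : trace) (w : field) (wb : trace) : R :=
  \sum_(K in T)
    (elem_int pt K (fun x =>
       dotv (D (veval (u K) x) *m pgrad (c K) x) (pgrad (w K) x))
     - bdry_int pt K (fun n F x =>
         dotv (D (veval (u K) x) *m pgrad (c K) x) n * (peval (w K) x - wb x))
     + betac / diam pt K * bdry_int pt K (fun n F x =>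
         dotv ((peval (c K) x - cb x) *: (D (veval (u K) x) *m n))
              ((peval (w K) x - wb x) *: n))
     - bdry_int pt K (fun n F x =>
         dotv (D (veval (u K) x) *m pgrad (w K) x) n *
         (peval (c K) x - cb x))).

Definition Bh c cb w wb : R := Bha c cb w wb + Bhd c cb w wb.

Definition porosity (K : {set V}) : R := if K \in Ts then 1 else phid.

(* dg is the derivative at t of g relative to [0, Tend] (one-sided at the
   end points). *)
Definition time_derivative (g : R -> R) (t dg : R) : Prop :=
  (fun s => (s - t)^-1 * (g s - g t)) @ within `[0, Tend]%classic t^' --> dg.

Definition L2_projection (g : 'cV[R]_d -> R) (c : field) : Prop :=
  inCh Ts Td l c /\
  forall w, inCh Ts Td l w ->
    \sum_(K in T) elem_int pt K (fun x => peval (c K) x * peval (w K) x) =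
    \sum_(K in T) elem_int pt K (fun x => g x * peval (w K) x).

Definition source_continuous : Prop :=
  forall t, t \in `[0, Tend] ->
    inL2 Om (f t) /\
    (fun s => sqnormL2 Om (fun x => f s x - f t x))
      @ within `[0, Tend]%classic (nbhs t) --> 0%E.

(* c lives on [0, Tend]; cb is only constrained on ]0, Tend]. *)
Definition transport_solution (c : R -> field) (cb : R -> trace) : Prop :=
  [/\ L2_projection c0 (c 0),
      forall K, K \in T -> forall x, hull pt K x ->
        (fun s => peval (c s K) x) @ 0^'+ --> peval (c 0 K) x &
      forall t, t \in `]0, Tend] ->
        [/\ inCh Ts Td l (c t), inCbarh pt Ts Td l (cb t) &
          exists dc : field,
            [/\ inCh Ts Td l dc,
                forall K, K \in T -> forall x, hull pt K x ->
                  time_derivative (fun s => peval (c s K) x) t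
                    (peval (dc K) x) &
                forall w wb, inCh Ts Td l w -> inCbarh pt Ts Td l wb ->
                  \sum_(K in T) elem_int pt K (fun x =>
                    porosity K * peval (dc K) x * peval (w K) x)
                  + Bh (c t) (cb t) w wb =
                  \sum_(K in T) elem_int pt K (fun x =>
                    f t x * peval (w K) x)]]].

End transport.

(* Main.v *)
(* Testing the scheme with pairs (0, wb) involves no time derivative and expresses the
   trace cb through c: the form B_h(0, cb; 0, wb) is symmetric, and its inflow part
   |u . n| cb wb and its penalty part (beta_c / h_K) (D(u) n . n) cb wb make it positive
   definite on traces for every beta_c > 0, so coercivity of B_h itself is not needed.
   Testing with pairs (w, 0), where the mass form is positive definite, then gives a linear
   ordinary differential equation with constant coefficients (u_h does not depend on time)
   and continuous forcing for the nodal values of c. It is solved by variation of constants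
   with the matrix exponential, which also yields uniqueness. *)

(* Discrete functions are represented with redundancy: a family of polynomials has arbitrary members
   off the mesh, and a trace has arbitrary values off the skeleton. As types the spaces are not
   finite dimensional, so all linear algebra is done modulo evaluation at points of the mesh. The
   evaluated functions lie in the span of finitely many piecewise monomials, which need not be
   continuous traces themselves. Hence no basis is written down: a nodal system of maximal size
   serves as one, its size being bounded by the number of spanning functions. Its coordinates are
   point values, so that the pointwise time derivatives of the scheme are derivatives of
   coordinates. The equation holds on ]0, T] only, with a one-sided derivative at T; the right limit
   at 0 is what ties it to the initial projection. The forcing of the differential equation is
   continuous because the source is continuous in time with values in L2 and is tested with fixed
   polynomials. *)
Require Import Defs.
From HB Require Import structures.
From mathcomp Require Import all_boot all_order all_algebra.
From mathcomp Require mpoly.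
Import -(notations) mpoly.
From mathcomp Require Import all_classical all_reals all_analysis.
From mathcomp Require Import ring lra.

Import Order.TTheory GRing.Theory Num.Theory numFieldNormedType.Exports.

Set Implicit Arguments.
Unset Strict Implicit.
Unset Printing Implicit Defensive.

Local Open Scope classical_set_scope.
Local Open Scope ring_scope.

(** * Linear ordinary differential equations *)

Lemma cvg_sum {K : numFieldType} {V : normedModType K} {T : Type} {F : set_system T}
    {FF : Filter F} (I : Type) (r : seq I) (P : pred I) (f : I -> T -> V) (l : I -> V) :
  (forall i, P i -> f i @ F --> l i) ->
  (fun x => \sum_(i <- r | P i) f i x) @ F --> \sum_(i <- r | P i) l i.
Proof. by apply: cvg_big; exact: add_continuous. Qed.

Section matrix_exponential.
Context {R : realType} {n : nat}.
Implicit Types (L : 'M[R]_n) (t : R).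

Definition expmx_coef L (i j : 'I_n) (k : nat) : R := (L ^+ k) i j / k`!%:R.

(** The exponential is taken entry by entry, so that the theory of real power series gives
    convergence and termwise differentiation. *)
Definition expmx L t : 'M[R]_n := \matrix_(i, j) limn (pseries (expmx_coef L i j) t).

(** The sum of all moduli of entries dominates every row sum, so one more factor [L] costs one more
    factor of this constant. The entry series is thereby dominated by a real exponential series. *)
Lemma norm_expr_mx_le L k (i j : 'I_n) :
  `|(L ^+ k) i j| <= (\sum_i \sum_j `|L i j|) ^+ k.
Proof.
set B := \sum_i _.
have B0 : 0 <= B by apply: sumr_ge0 => ? _; apply: sumr_ge0.
elim: k i j => [|k IH] i j.
  by rewrite expr0 mxE; case: eqP => _; rewrite ?normr1 ?normr0.
rewrite exprS mxE exprS (le_trans (ler_norm_sum _ _ _))//.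
apply: (@le_trans _ _ (\sum_m `|L i m| * B ^+ k)).
  by apply: ler_sum => m _; rewrite normrM ler_wpM2l.
rewrite -mulr_suml ler_wpM2r ?exprn_ge0//.
by rewrite /B [leRHS](bigD1 i)//= lerDl sumr_ge0// => ? _; apply: sumr_ge0.
Qed.

Lemma is_cvg_expmx_coef L i j t : cvgn (pseries (expmx_coef L i j) t).
Proof.
rewrite /pseries.
set B := \sum_i \sum_j `|L i j|.
have B0 : 0 <= B by apply: sumr_ge0 => ? _; apply: sumr_ge0.
apply: normed_cvg.
apply: (@series_le_cvg _ _ (fun k => exp_coeff (B * `|t|) k)).
- by move=> k; rewrite normr_ge0.
- by move=> k; rewrite exp_coeff_ge0// mulr_ge0.
- move=> k /=; rewrite /exp_coeff /= /expmx_coef normrM normf_div normrX exprMn.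
  rewrite (ger0_norm (ler0n _ _)) mulrAC ler_wpM2r ?invr_ge0 ?ler0n//.
  by rewrite ler_wpM2r ?exprn_ge0// norm_expr_mx_le.
- exact: is_cvg_series_exp_coeff.
Qed.

(** Formal differentiation of the entries is multiplication by [L]. Iterating it reduces the
    convergence of all derived series to that of the original ones. *)
Lemma pseries_diffs_expmx_coef L i j :
  pseries_diffs (expmx_coef L i j) = fun k => \sum_m L i m * expmx_coef L m j k.
Proof.
apply/funext => k; rewrite /pseries_diffs /expmx_coef exprS mxE factS natrM.
have k0 : k.+1%:R != 0 :> R by rewrite pnatr_eq0.
have f0 : k`!%:R != 0 :> R by rewrite pnatr_eq0 -lt0n fact_gt0.
rewrite mulrCA invfM mulVKf// mulr_suml.
by apply: eq_bigr => m _; rewrite mulrA.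
Qed.

Lemma pseries_sum (I : finType) (c : I -> R) (f : I -> nat -> R) t :
  (forall m, cvgn (pseries (f m) t)) ->
  pseries (fun k => \sum_m c m * f m k) t @ \oo -->
    \sum_m c m * limn (pseries (f m) t).
Proof.
move=> cf.
have -> : pseries (fun k => \sum_m c m * f m k) t =
    fun N => \sum_m c m * pseries (f m) t N.
  apply/funext => N; rewrite /pseries /series /=.
  under eq_bigr do rewrite mulr_suml.
  rewrite exchange_big/=; apply: eq_bigr => m _; rewrite mulr_sumr.
  by apply: eq_bigr => k _; rewrite mulrA.
apply: cvg_sum => m _; apply: cvgMr; exact: cf.
Qed.

Lemma is_derive_expmx L t i j :
  is_derive t 1 (fun s => expmx L s i j) ((L *m expmx L t) i j).
Proof.
have -> : (fun s => expmx L s i j) = fun s => limn (pseries (expmx_coef L i j) s).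
  by apply/funext => s; rewrite mxE.
have -> : (L *m expmx L t) i j = limn (pseries (pseries_diffs (expmx_coef L i j)) t).
  rewrite pseries_diffs_expmx_coef; apply/esym/cvg_lim => //.
  rewrite mxE; under eq_bigr do rewrite [in X in _ * X]mxE.
  by apply: pseries_sum => m; exact: is_cvg_expmx_coef.
(* Termwise differentiation at [t] asks that the series and its first two formal derivatives
   converge at some point of larger modulus; [|t| + 1] is such a point. *)
apply: (@pseries_snd_diffs _ _ (`|t| + 1)).
- exact: is_cvg_expmx_coef.
- rewrite pseries_diffs_expmx_coef; apply/cvg_ex; eexists; apply: pseries_sum => m.
  exact: is_cvg_expmx_coef.
- rewrite pseries_diffs_expmx_coef.
  have -> : pseries_diffs (fun k => \sum_m L i m * expmx_coef L m j k) =
      fun k => \sum_m L i m * (pseries_diffs (expmx_coef L m j)) k.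
    apply/funext => k; rewrite {1}/pseries_diffs mulr_sumr; apply: eq_bigr => m _.
    by rewrite /pseries_diffs mulrCA.
  apply/cvg_ex; eexists; apply: pseries_sum => m; rewrite pseries_diffs_expmx_coef.
  apply/cvg_ex; eexists; apply: pseries_sum => m'; exact: is_cvg_expmx_coef.
- by rewrite [ltRHS]ger0_norm ?addr_ge0// ltrDl.
Qed.

Lemma expmx0 L : expmx L 0 = 1%:M.
Proof.
apply/matrixP => i j; rewrite !mxE; apply/cvg_lim => //.
apply: cvg_near_cst; near=> N.
have N0 : (0 < N)%N by near: N; exact: nbhs_infty_gt.
rewrite /pseries /series /= -(prednK N0) big_nat_recl//= expr0 mulr1 big1.
  by rewrite addr0 /expmx_coef expr0 fact0 divr1 mxE.
by move=> k _; rewrite expr0n mulr0.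
Unshelve. all: by end_near. Qed.

Lemma expmx_comm L t : L *m expmx L t = expmx L t *m L.
Proof.
apply/matrixP => i j; rewrite !mxE.
under eq_bigr do rewrite [in X in _ * X]mxE.
under [RHS]eq_bigr do rewrite mxE mulrC.
have H (f : 'I_n -> R) (g : 'I_n -> nat -> R) :
   (forall m, cvgn (pseries (g m) t)) ->
   \sum_m f m * limn (pseries (g m) t) = limn (pseries (fun k => \sum_m f m * g m k) t).
  by move=> cg; apply/esym/cvg_lim => //; apply: pseries_sum.
rewrite H; last by move=> m; exact: is_cvg_expmx_coef.
rewrite H; last by move=> m; exact: is_cvg_expmx_coef.
congr (limn (pseries _ t)); apply/funext => k.
transitivity ((L ^+ k.+1) i j / k`!%:R).
  by rewrite exprS mxE mulr_suml; apply: eq_bigr => m _; rewrite mulrA.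
rewrite exprSr mxE mulr_suml; apply: eq_bigr => m _.
by rewrite /expmx_coef mulrA [L _ _ * _]mulrC.
Qed.

End matrix_exponential.

Section linear_ode.
Context {R : realType} {n : nat}.
Implicit Types (L : 'M[R]_n) (t : R).

Lemma is_derive_sum_mul m (f g df dg : 'I_m -> R -> R) t :
  (forall i, is_derive t 1 (f i) (df i t)) -> (forall i, is_derive t 1 (g i) (dg i t)) ->
  is_derive t 1 (fun s => \sum_i f i s * g i s)
    (\sum_i (df i t * g i t + f i t * dg i t)).
Proof.
move=> Hf Hg.
have -> : (fun s => \sum_i f i s * g i s) = \sum_i (fun s => f i s * g i s).
  by apply/funext => s; rewrite fct_sumE.
apply: is_derive_sum => i.
have := is_deriveM (Hf i) (Hg i).
move=> H; apply: is_derive_eq H _.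
by rewrite /= addrC [g i t *: _]mulrC.
Qed.

(** Since [L] commutes with its exponential, the product has derivative zero in [t], and it is the
    identity at 0. *)
Lemma expmxN L t : expmx (- L) t *m expmx L t = 1%:M.
Proof.
apply/matrixP => i j.
have D (s : R) : is_derive s 1 (fun s => (expmx (- L) s *m expmx L s) i j) 0.
  have -> : (fun s => (expmx (- L) s *m expmx L s) i j) =
     fun s => \sum_m expmx (- L) s i m * expmx L s m j.
    by apply/funext => r; rewrite mxE.
  have := @is_derive_sum_mul n (fun m s => expmx (- L) s i m)
    (fun m s => expmx L s m j) (fun m s => ((- L) *m expmx (- L) s) i m)
    (fun m s => (L *m expmx L s) m j) s
    (fun m => is_derive_expmx (- L) s i m) (fun m => is_derive_expmx L s m j).
  move=> H; apply: is_derive_eq H _.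
  rewrite big_split /=.
  transitivity ((- L *m expmx (- L) s *m expmx L s + expmx (- L) s *m (L *m expmx L s)) i j).
    by rewrite [RHS]mxE [X in _ = X + _]mxE [X in _ = _ + X]mxE.
  by rewrite expmx_comm mulmxA mulmxN mulNmx addNr mxE.
have /= := is_derive_0_is_cst t 0 D.
by move=> ->; rewrite !expmx0 mulmx1.
Qed.

Lemma continuous_antiderivative (h : R -> R) : continuous h ->
  exists H : R -> R, H 0 = 0 /\ forall t, 0 <= t -> is_derive t 1 H (h t).
Proof.
move=> ch.
(* The base point -1 makes 0 an interior point of the interval of integration, so that the
   derivative at 0 is two-sided as well. *)
pose F (y : R) := (\int[lebesgue_measure]_(s in `[- 1, y]) h s)%R.
exists (fun y => F y - F 0); split; first by rewrite subrr.
move=> t t0.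
have [||||dF FE] := @continuous_FTC1_closed R h (- 1) t (t + 1).
- by rewrite ltrDl.
- apply: continuous_compact_integrable; first exact: segment_compact.
  by apply: continuous_subspaceT => x; exact: ch.
- by rewrite (lt_le_trans _ t0)// ltrN10.
- exact: ch.
have D : is_derive t 1 F (h t).
  apply: DeriveDef; first exact: dF.
  by rewrite -derive1E; exact: FE.
by have := is_deriveB D (is_derive_cst (F 0) t 1); rewrite subr0.
Qed.

(** Variation of constants for row vectors: the solution is (z0 + H(t)) exp(t L), where H is the
    antiderivative of g(s) exp(- s L) that vanishes at 0. *)
Lemma linear_ode_exists L (g : R -> 'rV[R]_n) (z0 : 'rV[R]_n) :
  (forall i, continuous (fun t => g t 0 i)) ->
  exists z : R -> 'rV[R]_n, z 0 = z0 /\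
    forall t, 0 <= t -> forall i, is_derive t 1 (fun s => z s 0 i) ((z t *m L + g t) 0 i).
Proof.
move=> cg.
have cE M i j : continuous (fun s => expmx M s i j).
  move=> t; apply: differentiable_continuous; apply/derivable1_diffP.
  by have [] := is_derive_expmx M t i j.
have ch i : continuous (fun t => (g t *m expmx (- L) t) 0 i).
  have -> : (fun t => (g t *m expmx (- L) t) 0 i) =
     fun t => \sum_m g t 0 m * expmx (- L) t m i.
    by apply/funext => r; rewrite mxE.
  move=> t; apply: cvg_sum => m _; apply: cvgM; [exact: cg|exact: cE].
have [H HP] := choice (fun i => continuous_antiderivative (ch i)).
pose w t : 'rV[R]_n := z0 + \row_i H i t.
exists (fun t => w t *m expmx L t); split.
  rewrite /w expmx0 mulmx1; apply/rowP => i.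
  by rewrite !mxE (HP i).1 addr0.
move=> t t0 i.
have Dw m : is_derive t 1 (fun s => w s 0 m) ((g t *m expmx (- L) t) 0 m).
  have -> : (fun s => w s 0 m) = fun s => z0 0 m + H m s.
    by apply/funext => r; rewrite !mxE.
  have := is_deriveD (is_derive_cst (z0 0 m) t 1) ((HP m).2 t t0).
  by rewrite add0r.
have -> : (fun s => (w s *m expmx L s) 0 i) =
     fun s => \sum_m w s 0 m * expmx L s m i.
  by apply/funext => r; rewrite mxE.
have := @is_derive_sum_mul n (fun m s => w s 0 m)
    (fun m s => expmx L s m i) (fun m s => (g s *m expmx (- L) s) 0 m)
    (fun m s => (L *m expmx L s) m i) t Dw (fun m => is_derive_expmx L t m i).
move=> D; apply: is_derive_eq D _.
rewrite big_split /=.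
transitivity ((g t *m expmx (- L) t *m expmx L t + w t *m (L *m expmx L t)) 0 i).
  by rewrite [RHS]mxE [X in _ = X + _]mxE [X in _ = _ + X]mxE.
by rewrite -mulmxA expmxN mulmx1 expmx_comm mulmxA addrC.
Qed.

Lemma time_derivative_is_derive (T : R) (g : R -> R) (t dg : R) : 0 < t < T ->
  time_derivative T g t dg -> is_derive t 1 g dg.
Proof.
move=> /andP[t0 tT]; rewrite /time_derivative => H.
have {}H : (fun s => (s - t)^-1 * (g s - g t)) @ t^' --> dg.
  apply: cvg_trans H; apply: cvg_app => A HA.
  have {}HA : \forall s \near t^', s \in `[0, T] -> A s by exact: HA.
  have HI : \forall s \near t^', s \in `]0, T[.
    by apply: nbhs_dnbhs; apply: near_in_itvoo; rewrite in_itv /= t0.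
  apply: filterS2 HA HI => s + sT; apply.
  by move: sT; rewrite !in_itv /= => /andP[/ltW -> /ltW ->].
have H' : (fun h => h^-1 *: (g (h *: 1 + t) - g t)) @ 0^' --> dg.
  move=> A /H; rewrite !nbhs_simpl /dnbhs /within /= => /nbhs_ballP[e /= e0 HB].
  apply/nbhs_ballP; exists e => //= h hB h0.
  rewrite /= [h *: 1]mulr1.
  have /= := HB (h + t); rewrite /ball /= addrK; apply.
    by rewrite opprD addrCA subrr addr0 normrN; move: hB; rewrite /ball/= sub0r normrN.
  by rewrite -subr_eq0 addrK.
apply: DeriveDef; first by apply/cvg_ex; exists dg; exact: H'.
exact/cvg_lim.
Qed.

(** The increment of [g] is s - t times a convergent difference quotient. At the end point T this
    gives the continuity from the left that the mean value theorem requires. *)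
Lemma time_derivative_continuous (T : R) (g : R -> R) (t dg : R) :
  time_derivative T g t dg -> g @ within `[0, T] (nbhs t) --> g t.
Proof.
rewrite /time_derivative => H.
have H1 : (fun s : R => s - t) @ within `[0, T]%classic t^' --> (0 : R).
  suff: (fun s : R => s - t) @ t --> (0 : R).
    apply: cvg_trans; apply: cvg_fmap2 => A HA.
    have HA' : \forall s \near t^', A s by exact: nbhs_dnbhs.
    by change (\forall s \near t^', s \in `[0, T] -> A s); apply: filterS HA'.
  rewrite -(subrr t); apply: cvgB; [exact: cvg_id|exact: cvg_cst].
have FW : Filter (within `[0, T] t^') by exact: within_filter.
have := cvgM H1 H; rewrite mul0r => /(_ FW) H2.
have H3 : g @ within `[0, T]%classic t^' --> g t.
  have := cvgD H2 (@cvg_cst _ (g t) _ _ FW); rewrite add0r => /(_ FW); apply: cvg_trans.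
  apply: near_eq_cvg.
  have := nbhs_dnbhs_neq t; apply: filterS => s st _.
  have : (s - t) * ((s - t)^-1 * (g s - g t)) + g t = g s.
    by rewrite mulrA divff ?mul1r ?subrK// subr_eq0.
  exact.
move=> A gA.
have {}H3 : \forall s \near t, s != t -> s \in `[0, T] -> A (g s) by exact: (H3 A gA).
change (\forall s \near t, s \in `[0, T] -> A (g s)).
apply: filterS H3 => s Hs sT; have [->|st] := eqVneq s t; last exact: Hs.
exact: (nbhs_singleton gA).
Qed.

Lemma is_derive_time_derivative (T : R) (g : R -> R) (t dg : R) :
  is_derive t 1 g dg -> time_derivative T g t dg.
Proof.
move=> [D DE]; have H : (fun h => h^-1 *: (g (h *: 1 + t) - g t)) @ 0^' --> dg.
  by rewrite -DE; exact: D.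
apply: cvg_within_filter => A /H.
rewrite !nbhs_simpl /dnbhs /within /= => /nbhs_ballP[e /= e0 HB].
apply/nbhs_ballP; exists e => //= s sB st; rewrite /=.
have := HB (s - t); rewrite /ball /= sub0r normrN distrC => /(_ sB).
by rewrite subr_eq0 => /(_ st); rewrite [_%:A]mulr1 subrK.
Qed.

Lemma time_derivativeB (T : R) (f g : R -> R) (t df dg : R) :
  time_derivative T f t df -> time_derivative T g t dg ->
  time_derivative T (fun s => f s - g s) t (df - dg).
Proof.
rewrite /time_derivative => Hf Hg.
have -> : (fun s => (s - t)^-1 * (f s - g s - (f t - g t))) =
    fun s => (s - t)^-1 * (f s - f t) - (s - t)^-1 * (g s - g t).
  by apply/funext => s; ring.
have FW : Filter (within `[0, T] t^') by exact: within_filter.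
exact: (@cvgB _ _ _ _ FW _ _ _ _ Hf Hg).
Qed.

(** Each component of z(s) exp(- s L) has derivative zero on ]0, t[ and is continuous on [0, t], so
    the mean value theorem equates its values at t and 0. Continuity at 0 is the assumed right
    limit, because the equation says nothing there; at t it comes from the possibly one-sided
    derivative. *)
Lemma linear_ode_unique (T : R) L (z : R -> 'rV[R]_n) :
  z 0 = 0 -> (forall i, (fun s => z s 0 i) @ 0^'+ --> (0 : R)) ->
  (forall t, t \in `]0, T] -> forall i,
     time_derivative T (fun s => z s 0 i) t ((z t *m L) 0 i)) ->
  forall t, t \in `[0, T] -> z t = 0.
Proof.
move=> z0 cz0 Dz.
suff main t : 0 < t -> t <= T -> z t *m expmx (- L) t = 0.
  move=> t; rewrite in_itv /= => /andP[]; rewrite le_eqVlt => /orP[/eqP <-//|t0 tT].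
  have := main t t0 tT => /(congr1 (mulmx^~ (expmx L t))).
  by rewrite -mulmxA expmxN mulmx1 mul0mx.
move=> t0 tT; apply/rowP => i; rewrite [RHS]mxE.
pose q s := \sum_m z s 0 m * expmx (- L) s m i.
have qE s : (z s *m expmx (- L) s) 0 i = q s by rewrite mxE.
have cE M j k : continuous (fun s => expmx M s j k).
  move=> s; apply: differentiable_continuous; apply/derivable1_diffP.
  by have [] := is_derive_expmx M s j k.
have q0 : q 0 = 0 by rewrite -qE z0 mul0mx mxE.
have Dq s : s \in `]0, t[ -> is_derive s 1 q 0.
  rewrite in_itv /= => /andP[s0 st].
  have Ds m : is_derive s 1 (fun r => z r 0 m) ((z s *m L) 0 m).
    apply: (@time_derivative_is_derive T); first by rewrite s0 (lt_le_trans st).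
    by apply: Dz; rewrite in_itv /= s0 (le_trans (ltW st)).
  have := @is_derive_sum_mul n (fun m s => z s 0 m)
    (fun m s => expmx (- L) s m i) (fun m s => (z s *m L) 0 m)
    (fun m s => (- L *m expmx (- L) s) m i) s Ds (fun m => is_derive_expmx (- L) s m i).
  move=> D; apply: is_derive_eq D _; rewrite big_split /=.
  transitivity ((z s *m L *m expmx (- L) s + z s *m (- L *m expmx (- L) s)) 0 i).
    by rewrite [RHS]mxE [X in _ = X + _]mxE [X in _ = _ + X]mxE.
  by rewrite mulNmx mulmxN -mulmxA subrr mxE.
have cq : {within `[0, t], continuous q}.
  apply/(continuous_within_itvP _ t0); split.
  - move=> s st; apply: differentiable_continuous; apply/derivable1_diffP.
    by have [] := Dq s st.
  - rewrite q0.
    suff : q @ 0^'+ --> \sum_(m < n) 0 * expmx (- L) 0 m i.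
      by rewrite big1// => m _; rewrite mul0r.
    apply: cvg_sum => m _; apply: cvgM; first exact: cz0.
    by apply: cvg_within_filter; exact: cE.
  - apply: cvg_sum => m _; apply: cvgM; last by apply: cvg_within_filter; exact: cE.
    have tT' : t \in `]0, T] by rewrite in_itv /= t0 tT.
    have H := time_derivative_continuous (Dz t tT' m).
    apply: cvg_trans H; apply: cvg_app => A HA.
    have {}HA : \forall s \near t, s \in `[0, T] -> A s by exact: HA.
    have HI : \forall s \near t, s \in `]0, t + 1[.
      by apply: near_in_itvoo; rewrite in_itv /= t0 /= ltrDl ltr01.
    change (\forall s \near t, s < t -> A s).
    apply: filterS2 HA HI => s + + st; rewrite !in_itv /= => As /andP[s0 _].
    by apply: As; rewrite (ltW s0) (le_trans (ltW st)).
have [c ct] := MVT t0 Dq cq.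
by rewrite q0 subr0 mul0r qE.
Qed.

End linear_ode.

(** * Lebesgue integration of continuous functions of several variables *)

Section matrix_continuity.
Context {R : realType}.

Lemma cvg_matrix {T : Type} {F : set_system T} {FF : Filter F} (m n : nat)
    (f : T -> 'M[R]_(m, n)) (l : 'M[R]_(m, n)) :
  (forall i j, (fun x => f x i j) @ F --> l i j) -> f @ F --> l.
Proof.
move=> fl; apply/cvg_ballP => e e0.
have H : \forall x \near F, forall ij : 'I_m * 'I_n, ball (l ij.1 ij.2) e (f x ij.1 ij.2).
  apply: filter_forall => -[i j] /=.
  by have /cvg_ballP := fl i j; apply.
by apply: filterS H => x Hx; split=> // i j; have := Hx (i, j).
Qed.

Lemma continuous_matrix (T : topologicalType) (m n : nat) (f : T -> 'M[R]_(m, n)) :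
  (forall i j, continuous (fun x => f x i j)) -> continuous f.
Proof.
move=> H x; have FF : Filter (nbhs x) by exact: nbhs_filter.
by apply: (@cvg_matrix _ _ FF) => i j; exact: H.
Qed.

Lemma continuous_sum {T : topologicalType} {W : normedModType R} (I : Type) (r : seq I)
    (P : pred I) (f : I -> T -> W) :
  (forall i, P i -> continuous (f i)) -> continuous (fun x => \sum_(i <- r | P i) f i x).
Proof.
move=> cf x; have FF : Filter (nbhs x) := nbhs_filter x.
by apply: (@cvg_sum _ _ _ _ FF) => i Pi; exact: cf.
Qed.

Lemma cvg_coord {T : Type} {F : set_system T} {FF : Filter F} (m n : nat)
    (f : T -> 'M[R]_(m, n)) (l : 'M[R]_(m, n)) i j :
  f @ F --> l -> (fun x => f x i j) @ F --> l i j.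
Proof.
move=> fl; apply: (@cvg_comp _ _ _ f (fun M : 'M[R]_(m, n) => M i j) _ _ _ fl).
exact: coord_continuous.
Qed.

Lemma continuous_bounded_box (n : nat) (g : 'cV[R]_n -> R) (M : R) : continuous g ->
  exists2 B : R, 0 <= B & forall x : 'cV[R]_n, (forall i, `|x i 0| <= M) -> `|g x| <= B.
Proof.
move=> cg.
pose A := [set v : 'rV[R]_n | forall i, `[- M, M]%classic (v ord0 i)].
have cA : compact A.
  by apply: (@rV_compact R n (fun=> `[- M, M]%classic)) => i; exact: segment_compact.
have cgt : continuous (fun v : 'rV[R]_n => g v^T).
  move=> v; apply: (@cvg_comp _ _ _ (fun v : 'rV[R]_n => v^T) g _ (nbhs v^T)); last exact: cg.
  apply: continuous_matrix => i j.
  have -> : (fun x : 'rV[R]_n => x^T i j) = fun x => x j i by apply/funext => x; rewrite mxE.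
  exact: coord_continuous.
have [B [_ HB]] := compact_bounded
  (continuous_compact (continuous_subspaceT cgt) cA).
exists `|B + 1|; first exact: normr_ge0.
move=> x xM; apply: (le_trans _ (ler_norm _)).
apply: HB; first by rewrite ltrDl.
exists x^T; last by rewrite trmxK.
by move=> i; rewrite /= mxE in_itv /= -ler_norml.
Qed.

End matrix_continuity.

Section lebesgue_tuple_theory.
Context {R : realType}.

Lemma measurable_ball (c e : R) : measurable (ball c e).
Proof. by rewrite ball_itv; exact: measurable_itv. Qed.

Definition tuple_box n (c : 'I_n -> R) (e : R) : set (n.-tuple R) :=
  [set t | forall i : 'I_n, `|tnth t i - c i| < e].

Lemma measurable_tuple_box n c e : measurable (@tuple_box n c e).
Proof.
have -> : @tuple_box n c e = \bigcap_(i in [set: 'I_n]) ((@tnth n R)^~ i @^-1` ball (c i) e).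
  apply/seteqP; split=> t /= H i; first by move=> _; rewrite /ball/= distrC; exact: H.
  by rewrite distrC; exact: (H i I).
apply: fin_bigcap_measurable => // i _.
rewrite -[X in measurable X]setTI; apply: measurable_tnth => //.
exact: measurable_ball.
Qed.

Lemma lebesgue_tuple_box n c e : 0 <= e ->
  lebesgue_tuple n (@tuple_box n c e) = ((e *+ 2) ^+ n)%:E.
Proof.
move=> e0; elim: n c => [|n IH] c.
  by rewrite expr0 /= diracE mem_set// => -[].
rewrite /= /lebesgue_step /pushforward.
have -> : @Defs.cons_tuple R n @^-1` @tuple_box n.+1 c e =
    ball (c ord0) e `*` @tuple_box n (fun i => c (lift ord0 i)) e.
  apply/seteqP; split=> [[x t] /= H|[x t] [/= Hx Ht]].
    split=> /=; first by rewrite /ball/= distrC; exact: (H ord0).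
    by move=> i; have := H (lift ord0 i); rewrite tnthS.
  move=> i; case: (unliftP ord0 i) => [j ->|->]; last by rewrite distrC.
  by rewrite tnthS; exact: Ht.
rewrite product_measure1E; [|exact: measurable_ball|exact: measurable_tuple_box].
by rewrite IH exprS EFinM; congr (_ * _)%E; exact: lebesgue_measure_ball.
Qed.

(** Tuples carry the product sigma-algebra, so openness is translated into a countable union of
    boxes with rational centres and radii 1/(k+1). Two points of one box differ by at most twice its
    radius in each coordinate, hence the condition on k. *)
Lemma open_col_measurable n (U : set 'cV[R]_n) :
  open U -> measurable (@col_of_tuple R n @^-1` U).
Proof.
move=> oU.
pose B (qk : {ffun 'I_n -> rat} * nat) : set (n.-tuple R) :=
  @tuple_box n (fun i => ratr (qk.1 i)) qk.2.+1%:R^-1.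
pose P qk := B qk `<=` @col_of_tuple R n @^-1` U.
have -> : @col_of_tuple R n @^-1` U =
    \bigcup_qk (if `[< P qk >] then B qk else set0).
  apply/seteqP; split=> [t Ut|t [qk _]]; last by case: asboolP => // + Bt; apply.
  have /nbhs_ballP[e /= e0 eU] := oU _ Ut.
  have [k ke] : exists k : nat, k.+1%:R^-1 *+ 2 < e.
    have [k _] := near_infty_natSinv_lt (PosNum (divr_gt0 e0 (ltr0n R 2))).
    move=> /(_ k (leqnn k)) /= Hk; exists k.
    by rewrite -[_ *+ 2]mulr_natr -ltr_pdivlMr// ltr0n.
  have /fin_all_exists[q Hq] : forall i : 'I_n, exists q : rat,
      `|tnth t i - ratr q| < k.+1%:R^-1.
    move=> i; have [q] := @rat_in_itvoo R (tnth t i - k.+1%:R^-1) (tnth t i + k.+1%:R^-1)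
      ltac:(by rewrite ltrBlDr -addrA ltrDl addr_gt0 ?invr_gt0).
    by rewrite in_itv /= -ltr_distlC => Hq; exists q.
  exists ([ffun i => q i], k) => //.
  have Bt : B ([ffun i => q i], k) t by move=> i /=; rewrite ffunE.
  rewrite asboolT// => s Bs /=; apply: eU; split=> // i j.
  rewrite /ball /= !mxE; apply: le_lt_trans ke.
  have -> : tnth t i - tnth s i = (tnth t i - ratr (q i)) - (tnth s i - ratr (q i)) by ring.
  rewrite (le_trans (ler_normB _ _))// mulr2n lerD// ltW//.
  by have := Bs i; rewrite /= ffunE.
apply: countable_bigcupT_measurable; first exact: countableP.
move=> qk; case: asboolP => // _.
exact: measurable_tuple_box.
Qed.

Lemma closed_col_measurable n (A : set 'cV[R]_n) :
  closed A -> measurable (@col_of_tuple R n @^-1` A).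
Proof.
move=> /closed_openC /open_col_measurable/measurableC.
by rewrite preimage_setC setCK.
Qed.

Lemma continuous_col_measurable n (g : 'cV[R]_n -> R) (A : set (n.-tuple R)) :
  continuous g -> measurable_fun A (g \o @col_of_tuple R n).
Proof.
move=> cg; apply: (@measurable_funS _ _ _ _ setT) => //.
apply: (measurability _ (measurable_realfun.RGenOInfty.measurableE R)).
move=> /= _ [_ [a ->] <-]; rewrite setTI.
have -> : (g \o @col_of_tuple R n) @^-1` `]a, +oo[ = @col_of_tuple R n @^-1` (g @^-1` `]a, +oo[) by [].
apply: open_col_measurable; apply: open_comp; first by move=> x _; exact: cg.
exact: interval_open.
Qed.

Lemma continuous_integrable n (g : 'cV[R]_n -> R) (A : set (n.-tuple R)) (M : R) :
  continuous g -> measurable A -> (forall t i, A t -> `|tnth t i| <= M) ->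
  (lebesgue_tuple n).-integrable A (EFin \o (g \o @col_of_tuple R n)).
Proof.
move=> cg mA AM.
apply: measurable_bounded_integrable => //; last first.
- have [B B0 HB] := continuous_bounded_box M cg.
  exists B; split; first exact: ger0_real.
  move=> r Br t At /=; apply: le_trans (ltW Br); apply: HB => i.
  by rewrite mxE; exact: AM.
- exact: continuous_col_measurable.
apply: (@le_lt_trans _ _ (lebesgue_tuple n (@tuple_box n (fun=> 0) (`|M| + 1)))).
  apply: le_measure; rewrite ?inE//; first exact: measurable_tuple_box.
  move=> t At i; rewrite subr0 (le_lt_trans (AM t i At))//.
  by rewrite (le_lt_trans (ler_norm M))// ltrDl.
by rewrite lebesgue_tuple_box ?ltry// addr_ge0.
Qed.

(** A nonnegative integrand of integral zero vanishes off a null set. If [g] were nonzero at a point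
    of the open set [U], it would be nonzero on a whole box inside [U], and a box has positive
    measure. *)
Lemma Rintegral_continuous_eq0 n (g : 'cV[R]_n -> R) (A : set (n.-tuple R)) (M : R)
    (U : set 'cV[R]_n) :
  continuous g -> measurable A -> (forall t i, A t -> `|tnth t i| <= M) ->
  open U -> @col_of_tuple R n @^-1` U `<=` A ->
  (forall t, A t -> 0 <= g (col_of_tuple t)) ->
  \int[lebesgue_tuple n]_(t in A) g (col_of_tuple t) = 0 ->
  forall x, U x -> g x = 0.
Proof.
move=> cg mA AM oU UA g0 Ig x Ux.
have Iint := continuous_integrable cg mA AM.
have /integrableP[mg _] := Iint.
have I0 : (\int[lebesgue_tuple n]_(t in A) `|(EFin \o (g \o @col_of_tuple R n)) t| = 0)%E.
  rewrite -[RHS](_ : (0 : R)%:E = 0%E)// -Ig /Rintegral fineK.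
    by apply: eq_integral => t /[!inE] At /=; rewrite ger0_norm// g0.
  exact: integrable_fin_num.
have /(ae_eq_integral_abs _ mA mg)[N [mN N0 HN]] := I0.
apply/eqP/negPn/negP => gx.
have : \forall y \near x, U y /\ g y != 0.
  have H1 : \forall y \near x, U y by exact: open_nbhs_nbhs.
  have H2 : \forall y \near x, g y != 0 by exact: (@cvgr_neq0 _ _ _ (nbhs x) _ g (g x) (cg x) gx).
  by apply: filterS2 H1 H2 => y.
move=> /nbhs_ballP[e /= e0 He].
have : (lebesgue_tuple n (@tuple_box n (fun i => x i 0%R) e)
   <= lebesgue_tuple n N)%E.
  apply: le_measure; rewrite ?inE//; first exact: measurable_tuple_box.
  move=> t Bt; apply: HN => /= H.
  have [Ut /eqP] : U (col_of_tuple t) /\ g (col_of_tuple t) != 0.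
    apply: He; split=> // i j; rewrite /ball/= mxE ord1 distrC.
    exact: Bt.
  by apply; have [] := H (UA _ Ut).
rewrite N0 lebesgue_tuple_box; last exact: ltW.
by rewrite lee_fin leNgt exprn_gt0// mulrn_wgt0.
Qed.

End lebesgue_tuple_theory.

(** * Polynomial functions *)

Section mpoly_functions.
Context {R : realType} {d : nat}.
Implicit Types (p q : mpoly d R) (x : 'cV[R]_d).

Lemma mpoly_gen_ind (P : mpoly d R -> Prop) :
  (forall c, P (mpolyC d c)) -> (forall i, P (mpolyX R (mnm1 i))) ->
  (forall p q, P p -> P q -> P (p + q)) -> (forall p q, P p -> P q -> P (p * q)) ->
  forall p, P p.
Proof.
move=> PC PX PD PM; elim/mpolyind => [|c m p _ _ Pp].
  by rewrite -mpolyC0; exact: PC.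
apply: PD => //; rewrite -mul_mpolyC; apply: (PM _ _ (PC c)).
rewrite mpolyXE_id; apply: (big_ind P) => //; first by rewrite -mpolyC1; exact: PC.
move=> i _; elim: (m i) => [|k IH]; first by rewrite expr0 -mpolyC1; exact: PC.
by rewrite exprS; exact: PM.
Qed.

Lemma pevalD p q x : peval (p + q) x = peval p x + peval q x.
Proof. exact: mevalD. Qed.
Lemma pevalZ c p x : peval (c *: p) x = c * peval p x.
Proof. exact: mevalZ. Qed.
Lemma peval0 x : peval 0 x = 0.
Proof. exact: meval0. Qed.
Lemma pevalM p q x : peval (p * q) x = peval p x * peval q x.
Proof. exact: mevalM. Qed.
Lemma pevalC c x : peval (mpolyC d c) x = c.
Proof. exact: mevalC. Qed.
Lemma pevalX i x : peval (mpolyX R (mnm1 i)) x = x i 0.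
Proof. exact: mevalXU. Qed.

Lemma peval_sum (I : Type) (r : seq I) (P : pred I) (f : I -> mpoly d R) x :
  peval (\sum_(i <- r | P i) f i) x = \sum_(i <- r | P i) peval (f i) x.
Proof. by elim/big_ind2 : _ => //[|? ? ? ? <- <-]; rewrite (peval0, pevalD). Qed.

Lemma pgrad_lin c p q x : pgrad (c *: p + q) x = c *: pgrad p x + pgrad q x.
Proof. by apply/colP => i; rewrite !mxE linearP/= pevalD pevalZ. Qed.

Lemma pgrad0 x : pgrad 0 x = 0.
Proof. by apply/colP => i; rewrite !mxE mderiv0 peval0. Qed.

Lemma continuous_peval p : continuous (peval p).
Proof.
elim/mpoly_gen_ind: p => [c|i|p q cp cq|p q cp cq].
- have -> : peval (mpolyC d c) = cst c by apply/funext => x; rewrite pevalC.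
  exact: cst_continuous.
- have -> : peval (mpolyX R (mnm1 i)) = fun x => x i 0 by apply/funext => x; rewrite pevalX.
  exact: coord_continuous.
- have -> : peval (p + q) = fun x => peval p x + peval q x by apply/funext => x; rewrite pevalD.
  by move=> x; exact: (@cvgD _ _ _ _ _ (peval p) (peval q) _ _ (cp x) (cq x)).
- have -> : peval (p * q) = fun x => peval p x * peval q x by apply/funext => x; rewrite pevalM.
  by move=> x; exact: (@cvgM _ _ _ _ (peval p) (peval q) _ _ (cp x) (cq x)).
Qed.

Lemma is_derive_peval p x (i : 'I_d) :
  is_derive (0 : R) 1 (fun s => peval p (x + s *: delta_mx i 0)) (peval (mderiv i p) x).
Proof.
elim/mpoly_gen_ind: p => [c|j|p q cp cq|p q cp cq].
- rewrite mderivC peval0.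
  have -> : (fun s => peval (mpolyC d c) (x + s *: delta_mx i 0)) = cst c.
    by apply/funext => s; rewrite pevalC.
  exact: is_derive_cst.
- have -> : (fun s => peval (mpolyX R (mnm1 j)) (x + s *: delta_mx i 0)) =
      fun s => x j 0 + (j == i)%:R * s.
    by apply/funext => s; rewrite pevalX !mxE eqxx andbT mulrC.
  have := is_deriveD (is_derive_cst (x j 0) (0 : R) 1)
    (is_deriveZ (j == i)%:R (is_derive_id (0 : R) 1)).
  move=> H; apply: is_derive_eq H _.
  rewrite add0r mderivX mnm1E pevalZ [_ *: _]mulr1.
  case: eqVneq => [->|_]; last by rewrite mul0r.
  rewrite (_ : mnm_sub _ _ = (@mnm0 d)); last by apply/mnmP => k; rewrite mnmBE subnn mnm0E.
  by rewrite mpolyX0 -mpolyC1 pevalC mulr1.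
- rewrite mderivD pevalD.
  have -> : (fun s => peval (p + q) (x + s *: delta_mx i 0)) =
      (fun s => peval p (x + s *: delta_mx i 0)) + (fun s => peval q (x + s *: delta_mx i 0)).
    by apply/funext => s; rewrite pevalD.
  exact: is_deriveD.
- rewrite mderivM pevalD !pevalM.
  have -> : (fun s => peval (p * q) (x + s *: delta_mx i 0)) =
      (fun s => peval p (x + s *: delta_mx i 0)) * (fun s => peval q (x + s *: delta_mx i 0)).
    by apply/funext => s; rewrite pevalM.
  have H := is_deriveM cp cq.
  apply: is_derive_eq H _.
  by rewrite /= scale0r addr0 addrC [peval q x *: _]mulrC.
Qed.

(** Induction on the degree: the partial derivatives also vanish on [U], hence are zero polynomials,
    so p is a constant, and its value at a point of [U] is 0. *)
Lemma peval_eq0_open p (U : set 'cV[R]_d) : U !=set0 -> open U ->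
  (forall x, U x -> peval p x = 0) -> p = 0.
Proof.
move=> [x0 Ux0] oU; have [n] := ubnP (msize p); elim: n p => // n IH p pn p0.
have dp i : mderiv i p = 0.
  (* If the derivative is nonzero, its leading monomial times the variable [i] lies in the support
     of p, so its size is strictly smaller and the induction hypothesis applies. *)
  apply/eqP/negPn/negP => dp0; move/negP: (dp0); apply; apply/eqP/IH.
    rewrite -(mlead_deg dp0); apply: (@leq_trans (msize p)); last by rewrite -ltnS.
    have := mlead_supp dp0; rewrite mcoeff_msupp mcoeff_mderiv => Hm.
    have : mnm_add (mlead (mderiv i p)) (mnm1 i) \in msupp p.
      by rewrite mcoeff_msupp; apply: contraNneq Hm => ->; rewrite mul0rn.
    by move/msize_mdeg_lt; rewrite mdegD mdeg1 addn1.
  move=> x Ux.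
  have D0 : is_derive (0 : R) 1 (fun s => peval p (x + s *: delta_mx i 0)) 0.
    have := is_derive_cst (0 : R) (0 : R) 1.
    apply: near_eq_is_derive.
    have cl : continuous (fun s : R => x + s *: (delta_mx i 0 : 'cV[R]_d)).
      move=> s; apply: cvgD; first exact: cvg_cst.
      by apply: cvgZr_tmp; exact: cvg_id.
    have : \forall y \near x + 0 *: (delta_mx i 0 : 'cV[R]_d), U y.
      by rewrite scale0r addr0; exact: open_nbhs_nbhs.
    move=> HU; have {}HU : \forall s \near (0 : R), U (x + s *: delta_mx i 0).
      exact: (cl 0 U HU).
    by apply: filterS HU => s /p0 ->.
  have D1 := is_derive_peval p x i.
  by rewrite -(@derive_val _ _ _ _ _ _ _ D1) (@derive_val _ _ _ _ _ _ _ D0).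
(* Characteristic zero enters here: a monomial m containing the variable [i] contributes a positive
   multiple of its coefficient to the derivative in that variable. *)
have pC : p = mpolyC d (mcoeff (@mnm0 d) p).
  apply/mpolyP => m; rewrite mcoeffC; have [->|m0] := eqVneq m (@mnm0 d).
    by rewrite mulr1.
  rewrite mulr0.
  have [i mi] : exists i, m i != 0%N.
    apply/existsP; apply: contraNT m0; rewrite negb_exists => /forallP H.
    by apply/eqP/mnmP => i; rewrite mnm0E; apply/eqP; have := H i; rewrite negbK.
  have := congr1 (mcoeff (mnm_sub m (mnm1 i))) (dp i).
  rewrite mcoeff0 mcoeff_mderiv submK; last by rewrite lep1mP.
  by move=> /eqP; rewrite mulrn_eq0 /= => /eqP.
by rewrite pC -(pevalC (mcoeff (@mnm0 d) p) x0) -pC p0// mpolyC0.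
Qed.

Lemma inP_lin m (c : R) p q : inP m p -> inP m q -> inP m (c *: p + q).
Proof.
rewrite /inP => Hp Hq.
have H1 := msizeD_le (c *: p) q.
have H2 := msizeZ_le p c.
apply: (leq_trans H1); rewrite geq_max Hq andbT.
exact: (leq_trans H2).
Qed.

Lemma inP0 m : inP m (0 : mpoly d R).
Proof. by rewrite /inP msize0. Qed.

End mpoly_functions.

(** * Geometry of simplices *)

Section euclidean_theory.
Context {R : realType} {d : nat}.
Implicit Types x y z : 'cV[R]_d.

Lemma dotvC x y : dotv x y = dotv y x.
Proof. by apply: eq_bigr => i _; rewrite mulrC. Qed.

Lemma dotv_linr (c : R) x y z : dotv z (c *: x + y) = c * dotv z x + dotv z y.
Proof.
rewrite /dotv mulr_sumr -big_split /=; apply: eq_bigr => i _.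
by rewrite !mxE mulrDr mulrCA.
Qed.

Lemma dotv_linl (c : R) x y z : dotv (c *: x + y) z = c * dotv x z + dotv y z.
Proof. by rewrite dotvC dotv_linr !(dotvC z). Qed.

Lemma dotv0r x : dotv x 0 = 0.
Proof. by apply: big1 => i _; rewrite mxE mulr0. Qed.

Lemma dotv0l x : dotv 0 x = 0.
Proof. by rewrite dotvC dotv0r. Qed.

Lemma dotvZl (c : R) x y : dotv (c *: x) y = c * dotv x y.
Proof. by rewrite -[c *: x]addr0 dotv_linl dotv0l addr0. Qed.

Lemma dotvZr (c : R) x y : dotv x (c *: y) = c * dotv x y.
Proof. by rewrite dotvC dotvZl dotvC. Qed.

Lemma dotvBr x y z : dotv z (x - y) = dotv z x - dotv z y.
Proof. by rewrite addrC -scaleN1r dotv_linr mulN1r addrC. Qed.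

Lemma dotvv_ge0 x : 0 <= dotv x x.
Proof. by apply: sumr_ge0 => i _; rewrite -expr2 sqr_ge0. Qed.

Lemma dotvv_eq0 x : dotv x x = 0 -> x = 0.
Proof.
move/eqP; rewrite psumr_eq0 => [/allP H|i _]; last by rewrite -expr2 sqr_ge0.
apply/colP => i; rewrite mxE; have := H i (mem_index_enum i).
by rewrite /= mulf_eq0 orbb => /eqP.
Qed.

Lemma normv_sqr x : normv x ^+ 2 = dotv x x.
Proof. by rewrite sqr_sqrtr// dotvv_ge0. Qed.

Lemma continuous_dotv {T : topologicalType} (f g : T -> 'cV[R]_d) :
  continuous f -> continuous g -> continuous (fun t => dotv (f t) (g t)).
Proof.
move=> cf cg t; apply: cvg_sum => i _.
by apply: (@cvgM _ _ _ _ (fun t => f t i 0) (fun t => g t i 0));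
  apply: cvg_coord; [exact: cf|exact: cg].
Qed.

Lemma continuous_affine (b : R) (g : 'cV[R]_d) : continuous (fun x => b + dotv g x).
Proof.
move=> x; apply: (@continuousD _ _ _ (cst b) (fun x => dotv g x) x); first exact: cst_continuous.
apply: (@continuous_dotv _ (fun=> g) id); first exact: cst_continuous.
by move=> t A.
Qed.

End euclidean_theory.

Section simplex_geometry.
Context {R : realType} {d : nat} {V : finType} (pt : V -> 'cV[R]_d).
Implicit Types (S K F : {set V}).

(** Barycentric coordinates as affine functions on the whole space. The matrix [N] with rows (1, pt
    v) sends weights to the pair of total mass and weighted point; affine independence and the
    cardinality d + 1 make it invertible, and the columns of its inverse hold the coefficients [b]
    and [g]. *)
Lemma barycentric K : Defs.nondegenerate pt K ->
  exists (b : V -> R) (g : V -> 'cV[R]_d),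
    (forall a : V -> R, \sum_(v in K) a v = 1 -> forall v, v \in K ->
       b v + dotv (g v) (\sum_(w in K) a w *: pt w) = a v) /\
    (forall x, \sum_(v in K) (b v + dotv (g v) x) = 1 /\
       x = \sum_(v in K) (b v + dotv (g v) x) *: pt v).
Proof.
move=> [cK aK].
pose N : 'M[R]_(#|K|, 1 + d) :=
  row_mx (const_mx 1) (\matrix_(i, j) pt (enum_val i) j 0).
have yN (y : 'rV[R]_#|K|) (a : V -> R) : (forall i, y 0 i = a (enum_val i)) ->
    y *m N = row_mx (\sum_(v in K) a v)%:M (\sum_(v in K) a v *: pt v)^T.
  move=> ya; rewrite mul_mx_row; congr row_mx.
    apply/rowP => j; rewrite ord1 !mxE eqxx mulr1n [in RHS]big_enum_val /=.
    by apply: eq_bigr => i _; rewrite mxE mulr1 ya.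
  apply/rowP => j; rewrite !mxE summxE [in RHS]big_enum_val /=.
  by apply: eq_bigr => i _; rewrite !mxE ya.
pose ext (y : 'rV[R]_#|K|) v : R := \sum_i y 0 i *+ (enum_val i == v).
have extE y i : ext y (enum_val i) = y 0 i.
  rewrite /ext (bigD1 i)//= eqxx mulr1n big1 ?addr0// => j ji.
  by rewrite (inj_eq enum_val_inj) (negbTE ji) mulr0n.
have fN : row_free N.
  apply: inj_row_free => y.
  rewrite (@yN y (ext y)); last by move=> i; rewrite extE.
  move=> E; have /eq_row_mx[/matrixP /(_ 0 0) H1 H2] := etrans E (esym (@row_mx0 _ 1 1 d)).
  move: H1; rewrite !mxE eqxx mulr1n => H1.
  move/(congr1 trmx) : H2; rewrite trmxK trmx0 => H2.
  have H := aK _ H1 H2.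
  by apply/rowP => i; rewrite mxE -extE H// enum_valP.
have uN : row_full N by rewrite /row_full (eqP (fN : \rank N == #|K|)) cK.
(* The sizes #|K| and 1 + d are equal by hypothesis but not by conversion, so a pseudo-inverse takes
   the place of the inverse; it is two-sided because [N] is both row free and row full. *)
pose P := pinvmx N.
pose b v : R := ext (row 0 P) v.
pose g v : 'cV[R]_d := \col_j ext (row (rshift 1 j) P) v.
have bg x i : b (enum_val i) + dotv (g (enum_val i)) x =
    (row_mx 1%:M x^T *m P) 0 i.
  rewrite [RHS]mxE big_split_ord /= big_ord1 row_mxEl [1%:M _ _]mxE eqxx mul1r.
  rewrite /b extE mxE /dotv.
  rewrite (_ : lshift d ord0 = 0); last exact/val_inj.
  congr (_ + _).
  by apply: eq_bigr => j _; rewrite row_mxEr [x^T _ _]mxE [g _ _ _]mxE extE mxE mulrC.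
exists b, g; split.
  move=> a a1 v vK.
  have {vK} [i ->] : exists i : 'I_#|K|, v = enum_val i.
    by exists (enum_rank_in vK v); rewrite enum_rankK_in.
  rewrite bg -a1.
  have <- := @yN (\row_i a (enum_val i)) a (fun i => mxE _ _ _ _).
  by rewrite /P -mulmxA mulmxVp// mulmx1 mxE.
move=> x; pose w := row_mx 1%:M x^T *m P.
have wN : w *m N = row_mx 1%:M x^T by rewrite /w -mulmxA mulVpmx// mulmx1.
have := @yN w (fun v => b v + dotv (g v) x) (fun i => esym (bg x i)).
rewrite wN => /eq_row_mx[/matrixP/(_ 0 0) H1 /(congr1 trmx)].
rewrite !trmxK => H2; split=> //.
by move: H1; rewrite !mxE eqxx !mulr1n.
Qed.

Definition vertices_bound : R := \sum_(v : V) \sum_(i < d) `|pt v i 0|.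

Lemma hull_bounded S x i : hull pt S x -> `|x i 0| <= vertices_bound.
Proof.
move=> [a [a0 a1 ->]]; rewrite summxE (le_trans (ler_norm_sum _ _ _))//.
have aS v : v \in S -> a v <= 1.
  move=> vS; rewrite -a1 (bigD1 v)//= lerDl sumr_ge0// => w /andP[wS _]; exact: a0.
apply: (@le_trans _ _ (\sum_(v in S) `|pt v i 0|)).
  apply: ler_sum => v vS; rewrite mxE normrM ger0_norm ?a0//.
  by rewrite ler_piMl ?aS.
rewrite /vertices_bound big_mkcond /=; apply: ler_sum => v _.
have : `|pt v i 0| <= \sum_(j < d) `|pt v j 0|.
  by rewrite (bigD1 i)//= lerDl sumr_ge0.
by case: ifP => // _ _; rewrite sumr_ge0.
Qed.

Lemma open_hullW S : open_hull pt S `<=` hull pt S.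
Proof. by move=> x [a [a0 a1 ->]]; exists a; split=> // v /a0/ltW. Qed.

Lemma hull_vertex S v : v \in S -> hull pt S (pt v).
Proof.
move=> vS; exists (fun w => (w == v)%:R); split.
- by move=> w _; rewrite ler0n.
- by rewrite (bigD1 v)//= eqxx big1 ?addr0// => w /andP[_ /negbTE ->].
- rewrite (bigD1 v)//= eqxx scale1r big1 ?addr0// => w /andP[_ /negbTE ->].
  by rewrite scale0r.
Qed.

Lemma open_open_hull K : Defs.nondegenerate pt K -> open (open_hull pt K).
Proof.
move=> /barycentric[b [g [H1 H2]]].
have -> : open_hull pt K =
    \bigcap_(v in [set v | v \in K]) [set x | 0 < b v + dotv (g v) x].
  apply/seteqP; split=> [x [a [a0 a1 ->]] v /= vK|x Hx].
    by rewrite H1// a0.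
  exists (fun v => b v + dotv (g v) x); have [? ?] := H2 x; split=> //.
rewrite -closedC setC_bigcap; apply: closed_bigcup; first exact: finite_finset.
move=> v _; rewrite closedC.
apply: (@open_comp _ _ (fun x => b v + dotv (g v) x) [set y : R | 0 < y]).
  by move=> x _; exact: continuous_affine.
exact: open_gt.
Qed.

Lemma closed_hull K : Defs.nondegenerate pt K -> closed (hull pt K).
Proof.
move=> /barycentric[b [g [H1 H2]]].
have -> : hull pt K =
    \bigcap_(v in [set v | v \in K]) [set x | 0 <= b v + dotv (g v) x].
  apply/seteqP; split=> [x [a [a0 a1 ->]] v /= vK|x Hx].
    by rewrite H1// a0.
  exists (fun v => b v + dotv (g v) x); have [? ?] := H2 x; split=> //.
apply: closed_bigI => v _.
apply: (@preimage_closed _ _ (fun x => b v + dotv (g v) x) [set y : R | 0 <= y]).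
  by move=> x _; exact: continuous_affine.
exact: closed_ge.
Qed.

Lemma open_hull_neq0 K : Defs.nondegenerate pt K -> open_hull pt K !=set0.
Proof.
move=> [cK _]; exists (\sum_(v in K) (#|K|%:R)^-1 *: pt v).
have K0 : #|K|%:R != 0 :> R by rewrite cK pnatr_eq0.
exists (fun=> (#|K|%:R)^-1); split=> //.
- by move=> v _; rewrite invr_gt0 lt_neqAle eq_sym K0 ler0n.
- by rewrite sumr_const -[_ *+ _]mulr_natr mulVf.
Qed.

Lemma nondegenerate_inj K v w : Defs.nondegenerate pt K -> v \in K -> w \in K ->
  pt v = pt w -> v = w.
Proof.
move=> /barycentric[b [g [H1 _]]] vK wK vw; apply/eqP/negPn/negP => nvw.
have sv u : u \in K -> \sum_(z in K) (z == u)%:R = 1 :> R.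
  by move=> uK; rewrite (bigD1 u)//= eqxx big1 ?addr0// => z /andP[_ /negbTE ->].
have pv u : u \in K -> \sum_(z in K) (z == u)%:R *: pt z = pt u.
  move=> uK; rewrite (bigD1 u)//= eqxx scale1r big1 ?addr0// => z /andP[_ /negbTE ->].
  by rewrite scale0r.
have := H1 _ (sv v vK) v vK; have := H1 _ (sv w wK) v vK.
rewrite !pv// vw eqxx (negbTE nvw) => ->.
by move=> /eqP; rewrite eq_sym oner_eq0.
Qed.

Lemma diam_gt0 K : (0 < d)%N -> Defs.nondegenerate pt K -> 0 < diam pt K.
Proof.
move=> d0 nK; have [cK _] := nK.
have [v [w [vK wK vw]]] : exists v w, [/\ v \in K, w \in K & v != w].
  have : (1 < #|K|)%N by rewrite cK.
  by move=> /card_gt1P[v [w [? ? ?]]]; exists v, w.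
have dvw : 0 < normv (pt v - pt w).
  rewrite /normv sqrtr_gt0 lt_neqAle dotvv_ge0 andbT eq_sym.
  apply: contraNneq vw => /dotvv_eq0/eqP; rewrite subr_eq0 => /eqP.
  by move=> /(nondegenerate_inj nK vK wK) ->.
apply: (lt_le_trans dvw); apply: ub_le_sup.
  (* A supremum bounds its set only if the set is bounded above, so an explicit bound of the
     distances is supplied. *)
  exists (Num.sqrt (\sum_(i < d) (vertices_bound *+ 2) ^+ 2)).
  move=> _ [x [y [Kx Ky ->]]]; rewrite ler_sqrt.
    apply: ler_sum => i _; rewrite -expr2 -real_normK ?num_real//.
    rewrite lerXn2r ?nnegrE ?normr_ge0//.
      by rewrite mulrn_wge0// (le_trans _ (hull_bounded i Kx)).
    rewrite !mxE (le_trans (ler_normB _ _))// mulr2n.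
    by rewrite lerD ?(hull_bounded _ Kx) ?(hull_bounded _ Ky).
  by apply: sumr_ge0 => i _; rewrite sqr_ge0.
by exists (pt v), (pt w); split=> //; exact: hull_vertex.
Qed.

(** The default value 0 of [xget] has to be excluded by exhibiting an outward unit normal. It is
    minus the normalized gradient of the barycentric coordinate of [v], which is 0 at the vertices
    of the facet and 1 at [v]. The gradient is nonzero because the facet has a vertex when d > 0. *)
Lemma normal_unit K v : (0 < d)%N -> Defs.nondegenerate pt K -> v \in K ->
  dotv (normal pt K v) (normal pt K v) = 1.
Proof.
move=> d0 nK vK; have [b [g [H1 H2]]] := barycentric nK.
have val u w : u \in K -> w \in K -> b u + dotv (g u) (pt w) = (w == u)%:R.
  move=> uK wK; have := H1 (fun z => (z == w)%:R).
  rewrite (bigD1 w)//= eqxx big1 ?addr0; last by move=> z /andP[_ /negbTE ->].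
  move=> /(_ erefl u uK); rewrite (bigD1 w)//= eqxx scale1r big1 ?addr0.
    by rewrite eq_sym.
  by move=> z /andP[_ /negbTE ->]; rewrite scale0r.
have [w wK wv] : exists2 w, w \in K & w != v.
  have : (0 < #|K :\ v|)%N by have := cardsD1 v K; rewrite vK nK.1 add1n => -[<-].
  by move=> /card_gt0P[w]; rewrite !inE => /andP[? ?]; exists w.
have gvw z : z \in K -> z != v -> dotv (g v) (pt v - pt z) = 1.
  move=> zK zv; have := val v z vK zK; have := val v v vK vK.
  rewrite eqxx (negbTE zv) dotvBr mulr1n mulr0n => E1 E2; lra.
have gg : 0 < dotv (g v) (g v).
  rewrite lt_neqAle dotvv_ge0 andbT eq_sym; apply/eqP => /dotvv_eq0 g0.
  by have := gvw w wK wv; rewrite g0 dotv0l => /eqP; rewrite eq_sym oner_eq0.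
have g2 : 0 < normv (g v) by rewrite sqrtr_gt0.
suff : [set n | [/\ dotv n n = 1,
    forall w w', w \in K :\ v -> w' \in K :\ v -> dotv n (pt w - pt w') = 0 &
    forall w, w \in K :\ v -> dotv n (pt v - pt w) < 0]] (normal pt K v) by case.
rewrite /normal; apply: xgetPex; exists (- (normv (g v))^-1 *: g v); split.
- rewrite dotvZl dotvZr mulrA mulrNN -invfM -expr2 normv_sqr mulVf//.
  exact: lt0r_neq0.
- move=> z z'; rewrite !inE => /andP[zv zK] /andP[z'v z'K].
  rewrite dotvZl dotvBr.
  have := val v z vK zK; have := val v z' vK z'K.
  rewrite (negbTE zv) (negbTE z'v) mulr0n => E1 E2.
  by rewrite (_ : _ - _ = 0) ?mulr0//; lra.
- move=> z; rewrite !inE => /andP[zv zK].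
  by rewrite dotvZl gvw// mulr1 oppr_lt0 invr_gt0.
Qed.

End simplex_geometry.

(** * Integrals over simplices and their facets *)

(** The segment [G] from the Gram matrix to the identity consists of positive definite, hence
    nonsingular, matrices. The determinant is continuous along it and equals 1 at the end, so by the
    intermediate value theorem it cannot start at a nonpositive value. *)
Lemma det_gram_gt0 {R : realType} (m n : nat) (E : 'M[R]_(m, n)) :
  row_free E -> 0 < \det (E *m E^T).
Proof.
move=> fE; pose G s : 'M[R]_m := s *: 1%:M + (1 - s) *: (E *m E^T).
have G_neq0 s : 0 <= s <= 1 -> \det (G s) != 0.
  move=> /andP[s0 s1]; apply/det0P => -[v v0 vG].
  have := congr1 (fun M => (M *m v^T) 0 0) vG.
  rewrite mul0mx [RHS]mxE /G mulmxDr -!scalemxAr mulmx1 mulmxDl -!scalemxAl.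
  rewrite mxE [X in X + _]mxE [X in _ + X]mxE => H.
  have sq k (w : 'rV[R]_k) : (w *m w^T) 0 0 = \sum_i w 0 i ^+ 2.
    by rewrite mxE; apply: eq_bigr => i _; rewrite mxE expr2.
  have sq0 k (w : 'rV[R]_k) : 0 <= (w *m w^T) 0 0.
    by rewrite sq sumr_ge0// => i _; rewrite sqr_ge0.
  have sq_eq0 k (w : 'rV[R]_k) : (w *m w^T) 0 0 = 0 -> w = 0.
    rewrite sq => /eqP; rewrite psumr_eq0 => [/allP wi|i _]; last by rewrite sqr_ge0.
    apply/rowP => i; rewrite mxE; have := wi i (mem_index_enum i).
    by rewrite /= sqrf_eq0 => /eqP.
  rewrite (_ : v *m (E *m E^T) *m v^T = (v *m E) *m (v *m E)^T) in H; last first.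
    by rewrite trmx_mul !mulmxA.
  move/eqP : H; rewrite paddr_eq0 ?mulr_ge0// ?subr_ge0// => /andP[].
  rewrite !mulf_eq0 => /orP[/eqP ->|/eqP /sq_eq0 ve]; last by rewrite ve eqxx in v0.
  rewrite subr0 oner_eq0 /= => /eqP/sq_eq0 vE.
  by move/negP : v0; apply; apply/eqP/(row_free_inj fE); rewrite mul0mx.
have cGij i j : continuous (fun s => G s i j).
  have -> : (fun x => G x i j) =
      fun x : R => x * (1%:M : 'M[R]_m) i j + (1 - x) * (E *m E^T) i j.
    by apply/funext => x; rewrite [LHS]mxE [X in X + _ = _]mxE [X in _ + X = _]mxE.
  move=> s; apply: cvgD; apply: cvgMr_tmp; first exact: cvg_id.
  by apply: cvgB; [exact: cvg_cst|exact: cvg_id].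
have cG : continuous (fun s => \det (G s)).
  move=> s; apply: cvg_sum => p _; apply: cvgM; first exact: cvg_cst.
  apply: cvg_big => [|i _]; first exact: mul_continuous.
  exact: cGij.
have G0 : G 0 = E *m E^T by rewrite /G scale0r add0r subr0 scale1r.
have G1 : \det (G 1) = 1 by rewrite /G subrr scale0r addr0 scale1r det1.
rewrite ltNge -G0; apply/negP => dG.
have [||c] := @IVT R (fun s => \det (G s)) 0 1 0 ler01.
- exact: continuous_subspaceT.
- by rewrite G1 ge_min le_max dG ler01 orbT.
by rewrite in_itv /= => /G_neq0 /eqP.
Qed.

Section reference_simplex.
Context {R : realType} {m : nat}.

Let ref : set 'cV[R]_m := [set y | (forall i, 0 <= y i 0) /\ \sum_i y i 0 <= 1].

Lemma ref_simplexE : @ref_simplex R m = @col_of_tuple R m @^-1` ref.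
Proof.
apply/seteqP; split=> t /= [H1 H2]; split.
- by move=> i; rewrite mxE.
- by under eq_bigr do rewrite mxE.
- by move=> i; have := H1 i; rewrite mxE.
- by move: H2; under eq_bigr do rewrite mxE.
Qed.

Let continuous_sum_coord : continuous (fun y : 'cV[R]_m => \sum_i y i 0).
Proof. by apply: continuous_sum => i _; exact: coord_continuous. Qed.

Lemma measurable_ref_simplex : measurable (@ref_simplex R m).
Proof.
rewrite ref_simplexE; apply: closed_col_measurable; apply: closedI.
  rewrite [X in closed X](_ : _ = \bigcap_(i in [set: 'I_m]) [set y : 'cV[R]_m | 0 <= y i 0]).
    apply: closed_bigI => i _.
    apply: (@preimage_closed _ _ (fun y : 'cV[R]_m => y i 0) [set r : R | 0 <= r]).
      by move=> y _; exact: coord_continuous.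
    exact: closed_ge.
  by apply/seteqP; split=> y /= H i; [move=> _; exact: H|exact: (H i I)].
apply: (@preimage_closed _ _ (fun y : 'cV[R]_m => \sum_i y i 0) [set r : R | r <= 1]).
  by move=> y _; exact: continuous_sum_coord.
exact: closed_le.
Qed.

Lemma ref_simplex_bounded (t : m.-tuple R) i : ref_simplex t -> `|tnth t i| <= 1.
Proof.
move=> [t0 t1]; rewrite ger0_norm ?t0//; apply: le_trans t1.
by rewrite (bigD1 i)//= lerDl sumr_ge0.
Qed.

(** The general vanishing result covers only the open simplex. The boundary is reached by continuity
    along a segment leading inside, and this matters because traces have to vanish on the closed
    facet. *)
Lemma ref_simplex_Rintegral_eq0 (g : 'cV[R]_m -> R) : continuous g ->
  (forall t, ref_simplex t -> 0 <= g (col_of_tuple t)) ->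
  \int[lebesgue_tuple m]_(t in @ref_simplex R m) g (col_of_tuple t) = 0 ->
  forall t, ref_simplex t -> g (col_of_tuple t) = 0.
Proof.
move=> cg g0 Ig t rt.
pose U : set 'cV[R]_m := (\bigcap_(i in [set: 'I_m]) [set y | 0 < y i 0]) `&`
   [set y | \sum_i y i 0 < 1].
have oU : open U.
  apply: openI.
    rewrite -closedC setC_bigcap; apply: closed_bigcup; first exact: finite_finset.
    move=> i _; rewrite closedC.
    apply: (@open_comp _ _ (fun y : 'cV[R]_m => y i 0) [set r : R | 0 < r]).
      by move=> y _; exact: coord_continuous.
    exact: open_gt.
  apply: (@open_comp _ _ (fun y : 'cV[R]_m => \sum_i y i 0) [set r : R | r < 1]).
    by move=> y _; exact: continuous_sum_coord.
  exact: open_lt.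
have gU : forall x, U x -> g x = 0.
  apply: (Rintegral_continuous_eq0 cg measurable_ref_simplex) Ig => //.
  - by move=> s i; exact: ref_simplex_bounded.
  - rewrite ref_simplexE => s [/= H1 H2]; split; last exact: ltW.
    by move=> i; apply/ltW/H1.
pose y : 'cV[R]_m := col_of_tuple t.
(* This is the barycentre of the reference simplex with its origin vertex counted, hence m + 1 in
   the denominator; moving from y towards it enters the interior at once. *)
pose c : 'cV[R]_m := const_mx (m.+1%:R^-1).
pose p (s : R) : 'cV[R]_m := (1 - s) *: y + s *: c.
have m0 : 0 < m.+1%:R :> R by rewrite ltr0n.
have pU s : 0 < s <= 1 -> U (p s).
  move=> /andP[s0 s1]; split=> [i _|] /=.
    rewrite !mxE ltr_wpDl// ?mulr_gt0 ?invr_gt0//.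
    by rewrite mulr_ge0 ?subr_ge0// rt.1.
  under eq_bigr do rewrite /p /y /c !mxE.
  rewrite big_split /= -!mulr_sumr sumr_const card_ord -[_ *+ m]mulr_natr.
  have H1 : (1 - s) * \sum_(i < m) tnth t i <= 1 - s.
    by rewrite ler_piMr ?subr_ge0// rt.2.
  have H2 : s * (m.+1%:R^-1 * m%:R) < s.
    rewrite gtr_pMr// mulrC ltr_pdivrMr// mul1r ltr_nat//.
  move: H1 H2; set A := \sum_(_ < m) _; set B := _ * m%:R.
  lra.
have p0 : p 0 = y by rewrite /p subr0 scale1r scale0r addr0.
have cp : continuous (fun s => g (p s)).
  move=> s; apply: (@continuous_comp _ _ _ p g); last exact: cg.
  rewrite /p; apply: cvgD; apply: cvgZr_tmp; last exact: cvg_id.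
  by apply: cvgB; [exact: cvg_cst|exact: cvg_id].
apply/eqP/negPn/negP => gy.
have : \forall s \near (0 : R), g (p s) != 0.
  by apply: (@cvgr_neq0 _ _ _ (nbhs (0 : R)) _ _ (g (p 0)) (cp 0)); rewrite p0.
move=> /nbhs_ballP[e /= e0 He].
have : g (p (Num.min (e / 2) 1)) != 0.
  apply: He; rewrite /ball /= sub0r normrN ger0_norm.
    by rewrite gt_min ltr_pdivrMr// ltr_pMr// ltrDl ltr01.
  by rewrite le_min ler01 andbT divr_ge0// ltW.
rewrite gU ?eqxx//; apply: pU.
by rewrite lt_min ltr01 andbT divr_gt0//= ge_min lexx orbT.
Qed.

End reference_simplex.

Section simplex_integrals.
Context {R : realType} {d : nat} {V : finType} (pt : V -> 'cV[R]_d).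
Implicit Types (K F : {set V}) (g h : 'cV[R]_d -> R).

Lemma elem_int_eq K g h : (forall x, open_hull pt K x -> g x = h x) ->
  elem_int pt K g = elem_int pt K h.
Proof. by move=> gh; apply: eq_Rintegral => t /[!inE] /= Kt; exact: gh. Qed.

Lemma measurable_open_hull K : Defs.nondegenerate pt K ->
  measurable (@col_of_tuple R d @^-1` open_hull pt K).
Proof. by move=> nK; apply: open_col_measurable; exact: open_open_hull. Qed.

Lemma open_hull_tuple_bounded K (t : d.-tuple R) i :
  (@col_of_tuple R d @^-1` open_hull pt K) t -> `|tnth t i| <= vertices_bound pt.
Proof. by move=> /open_hullW /(hull_bounded i); rewrite mxE. Qed.

Lemma elem_integrable K g : Defs.nondegenerate pt K -> continuous g ->
  (lebesgue_tuple d).-integrable (@col_of_tuple R d @^-1` open_hull pt K)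
    (EFin \o (g \o @col_of_tuple R d)).
Proof.
move=> nK cg; apply: (continuous_integrable cg (measurable_open_hull nK)) => t i.
exact: open_hull_tuple_bounded.
Qed.

Lemma elem_int_lin K (c : R) g h : Defs.nondegenerate pt K -> continuous g -> continuous h ->
  elem_int pt K (fun x => c * g x + h x) = c * elem_int pt K g + elem_int pt K h.
Proof.
move=> nK cg ch; have mK := measurable_open_hull nK.
have ig := elem_integrable nK cg; have ih := elem_integrable nK ch.
rewrite /elem_int /vol_int.
rewrite (@RintegralD _ _ _ (lebesgue_tuple d) _ (fun t => c * g (col_of_tuple t)))//.
  by rewrite (@RintegralZl _ _ _ (lebesgue_tuple d) _ (fun t => g (col_of_tuple t))).
have -> : EFin \o (fun t : d.-tuple R => c * g (col_of_tuple t)) =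
   (fun t => (c%:E * (EFin \o (g \o @col_of_tuple R d)) t)%E) by apply/funext.
exact: integrableZl.
Qed.

Lemma elem_int_ge0 K g : (forall x, open_hull pt K x -> 0 <= g x) -> 0 <= elem_int pt K g.
Proof. by move=> g0; apply: Rintegral_ge0 => t /= Kt; exact: g0. Qed.

Lemma elem_int_eq0 K g : Defs.nondegenerate pt K -> continuous g ->
  (forall x, open_hull pt K x -> 0 <= g x) -> elem_int pt K g = 0 ->
  forall x, open_hull pt K x -> g x = 0.
Proof.
move=> nK cg g0 Ig; have mK := measurable_open_hull nK.
apply: (Rintegral_continuous_eq0 cg mK) Ig => //.
- by move=> t i; exact: open_hull_tuple_bounded.
- exact: open_open_hull.
- by move=> t; exact: g0.
Qed.

Definition facet_param F (y : 'cV[R]_d.-1) : 'cV[R]_d :=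
  let s := [seq pt v | v <- enum F] in
  s`_0 + \sum_(i < d.-1) y i 0 *: (s`_i.+1 - s`_0).

Definition facet_jacobian F : R :=
  let s := [seq pt v | v <- enum F] in
  Num.sqrt (\det (\matrix_(i < d.-1, j < d.-1) dotv (s`_i.+1 - s`_0) (s`_j.+1 - s`_0))).

Lemma facet_intE F g : facet_int pt F g = facet_jacobian F *
  \int[lebesgue_tuple d.-1]_(t in @ref_simplex R d.-1) g (facet_param F (col_of_tuple t)).
Proof.
rewrite /facet_int; congr (_ * _); apply: eq_Rintegral => t _.
by congr g; congr (_ + _); apply: eq_bigr => i _; rewrite mxE.
Qed.

Lemma continuous_facet_param F : continuous (facet_param F).
Proof.
move=> y; apply: (@continuousD _ _ _ (cst _)); first exact: cst_continuous.
apply: continuous_sum => i _ x.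
exact: (@cvgZr_tmp _ _ _ (nbhs x) _ _ _ _ (@coord_continuous _ _ _ i 0 x)).
Qed.

Lemma big_facet F (W : nmodType) (h : V -> W) v0 : (0 < d)%N -> #|F| = d ->
  \sum_(v in F) h v =
  h (nth v0 (enum F) 0) + \sum_(i < d.-1) h (nth v0 (enum F) i.+1).
Proof.
move=> d0 cF; rewrite -big_enum (big_nth v0) -cardE cF -{1}(prednK d0).
by rewrite big_mkord big_ord_recl.
Qed.

(** Weights are indexed in the order of [enum F], whose first vertex is the common origin of the
    edges in [facet_int]; this causes the shift by one. *)
Let facet_coef F (c : R) (y : nat -> R) v : R :=
  if index v (enum F) is j.+1 then y j else c.

Let facet_coefE F c y v0 i : (i < #|F|)%N ->
  facet_coef F c y (nth v0 (enum F) i) = if i is j.+1 then y j else c.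
Proof. by move=> iF; rewrite /facet_coef index_uniq ?enum_uniq// -cardE. Qed.

Lemma facet_vertexE F v0 i : (i < #|F|)%N ->
  [seq pt v | v <- enum F]`_i = pt (nth v0 (enum F) i).
Proof. by move=> iF; rewrite (nth_map v0)// -cardE. Qed.

Let ltF F (i : 'I_d.-1) : (0 < d)%N -> #|F| = d -> (i.+1 < #|F|)%N.
Proof. by move=> d0 ->; rewrite -[X in (_ < X)%N](prednK d0) ltnS. Qed.

(** Used with two total weights: weight 1 identifies the parametrized simplex with the hull, and
    weight 0 turns affine independence of the vertices into linear independence of the edges. *)
Lemma facet_param_affine F v0 (a : V -> R) : (0 < d)%N -> #|F| = d ->
  \sum_(v in F) a v *: pt v = (\sum_(v in F) a v) *: [seq pt v | v <- enum F]`_0 +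
   \sum_(i < d.-1) a (nth v0 (enum F) i.+1) *:
      ([seq pt v | v <- enum F]`_i.+1 - [seq pt v | v <- enum F]`_0).
Proof.
move=> d0 cF; rewrite !(big_facet _ v0)// scalerDl -addrA; congr (_ + _).
  by rewrite (facet_vertexE v0)// cF.
rewrite scaler_suml -big_split /=; apply: eq_bigr => i _.
by rewrite scalerBr addrC subrK (facet_vertexE v0)// ltF.
Qed.

Lemma hull_facet_param F (t : d.-1.-tuple R) : (0 < d)%N -> #|F| = d ->
  ref_simplex t -> hull pt F (facet_param F (col_of_tuple t)).
Proof.
move=> d0 cF [t0 t1].
have /card_gt0P[v0 v0F] : (0 < #|F|)%N by rewrite cF.
pose y j := nth 0 t j; pose a := facet_coef F (1 - \sum_(i < d.-1) tnth t i) y.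
have ay (i : 'I_d.-1) : a (nth v0 (enum F) i.+1) = tnth t i.
  by rewrite /a facet_coefE ?ltF// /y (tnth_nth 0).
have a1 : \sum_(v in F) a v = 1.
  rewrite (big_facet _ v0)// (eq_bigr (fun i => tnth t i)) => [|i _]; last exact: ay.
  by rewrite {1}/a facet_coefE ?cF// subrK.
exists a; split=> //.
- move=> v vF; rewrite /a /facet_coef; case E : (index v (enum F)) => [|j].
    by rewrite subr_ge0.
  have jd : (j < d.-1)%N.
    by rewrite -ltnS (prednK d0) -cF cardE -E index_mem mem_enum.
  by rewrite /y (_ : nth 0 t j = tnth t (Ordinal jd)) ?t0// (tnth_nth 0).
- rewrite (facet_param_affine v0)// a1 scale1r /facet_param; congr (_ + _).
  by apply: eq_bigr => i _; rewrite ay mxE.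
Qed.

Lemma facet_param_surj F x : (0 < d)%N -> #|F| = d -> hull pt F x ->
  exists2 t : d.-1.-tuple R, ref_simplex t & x = facet_param F (col_of_tuple t).
Proof.
move=> d0 cF [a [a0 a1 ->]].
have /card_gt0P[v0 v0F] : (0 < #|F|)%N by rewrite cF.
have memF i : (i < #|F|)%N -> nth v0 (enum F) i \in F.
  by move=> iF; rewrite -mem_enum mem_nth// -cardE.
exists [tuple a (nth v0 (enum F) i.+1) | i < d.-1].
  split=> [i|]; first by rewrite tnth_mktuple a0// memF// ltF.
  under eq_bigr do rewrite tnth_mktuple.
  by rewrite -a1 [leRHS](big_facet _ v0)// lerDr a0// memF// cF.
rewrite (facet_param_affine v0)// a1 scale1r /facet_param; congr (_ + _).
by apply: eq_bigr => i _; rewrite mxE tnth_mktuple.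
Qed.

Lemma facet_jacobian_gt0 F : (0 < d)%N -> #|F| = d -> affinely_independent pt F ->
  0 < facet_jacobian F.
Proof.
move=> d0 cF aF; have /card_gt0P[v0 v0F] : (0 < #|F|)%N by rewrite cF.
pose s := [seq pt v | v <- enum F].
pose E : 'M[R]_(d.-1, d) := \matrix_(i, j) (s`_i.+1 - s`_0) j 0.
rewrite /facet_jacobian sqrtr_gt0 [X in \det X](_ : _ = E *m E^T).
  apply: det_gram_gt0; apply: inj_row_free => y yE.
  pose z j : R := if insub j is Some i then y 0 (i : 'I_d.-1) else 0.
  (* A linear relation between the edges becomes an affine one between the vertices once the base
     vertex receives minus the sum of the coefficients. *)
  pose a := facet_coef F (- \sum_(i < d.-1) y 0 i) z.
  have ay (i : 'I_d.-1) : a (nth v0 (enum F) i.+1) = y 0 i.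
    by rewrite /a facet_coefE ?ltF// /z valK.
  have a0 : \sum_(v in F) a v = 0.
    rewrite (big_facet _ v0)// (eq_bigr (fun i => y 0 i)) => [|i _]; last exact: ay.
    by rewrite {1}/a facet_coefE ?cF// addNr.
  have a1 : \sum_(v in F) a v *: pt v = 0.
    rewrite (facet_param_affine v0)// a0 scale0r add0r.
    apply/colP => j; rewrite summxE [RHS]mxE.
    have /rowP/(_ j) := yE; rewrite mxE [RHS]mxE => H; rewrite -[RHS]H.
    by apply: eq_bigr => i _; rewrite [LHS]mxE ay [E _ _]mxE.
  apply/rowP => i; rewrite mxE -ay; apply: aF => //.
  by rewrite -mem_enum mem_nth// -cardE ltF.
apply/matrixP => i j; rewrite mxE [RHS]mxE; apply: eq_bigr => k _.
by rewrite [E^T _ _]mxE ![E _ _]mxE.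
Qed.

Lemma facet_int_eq F g h : (0 < d)%N -> #|F| = d ->
  (forall x, hull pt F x -> g x = h x) -> facet_int pt F g = facet_int pt F h.
Proof.
move=> d0 cF gh; rewrite !facet_intE; congr (_ * _).
by apply: eq_Rintegral => t /[!inE] rt; apply: gh; exact: hull_facet_param.
Qed.

(** A trace is constrained facet by facet and arbitrary elsewhere, so it need not be continuous on
    the space; for integration over [F] it is replaced by a continuous representative. *)
Definition facet_continuous F g : Prop :=
  exists2 G : 'cV[R]_d -> R, continuous G & forall x, hull pt F x -> g x = G x.

Lemma facet_int_lin F (c : R) g h : (0 < d)%N -> #|F| = d ->
  facet_continuous F g -> facet_continuous F h ->
  facet_int pt F (fun x => c * g x + h x) = c * facet_int pt F g + facet_int pt F h.
Proof.
move=> d0 cF [G cG gG] [H cH hH].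
rewrite (facet_int_eq d0 cF (h := fun x => c * G x + H x)); last first.
  by move=> x Fx; rewrite gG// hH.
rewrite (facet_int_eq d0 cF gG) (facet_int_eq d0 cF hH) !facet_intE.
have int f : continuous f -> (lebesgue_tuple d.-1).-integrable (@ref_simplex R d.-1)
    (EFin \o ((f \o facet_param F) \o @col_of_tuple R d.-1)).
  move=> cf; apply: (continuous_integrable _ measurable_ref_simplex).
    by move=> y; apply: continuous_comp; [exact: continuous_facet_param|exact: cf].
  by move=> t i; exact: ref_simplex_bounded.
rewrite mulrCA -mulrDr; congr (_ * _).
rewrite (@RintegralD _ _ _ (lebesgue_tuple d.-1) _
  (fun t => c * G (facet_param F (col_of_tuple t))))//.
- rewrite (@RintegralZl _ _ _ (lebesgue_tuple d.-1) _
    (fun t => G (facet_param F (col_of_tuple t))))//; last exact: (int G cG).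
  exact: measurable_ref_simplex.
- exact: measurable_ref_simplex.
- have -> : EFin \o (fun t : d.-1.-tuple R => c * G (facet_param F (col_of_tuple t))) =
     (fun t => (c%:E * (EFin \o ((G \o facet_param F) \o @col_of_tuple R d.-1)) t)%E).
    by apply/funext.
  by apply: integrableZl; [exact: measurable_ref_simplex|exact: int].
- exact: (int H cH).
Qed.

Lemma facet_int_ge0 F g : (0 < d)%N -> #|F| = d ->
  (forall x, hull pt F x -> 0 <= g x) -> 0 <= facet_int pt F g.
Proof.
move=> d0 cF g0; rewrite facet_intE mulr_ge0 ?sqrtr_ge0//.
by apply: Rintegral_ge0 => t rt; apply: g0; exact: hull_facet_param.
Qed.

Lemma facet_int_eq0 F g : (0 < d)%N -> #|F| = d -> affinely_independent pt F ->
  facet_continuous F g -> (forall x, hull pt F x -> 0 <= g x) -> facet_int pt F g = 0 ->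
  forall x, hull pt F x -> g x = 0.
Proof.
move=> d0 cF aF [G cG gG] g0; rewrite (facet_int_eq d0 cF gG) facet_intE => /eqP.
rewrite mulf_eq0 gt_eqF ?facet_jacobian_gt0//= => /eqP I0 x Fx.
rewrite gG//; have [t rt ->] := facet_param_surj d0 cF Fx.
apply: (@ref_simplex_Rintegral_eq0 _ _ (G \o facet_param F)) => //.
  by move=> y; apply: continuous_comp; [exact: continuous_facet_param|exact: cG].
by move=> s rs /=; rewrite -gG ?g0//; exact: hull_facet_param.
Qed.

End simplex_integrals.

(** * Semi-discrete problems in nodal coordinates *)

(* A nodal family that is maximal in size is a basis: a member of S that is not its own
   interpolant would provide one more node. *)
Lemma nodal_basis (K : fieldType) (X : lmodType K) (A : Type) (S : X -> Prop)
    (ev : X -> A -> K) (N : nat) (bf : 'I_N -> A -> K) :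
  (forall c x y, S x -> S y -> S (c *: x + y)) -> S 0 ->
  (forall c x y a, ev (c *: x + y) a = c * ev x a + ev y a) ->
  (forall x, S x -> exists c : 'I_N -> K, forall a, ev x a = \sum_i c i * bf i a) ->
  exists (m : nat) (nd : 'I_m -> A) (e : 'I_m -> X),
    [/\ forall j, S (e j), forall j l, ev (e j) (nd l) = (j == l)%:R &
      forall x, S x -> forall a, ev x a = \sum_j ev x (nd j) * ev (e j) a].
Proof.
move=> Slin S0 evlin fin.
pose nodal m := exists (nd : 'I_m -> A) (e : 'I_m -> X),
  (forall j, S (e j)) /\ forall j l, ev (e j) (nd l) = (j == l)%:R.
have nodal_le m : nodal m -> (m <= N)%N.
  move=> [nd [e [Se end_]]].
  have [C HC] := choice (fun j => fin (e j) (Se j)).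
  (* The values of m nodal functions at their nodes form an identity matrix that factors through the
     N spanning functions. *)
  apply: (@mulmx1_min _ _ _ (\matrix_(j, i) C j i) (\matrix_(i, l) bf i (nd l))).
  apply/matrixP => j l; rewrite !mxE -end_ HC.
  by apply: eq_bigr => i _; rewrite !mxE.
have ex : exists m, `[< nodal m >].
  have nd0 : 'I_0 -> A by case.
  by exists 0%N; apply/asboolP; exists nd0, (fun=> 0); split=> -[].
have le m : `[< nodal m >] -> (m <= N)%N by move=> /asboolP; exact: nodal_le.
case: (ex_maxnP ex le) => m /asboolP[nd [e [Se end_]]] mmax.
exists m, nd, e; split=> // x Sx a; apply/eqP/negPn/negP => xa.
have ev0 b : ev 0 b = 0 by have := evlin (- 1) 0 0 b; rewrite scaler0 addr0 mulN1r addNr.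
have evsum (I : finType) (c : I -> K) (f : I -> X) b :
    ev (\sum_i c i *: f i) b = \sum_i c i * ev (f i) b.
  by elim/big_rec2 : _ => // i u v _ <-; rewrite evlin.
have Ssum (I : finType) (c : I -> K) (f : I -> X) : (forall i, S (f i)) ->
    S (\sum_i c i *: f i).
  by move=> Sf; elim/big_rec : _ => // i u _ Su; exact: Slin.
(* The interpolation error: it vanishes at all nodes and, by contradiction hypothesis, not at
   [a]. *)
pose r := (- 1) *: (\sum_j ev x (nd j) *: e j) + x.
have Sr : S r by apply: Slin => //; exact: Ssum.
have rnd l : ev r (nd l) = 0.
  rewrite evlin evsum (bigD1 l)//= end_ eqxx mulr1 big1 ?addr0 ?mulN1r ?addNr// => j jl.
  by rewrite end_ (negbTE jl) mulr0.
have ra : ev r a != 0 by rewrite evlin evsum mulN1r addrC subr_eq0.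
pose f := (ev r a)^-1 *: r.
have evf b : ev f b = (ev r a)^-1 * ev r b.
  by rewrite /f -[_ *: r]addr0 evlin ev0 addr0.
pose nd' (i : 'I_m.+1) := if unlift ord_max i is Some j then nd j else a.
(* The rescaled error [f] belongs to the new node [a], and each old function is corrected by a
   multiple of [f] so as to vanish there; its values at the old nodes are unaffected. *)
pose e' (i : 'I_m.+1) := if unlift ord_max i is Some j then (- ev (e j) a) *: f + e j else f.
have Sf : S f by rewrite /f -[_ *: r]addr0; exact: Slin.
suff : nodal m.+1 by move=> /asboolP/mmax; rewrite ltnn.
exists nd', e'; split=> [i|i l]; rewrite /e' /nd'.
  by case: unliftP => [j _|_] //; exact: Slin.
case: (unliftP ord_max i) => [j ->|->]; case: (unliftP ord_max l) => [k ->|->].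
- rewrite evlin evf rnd !mulr0 add0r end_ (inj_eq lift_inj)//.
- by rewrite evlin evf mulVf// mulr1 addNr eq_sym (negbTE (neq_lift _ _)).
- by rewrite evf rnd mulr0 (negbTE (neq_lift _ _)).
- by rewrite evf mulVf// eqxx.
Qed.

(* Linear systems M(dc, w) + B(c, cb; w, wb) = F(w), differential in c and algebraic in cb:
   cb is eliminated by the invertible form B(0, cb; 0, wb), which leaves a linear
   ordinary differential equation with constant coefficients for the nodal values of c. *)
Section semidiscrete.
Context {R : realType} {X Y : lmodType R} {A1 A2 : Type}.
Context (S1 : X -> Prop) (S2 : Y -> Prop) (ev1 : X -> A1 -> R) (ev2 : Y -> A2 -> R).
Context (N1 N2 : nat) (bf1 : 'I_N1 -> A1 -> R) (bf2 : 'I_N2 -> A2 -> R).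
Hypothesis S1lin : forall c x y, S1 x -> S1 y -> S1 (c *: x + y).
Hypothesis S2lin : forall c x y, S2 x -> S2 y -> S2 (c *: x + y).
Hypothesis S10 : S1 0.
Hypothesis S20 : S2 0.
Hypothesis ev1lin : forall c x y a, ev1 (c *: x + y) a = c * ev1 x a + ev1 y a.
Hypothesis ev2lin : forall c x y a, ev2 (c *: x + y) a = c * ev2 x a + ev2 y a.
Hypothesis fin1 :
  forall x, S1 x -> exists c : 'I_N1 -> R, forall a, ev1 x a = \sum_i c i * bf1 i a.
Hypothesis fin2 :
  forall x, S2 x -> exists c : 'I_N2 -> R, forall a, ev2 x a = \sum_i c i * bf2 i a.

Context (M M0 : X -> X -> R) (B : X -> Y -> X -> Y -> R) (F : R -> X -> R) (F0 : X -> R).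

(** Members of [X] carry data that [ev1] does not see, so the form is required to depend on
    evaluations alone. Definiteness is stated in the form that makes the matrix of the form in a
    nodal basis invertible. *)
Definition mass_form (m : X -> X -> R) :=
  [/\ forall k x y w, S1 x -> S1 y -> S1 w -> m (k *: x + y) w = k * m x w + m y w,
      forall k x y w, S1 x -> S1 y -> S1 w -> m w (k *: x + y) = k * m w x + m w y,
      forall x x' w w', S1 x -> S1 x' -> S1 w -> S1 w' ->
        (forall a, ev1 x a = ev1 x' a) -> (forall a, ev1 w a = ev1 w' a) ->
        m x w = m x' w' &
      forall x, S1 x -> m x x = 0 -> forall a, ev1 x a = 0].

Definition load_form (f : X -> R) :=
  (forall k x y, S1 x -> S1 y -> f (k *: x + y) = k * f x + f y) /\
  (forall w w', S1 w -> S1 w' -> (forall a, ev1 w a = ev1 w' a) -> f w = f w').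

Context (T : R) (T0 : 0 < T).
Hypothesis massM : mass_form M.
Hypothesis massM0 : mass_form M0.
Hypothesis loadF0 : load_form F0.
Hypothesis loadF : forall t, t \in `[0, T] -> load_form (F t).
Hypothesis contF : forall w, S1 w -> forall t, t \in `[0, T] ->
  (fun s => F s w) @ within `[0, T]%classic (nbhs t) --> F t w.
Hypothesis Blinl : forall k x x' y y' w v, S1 x -> S1 x' -> S2 y -> S2 y' -> S1 w -> S2 v ->
  B (k *: x + x') (k *: y + y') w v = k * B x y w v + B x' y' w v.
Hypothesis Blinr : forall k x x' y y' w v, S1 x -> S1 x' -> S2 y -> S2 y' -> S1 w -> S2 v ->
  B w v (k *: x + x') (k *: y + y') = k * B w v x y + B w v x' y'.
Hypothesis Bext : forall x x' y y' w w' v v',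
  S1 x -> S1 x' -> S2 y -> S2 y' -> S1 w -> S1 w' -> S2 v -> S2 v' ->
  (forall a, ev1 x a = ev1 x' a) -> (forall a, ev2 y a = ev2 y' a) ->
  (forall a, ev1 w a = ev1 w' a) -> (forall a, ev2 v a = ev2 v' a) ->
  B x y w v = B x' y' w' v'.
Hypothesis Bpos : forall y, S2 y -> B 0 y 0 y = 0 -> forall a, ev2 y a = 0.

(** Two mass forms occur: [M] weights the time derivative, by the porosity in the application, while
    [M0] defines the unweighted initial projection. *)
Definition semidiscrete_solution (c : R -> X) (cb : R -> Y) :=
  [/\ S1 (c 0) /\ (forall w, S1 w -> M0 (c 0) w = F0 w),
      forall a, (fun s => ev1 (c s) a) @ 0^'+ --> ev1 (c 0) a &
      forall t, t \in `]0, T] -> [/\ S1 (c t), S2 (cb t) &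
        exists dc, [/\ S1 dc,
          forall a, time_derivative T (fun s => ev1 (c s) a) t (ev1 dc a) &
          forall w v, S1 w -> S2 v -> M dc w + B (c t) (cb t) w v = F t w]]].

Lemma semidiscrete_unique_solution :
  exists c cb, semidiscrete_solution c cb /\
    forall c' cb', semidiscrete_solution c' cb' ->
      (forall t, t \in `[0, T] -> forall a, ev1 (c' t) a = ev1 (c t) a) /\
      (forall t, t \in `]0, T] -> forall a, ev2 (cb' t) a = ev2 (cb t) a).
Proof.
have [n [nd [e [Se end_ ebasis]]]] := nodal_basis S1lin S10 ev1lin fin1.
have [m [nb [b [Sb bnb bbasis]]]] := nodal_basis S2lin S20 ev2lin fin2.
pose phi (z : 'rV[R]_n) : X := \sum_i z 0 i *: e i.
pose psi (y : 'rV[R]_m) : Y := \sum_i y 0 i *: b i.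
(* [co] and [cob] sample at the nodes, [phi] and [psi] reconstruct. Sampling after reconstruction is
   the identity, while reconstruction after sampling is so only up to evaluation. *)
pose co (x : X) : 'rV[R]_n := \row_j ev1 x (nd j).
pose cob (y : Y) : 'rV[R]_m := \row_j ev2 y (nb j).
have ev10 a : ev1 0 a = 0 by have := ev1lin (- 1) 0 0 a; rewrite scaler0 addr0 mulN1r addNr.
have ev20 a : ev2 0 a = 0 by have := ev2lin (- 1) 0 0 a; rewrite scaler0 addr0 mulN1r addNr.
have Sphi z : S1 (phi z).
  by rewrite /phi; elim/big_rec : _ => // i u _ Su; exact: S1lin.
have Spsi y : S2 (psi y).
  by rewrite /psi; elim/big_rec : _ => // i u _ Su; exact: S2lin.
have ephi z a : ev1 (phi z) a = \sum_i z 0 i * ev1 (e i) a.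
  by rewrite /phi; elim/big_rec2 : _ => // i u v _ <-; rewrite ev1lin.
have epsi y a : ev2 (psi y) a = \sum_i y 0 i * ev2 (b i) a.
  by rewrite /psi; elim/big_rec2 : _ => // i u v _ <-; rewrite ev2lin.
have phi_nd z j : ev1 (phi z) (nd j) = z 0 j.
  rewrite ephi (bigD1 j)//= end_ eqxx mulr1 big1 ?addr0// => i ij.
  by rewrite end_ (negbTE ij) mulr0.
have psi_nb y j : ev2 (psi y) (nb j) = y 0 j.
  rewrite epsi (bigD1 j)//= bnb eqxx mulr1 big1 ?addr0// => i ij.
  by rewrite bnb (negbTE ij) mulr0.
have phi_co x : S1 x -> forall a, ev1 x a = ev1 (phi (co x)) a.
  by move=> Sx a; rewrite ephi ebasis//; apply: eq_bigr => i _; rewrite mxE.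
have psi_cob y : S2 y -> forall a, ev2 y a = ev2 (psi (cob y)) a.
  by move=> Sy a; rewrite epsi bbasis//; apply: eq_bigr => i _; rewrite mxE.
have lin_phi (f : X -> R) z : (forall k x y, S1 x -> S1 y -> f (k *: x + y) = k * f x + f y) ->
    f (phi z) = \sum_i z 0 i * f (e i).
  move=> fl; have f0 : f 0 = 0.
    by have := fl (- 1) 0 0 S10 S10; rewrite scaler0 addr0 mulN1r addNr.
  suff [] : S1 (phi z) /\ f (phi z) = \sum_i z 0 i * f (e i) by [].
  rewrite /phi; elim/big_rec2 : _ => // i u v _ [Sv E].
  by split; [exact: S1lin|rewrite fl// E].
have lin_psi (f : Y -> R) z : (forall k x y, S2 x -> S2 y -> f (k *: x + y) = k * f x + f y) ->
    f (psi z) = \sum_i z 0 i * f (b i).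
  move=> fl; have f0 : f 0 = 0.
    by have := fl (- 1) 0 0 S20 S20; rewrite scaler0 addr0 mulN1r addNr.
  suff [] : S2 (psi z) /\ f (psi z) = \sum_i z 0 i * f (b i) by [].
  rewrite /psi; elim/big_rec2 : _ => // i u v _ [Sv E].
  by split; [exact: S2lin|rewrite fl// E].
pose mx (g : X -> X -> R) : 'M[R]_n := \matrix_(i, j) g (e i) (e j).
have mxE' g z j : mass_form g -> g (phi z) (e j) = (z *m mx g) 0 j.
  move=> [gl _ _ _]; rewrite (lin_phi (fun x => g x (e j))); last first.
    by move=> k x y Sx Sy; rewrite gl.
  by rewrite mxE; apply: eq_bigr => i _; rewrite mxE.
have mx_unit g : mass_form g -> mx g \in unitmx.
  move=> Hg; have [gl gr ge gp] := Hg.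
  rewrite -row_free_unit; apply: inj_row_free => z zg.
  have : g (phi z) (phi z) = 0.
    rewrite (lin_phi (g (phi z))); last by move=> k x y Sx Sy; rewrite gr.
    by apply: big1 => j _; rewrite mxE' // zg mxE mulr0.
  by move=> /(gp _ (Sphi z)) H; apply/rowP => j; rewrite mxE -phi_nd H.
(* Blocks of [B] in the nodal bases: the first index is the trial function and the second the test
   function, so coordinate row vectors multiply from the left. *)
pose A11 : 'M[R]_n := \matrix_(i, j) B (e i) 0 (e j) 0.
pose A12 : 'M[R]_(n, m) := \matrix_(i, j) B (e i) 0 0 (b j).
pose A21 : 'M[R]_(m, n) := \matrix_(i, j) B 0 (b i) (e j) 0.
pose A22 : 'M[R]_m := \matrix_(i, j) B 0 (b i) 0 (b j).
have Bl x y w v : S1 x -> S2 y -> S1 w -> S2 v -> B x y w v = B x 0 w v + B 0 y w v.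
  move=> Sx Sy Sw Sv; have := @Blinl 1 x 0 0 y w v Sx S10 S20 Sy Sw Sv.
  by rewrite !scale1r addr0 add0r mul1r.
have Br x y w v : S1 x -> S2 y -> S1 w -> S2 v -> B x y w v = B x y w 0 + B x y 0 v.
  move=> Sx Sy Sw Sv; have := @Blinr 1 w 0 0 v x y Sw S10 S20 Sv Sx Sy.
  by rewrite !scale1r addr0 add0r mul1r.
have Bphi z w v : S1 w -> S2 v -> B (phi z) 0 w v = \sum_i z 0 i * B (e i) 0 w v.
  move=> Sw Sv; rewrite (lin_phi (fun x => B x 0 w v))// => k x y Sx Sy.
  by rewrite -Blinl// scaler0 addr0.
have Bpsi z w v : S1 w -> S2 v -> B 0 (psi z) w v = \sum_i z 0 i * B 0 (b i) w v.
  move=> Sw Sv; rewrite (lin_psi (fun x => B 0 x w v))// => k x y Sx Sy.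
  by rewrite -Blinl// scaler0 addr0.
have B1 z y j : B (phi z) (psi y) (e j) 0 = (z *m A11 + y *m A21) 0 j.
  rewrite Bl// Bphi// Bpsi// mxE; congr (_ + _); rewrite mxE;
  by apply: eq_bigr => i _; rewrite [A11 _ _]mxE || rewrite [A21 _ _]mxE.
have B2 z y j : B (phi z) (psi y) 0 (b j) = (z *m A12 + y *m A22) 0 j.
  rewrite Bl// Bphi// Bpsi// mxE; congr (_ + _); rewrite mxE;
  by apply: eq_bigr => i _; rewrite [A12 _ _]mxE || rewrite [A22 _ _]mxE.
have phi0 : phi 0 = 0 by rewrite /phi big1// => i _; rewrite mxE scale0r.
(* A row vector in the kernel reconstructs to a trace y with B(0, y; 0, y) = 0, which [Bpos] forces
   to evaluate to zero; this permits the elimination of the trace. *)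
have A22u : A22 \in unitmx.
  rewrite -row_free_unit; apply: inj_row_free => y yA.
  have : B 0 (psi y) 0 (psi y) = 0.
    rewrite (lin_psi (fun v => B 0 (psi y) 0 v)); last first.
      by move=> k v v' Sv Sv'; rewrite -Blinr// scaler0 addr0.
    apply: big1 => j _; have := B2 0 y j.
    by rewrite phi0 mul0mx add0r yA mxE => ->; rewrite mulr0.
  by move=> /(Bpos (Spsi y)) H; apply/rowP => j; rewrite mxE -psi_nb H.
pose Fv t : 'rV[R]_n := \row_j F t (e j).
(* By linearity and extensionality, testing with all pairs amounts to testing with the nodal
   functions: one matrix equation from the fields and one, without time derivative, from the
   traces. *)
have eqs dc c cb t : S1 dc -> S1 c -> S2 cb -> t \in `[0, T] ->
    (forall w v, S1 w -> S2 v -> M dc w + B c cb w v = F t w) <->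
    (co dc *m mx M + (co c *m A11 + cob cb *m A21) = Fv t /\
     co c *m A12 + cob cb *m A22 = 0).
  move=> Sdc Sc Scb tT; have [Ml Mr Me Mp] := massM; have [Fl Fe] := loadF tT.
  have Me' w : S1 w -> M dc w = M (phi (co dc)) w.
    by move=> Sw; apply: Me => //; exact: phi_co.
  have Be' w v : S1 w -> S2 v -> B c cb w v = B (phi (co c)) (psi (cob cb)) w v.
    by move=> Sw Sv; apply: Bext => //; [exact: phi_co|exact: psi_cob].
  have M00 : M dc 0 = 0.
    by have := Mr (- 1) 0 0 dc S10 S10 Sdc; rewrite scaler0 addr0 mulN1r addNr.
  have F00 : F t 0 = 0.
    by have := Fl (- 1) 0 0 S10 S10; rewrite scaler0 addr0 mulN1r addNr.
  split=> [H|[H1 H2] w v Sw Sv].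
    split; apply/rowP => j.
      have := H (e j) 0 (Se j) S20; rewrite Me'// Be'// mxE' // B1 => E1.
      by rewrite mxE E1 mxE.
    have := H 0 (b j) S10 (Sb j); rewrite M00 F00 add0r Be'// B2 => ->.
    by rewrite mxE.
  rewrite Br// addrA.
  have -> : M dc w + B c cb w 0 = F t w.
    rewrite (Me _ _ _ _ Sdc Sdc Sw (Sphi (co w)))//; last exact: phi_co.
    rewrite (Bext Sc Sc Scb Scb Sw (Sphi (co w)) S20 S20)//; last exact: phi_co.
    rewrite (Fe _ _ Sw (Sphi (co w))); last exact: phi_co.
    rewrite (lin_phi (M dc)); last by move=> k x y Sx Sy; rewrite Mr.
    rewrite (lin_phi (fun x => B c cb x 0)); last first.
      by move=> k x y Sx Sy; rewrite -Blinr// scaler0 addr0.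
    rewrite (lin_phi (F t))// -big_split /=; apply: eq_bigr => j _.
    rewrite -mulrDr; congr (_ * _); rewrite Me'// Be'// mxE' // B1.
    have /rowP/(_ j) := H1; rewrite mxE => ->; by rewrite mxE.
  have -> : B c cb 0 v = 0; last by rewrite addr0.
  rewrite (Bext Sc Sc Scb Scb S10 S10 Sv (Spsi (cob v)))//; last exact: psi_cob.
  rewrite (lin_psi (fun x => B c cb 0 x)); last first.
    by move=> k x y Sx Sy; rewrite -Blinr// scaler0 addr0.
  by apply: big1 => j _; rewrite Be'// B2 H2 [X in _ * X]mxE mulr0.
(* Minus the Schur complement of [A22], obtained by substituting the trace from the second equation
   into the first. *)
pose A : 'M[R]_n := A12 *m invmx A22 *m A21 - A11.
pose L : 'M[R]_n := A *m invmx (mx M).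
pose g t : 'rV[R]_n := Fv t *m invmx (mx M).
have Mu := mx_unit _ massM.
have solve (dz z : 'rV[R]_n) (y : 'rV[R]_m) (r : R) :
    (dz *m mx M + (z *m A11 + y *m A21) = Fv r /\ z *m A12 + y *m A22 = 0) <->
    (dz = z *m L + g r /\ y = - (z *m A12 *m invmx A22)).
  have key : y = - (z *m A12 *m invmx A22) -> z *m A11 + y *m A21 = - (z *m A).
    by move=> ->; rewrite mulNmx /A mulmxBr opprB !mulmxA.
  split=> [[H1 H2]|[-> yE]].
    have yE : y = - (z *m A12 *m invmx A22).
      have := congr1 (mulmx^~ (invmx A22)) H2.
      by rewrite mulmxDl mulmxK// mul0mx => /eqP; rewrite addrC addr_eq0 => /eqP.
    split=> //; move/eqP : H1; rewrite key// subr_eq => /eqP H1.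
    by rewrite -[LHS](mulmxK Mu) H1 mulmxDl addrC /L mulmxA.
  rewrite key//; split; last by rewrite yE mulNmx mulmxKV// subrr.
  by rewrite mulmxDl /L /g mulmxKV// mulmxA mulmxKV// addrAC subrr add0r.
(* The forcing is continuous on [0, T] only, whereas [linear_ode_exists] wants it on the whole line;
   clamping time extends it by its end values. *)
pose clamp (t : R) : R := Num.max 0 (Num.min t T).
have clampT t : clamp t \in `[0, T].
  by rewrite in_itv /= le_max lexx /= ge_max (ltW T0) ge_min lexx orbT.
have clampE t : t \in `[0, T] -> clamp t = t.
  by rewrite in_itv /= => /andP[t0 tT]; rewrite /clamp min_l// max_r.
have cclamp : continuous clamp.
  move=> t; apply: (@continuous_max _ _ (cst 0) (fun t => Num.min t T) t).
    exact: cst_continuous.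
  by apply: (@continuous_min _ _ id (cst T) t); [exact: cvg_id|exact: cst_continuous].
have cFv j : continuous (fun t => F (clamp t) (e j)).
  move=> t; apply: (@cvg_comp _ _ _ clamp (fun s => F s (e j)) _ (within `[0, T] (nbhs (clamp t)))).
    move=> P HP.
    have {}HP : \forall s \near clamp t, s \in `[0, T] -> P s by exact: HP.
    have HC : \forall s \near t, clamp s \in `[0, T] -> P (clamp s) := cclamp t _ HP.
    change (\forall s \near t, P (clamp s)).
    by apply: filterS HC => s Hs; exact: (Hs (clampT s)).
  exact: contF.
pose z0 : 'rV[R]_n := (\row_j F0 (e j)) *m invmx (mx M0).
have cg j : continuous (fun t => g (clamp t) 0 j).
  have -> : (fun t => g (clamp t) 0 j) =
      fun t => \sum_i F (clamp t) (e i) * invmx (mx M) i j.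
    by apply/funext => t; rewrite mxE; apply: eq_bigr => i _; rewrite mxE.
  by apply: continuous_sum => i _ t; apply: cvgMr_tmp; exact: cFv.
have [z [z00 zD]] := linear_ode_exists L z0 cg.
have init c : S1 c -> (forall w, S1 w -> M0 c w = F0 w) <-> co c = z0.
  move=> Sc; have [Ml Mr Me Mp] := massM0; have [Fl Fe] := loadF0.
  have Me' w : S1 w -> M0 c w = M0 (phi (co c)) w.
    by move=> Sw; apply: Me => //; exact: phi_co.
  split=> [H|H w Sw].
    rewrite /z0 -[LHS](mulmxK (mx_unit _ massM0)); congr (_ *m _).
    by apply/rowP => j; rewrite -mxE' // -Me'// H// mxE.
  rewrite (Me _ _ _ _ Sc Sc Sw (Sphi (co w)))//; last exact: phi_co.
  rewrite (Fe _ _ Sw (Sphi (co w))); last exact: phi_co.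
  rewrite (lin_phi (M0 c)); last by move=> k x y Sx Sy; rewrite Mr.
  rewrite (lin_phi F0)//; apply: eq_bigr => j _; congr (_ * _).
  by rewrite Me'// mxE' // H /z0 mulmxKV ?mx_unit// mxE.
have co_phi y : co (phi y) = y by apply/rowP => j; rewrite mxE phi_nd.
have cob_psi y : cob (psi y) = y by apply/rowP => j; rewrite mxE psi_nb.
pose yb t := - (z t *m A12 *m invmx A22).
have itvW (t : R) : t \in `]0, T] -> t \in `[0, T].
  by rewrite !in_itv /= => /andP[/ltW -> ->].
exists (fun t => phi (z t)), (fun t => psi (yb t)); split.
  split.
  - by split=> //; apply/(init _ (Sphi _)); rewrite co_phi.
  - move=> a; under [X in X @ _ --> _]eq_fun do rewrite ephi.
    rewrite ephi; apply: cvg_sum => i _; apply: cvgMr_tmp.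
    have [D _] := zD 0 (lexx 0) i.
    move/derivable1_diffP/differentiable_continuous : D => D.
    exact: cvg_at_right_filter.
  - move=> t tT; have tT' := itvW _ tT; split=> //.
    have t0 : 0 <= t by move: tT'; rewrite in_itv /= => /andP[].
    exists (phi (z t *m L + g t)); split=> //.
    + move=> a; rewrite /time_derivative (ephi (_ + _)).
      have -> : (fun s => (s - t)^-1 * (ev1 (phi (z s)) a - ev1 (phi (z t)) a)) =
          fun s => \sum_i ((s - t)^-1 * (z s 0 i - z t 0 i)) * ev1 (e i) a.
        apply/funext => s; rewrite !ephi -sumrB mulr_sumr; apply: eq_bigr => i _.
        by rewrite -mulrBl mulrA.
      have FW : Filter (within `[0, T] t^') by exact: within_filter.
      apply: (@cvg_sum _ _ _ _ FW) => i _; apply: (@cvgMr_tmp _ _ _ FW).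
      have := is_derive_time_derivative T (zD t t0 i).
      by rewrite clampE.
    + by apply/eqs => //; rewrite !co_phi cob_psi; apply/solve.
move=> c' cb' [[Sc0 c'0] c'r c'eq].
have z'E t : t \in `]0, T] -> exists dc, [/\ S1 dc,
    forall a, time_derivative T (fun s => ev1 (c' s) a) t (ev1 dc a),
    co dc = co (c' t) *m L + g t &
    cob (cb' t) = - (co (c' t) *m A12 *m invmx A22)].
  move=> tT; have [Sc Scb [dc [Sdc Ddc /eqs H]]] := c'eq t tT.
  have [] := H Sdc Sc Scb (itvW _ tT) => H1 H2.
  by exists dc; have /solve[] := conj H1 H2.
have cE t : t \in `[0, T] -> co (c' t) = z t.
  move=> tT; apply/eqP; rewrite -subr_eq0; apply/eqP.
  (* The forcing cancels in the difference of the two coordinate curves, which therefore solves the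
     homogeneous system with zero initial value. *)
  apply: (@linear_ode_unique _ _ T L (fun t => co (c' t) - z t)) => //.
  - by rewrite z00; have /(init _ Sc0) -> := c'0; rewrite subrr.
  - move=> j; have -> : (fun s => (co (c' s) - z s) 0 j) =
        fun s => ev1 (c' s) (nd j) - z s 0 j.
      by apply/funext => s; rewrite !mxE.
    have e0 : ev1 (c' 0) (nd j) - z 0 0 j = 0.
      by have /(init _ Sc0)/rowP/(_ j) := c'0; rewrite mxE z00 => ->; rewrite subrr.
    suff : (fun s => ev1 (c' s) (nd j) - z s 0 j) @ 0^'+ --> ev1 (c' 0) (nd j) - z 0 0 j.
      by rewrite e0.
    apply: cvgB; first exact: c'r.
    have [D _] := zD 0 (lexx 0) j.
    move/derivable1_diffP/differentiable_continuous : D => D.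
    exact: cvg_at_right_filter.
  - move=> s sT j; have [dc [Sdc Ddc dcE _]] := z'E s sT.
    have -> : (fun s => (co (c' s) - z s) 0 j) = fun s => ev1 (c' s) (nd j) - z s 0 j.
      by apply/funext => r; rewrite !mxE.
    have sT' := itvW _ sT.
    have s0 : 0 <= s by move: sT'; rewrite in_itv /= => /andP[].
    have := time_derivativeB (Ddc (nd j)) (is_derive_time_derivative T (zD s s0 j)).
    have -> : ev1 dc (nd j) = (co (c' s) *m L + g s) 0 j by rewrite -dcE mxE.
    have -> : (co (c' s) - z s) *m L = (co (c' s) *m L + g s) - (z s *m L + g s).
      by rewrite mulmxBl opprD addrACA subrr addr0.
    have subE (A' B' : 'rV[R]_n) : (A' - B') 0 j = A' 0 j - B' 0 j.
      by rewrite mxE [X in _ + X = _]mxE.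
    by rewrite clampE// subE.
split=> t tT.
  (* At time 0 membership of [c' 0] in the space comes from the initial condition, at later times
     from the equation. *)
  have [->|t0] := eqVneq t 0.
    move=> a; rewrite (phi_co _ Sc0) cE ?in_itv /= ?lexx ?ltW//.
  have tT' : t \in `]0, T].
    by move: tT; rewrite !in_itv /= le_eqVlt eq_sym (negbTE t0).
  by have [Sc _ _] := c'eq t tT' => a; rewrite (phi_co _ Sc) cE.
have [_ Scb _] := c'eq t tT => a; rewrite (psi_cob _ Scb).
by have [dc [_ _ _ ->]] := z'E t tT; rewrite cE// itvW.
Qed.

End semidiscrete.

(** * Data of the transport problem *)

Section square_integrable_loads.
Context {R : realType} {d : nat} {V : finType} (pt : V -> 'cV[R]_d).
Context (Om : set 'cV[R]_d) (K : {set V}) (nK : Defs.nondegenerate pt K).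
Context (KOm : open_hull pt K `<=` Om).
Implicit Types (g : 'cV[R]_d -> R) (p q : mpoly d R).

Let mu := @lebesgue_tuple R d.
Let Kt : set (d.-tuple R) := @col_of_tuple R d @^-1` open_hull pt K.
Let mK : measurable Kt := measurable_open_hull nK.
(** Cut off exactly as in [inL2], where measurability is assumed of this product and not of [g]
    itself. *)
Let ext g (t : d.-tuple R) : R := \1_Om (col_of_tuple t) * g (col_of_tuple t).

Let extE g t : Kt t -> ext g t = g (col_of_tuple t).
Proof. by move=> Ktt; rewrite /ext indicE mem_set ?mul1r//; exact: KOm. Qed.

Let integrable_ext_sqr g : inL2 Om g ->
  mu.-integrable Kt (EFin \o (fun t => ext g t ^+ 2)).
Proof.
move=> [mg ig]; have mg2 : measurable_fun setT (fun t => ext g t ^+ 2).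
  exact: measurable_realfun.measurable_funX.
apply/integrableP; split.
  by apply/measurable_realfun.measurable_EFinP; exact: measurable_funS mg2.
apply: le_lt_trans ig; rewrite /sqnormL2.
under eq_integral do rewrite /= ger0_norm ?sqr_ge0//.
apply: ge0_subset_integral => //.
  exact/measurable_realfun.measurable_EFinP.
by move=> t _; rewrite lee_fin sqr_ge0.
Qed.

Let integrable_poly p : mu.-integrable Kt (EFin \o (peval p \o @col_of_tuple R d)).
Proof. by apply: elem_integrable => //; exact: continuous_peval. Qed.

(** The product of two square-integrable factors is dominated by the sum of their squares. *)
Let integrable_load g p : inL2 Om g ->
  mu.-integrable Kt (EFin \o (fun t => ext g t * peval p (col_of_tuple t))).
Proof.
move=> gL2; have [mg ig] := gL2.
have i1 := integrable_ext_sqr gL2; have i2 := integrable_poly (p * p).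
apply: (le_integrable _ _ _ (integrableD mK i1 i2)) => //.
  apply/measurable_realfun.measurable_EFinP; apply: measurable_realfun.measurable_funM; first exact: measurable_funS mg.
  by apply: continuous_col_measurable; exact: continuous_peval.
move=> t _ /=; rewrite lee_fin pevalM normrM -expr2.
rewrite [leRHS]ger0_norm ?addr_ge0 ?sqr_ge0//.
rewrite -(real_normK (num_real (ext g t))) -(real_normK (num_real (peval p _))).
set a := `|ext g t|; set b := `|peval p _|.
have a0 : 0 <= a := normr_ge0 _; have b0 : 0 <= b := normr_ge0 _.
have := sqr_ge0 (a - b); have := mulr_ge0 a0 b0; nra.
Qed.

Let elem_int_ext g p : elem_int pt K (fun x => g x * peval p x) =
  \int[mu]_(t in Kt) (ext g t * peval p (col_of_tuple t)).
Proof. by apply: eq_Rintegral => t /[!inE] Ktt; rewrite extE. Qed.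

Lemma elem_int_load_lin g (k : R) p q : inL2 Om g ->
  elem_int pt K (fun x => g x * peval (k *: p + q) x) =
  k * elem_int pt K (fun x => g x * peval p x) + elem_int pt K (fun x => g x * peval q x).
Proof.
move=> gL2; rewrite !elem_int_ext.
have ip := integrable_load p gL2; have iq := integrable_load q gL2.
rewrite -(RintegralZl _ mK ip).
rewrite -(@RintegralD _ _ _ mu _ (fun t => k * (ext g t * peval p (col_of_tuple t))))//.
  by apply: eq_Rintegral => t _; rewrite pevalD pevalZ mulrDr mulrCA.
have -> : EFin \o (fun t : d.-tuple R => k * (ext g t * peval p (col_of_tuple t))) =
   (fun t => (k%:E * (EFin \o (fun t => ext g t * peval p (col_of_tuple t))%R) t)%E).
  by apply/funext.
exact: integrableZl.
Qed.

(** Young's inequality with a free parameter [eta] bounds the pairing directly by the squared L2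
    distance, the quantity in which continuity of the source is expressed. *)
Lemma elem_int_load_dist (g h : 'cV[R]_d -> R) p (del eta : R) : inL2 Om g -> inL2 Om h -> 0 < eta ->
  (sqnormL2 Om (fun x => g x - h x)%R < del%:E)%E ->
  `|elem_int pt K (fun x => g x * peval p x) - elem_int pt K (fun x => h x * peval p x)| <=
    eta^-1 * del + eta * elem_int pt K (peval (p * p)).
Proof.
move=> gL2 hL2 eta0 ghd.
have gh : inL2 Om (fun x => g x - h x).
  split; last exact: lt_trans ghd (ltry _).
  rewrite (_ : (fun t => _) = (fun t => ext g t - ext h t)).
    by apply: measurable_realfun.measurable_funB; [exact: gL2.1|exact: hL2.1].
  by apply/funext => t; rewrite /ext mulrBr.
have ig := integrable_load p gL2; have ih := integrable_load p hL2.
have igh := integrable_load p gh.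
have i1 := integrable_ext_sqr gh; have i2 := integrable_poly (p * p).
rewrite !elem_int_ext -(RintegralB mK ig ih).
rewrite (@eq_Rintegral _ _ _ mu _ (fun t => ext (fun x => g x - h x) t * peval p (col_of_tuple t))); last first.
  by move=> t _; rewrite -mulrBl /ext -mulrBr.
apply: (le_trans (le_normr_Rintegral mK igh)).
set e := ext _ in igh i1 *.
have i1' : mu.-integrable Kt (EFin \o (fun t => eta^-1 * e t ^+ 2)).
  have -> : EFin \o (fun t : d.-tuple R => eta^-1 * e t ^+ 2) =
     (fun t => (eta^-1%:E * (EFin \o (fun t => e t ^+ 2)%R) t)%E) by apply/funext.
  exact: integrableZl.
have i2' : mu.-integrable Kt (EFin \o (fun t : d.-tuple R => eta * peval (p * p) (col_of_tuple t))).
  have -> : EFin \o (fun t : d.-tuple R => eta * peval (p * p) (col_of_tuple t)) =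
     (fun t => (eta%:E * (EFin \o (peval (p * p)%R \o @col_of_tuple R d)) t)%E) by apply/funext.
  exact: integrableZl.
apply: (@le_trans _ _ (\int[mu]_(t in Kt) (eta^-1 * e t ^+ 2 + eta * peval (p * p) (col_of_tuple t)))).
  apply: le_Rintegral => //.
  - exact: (integrable_norm igh).
  - exact: (integrableD mK i1' i2').
  - move=> t _; rewrite pevalM normrM -expr2.
    rewrite -(real_normK (num_real (e t))) -(real_normK (num_real (peval p _))).
    set a := `|e t|; set b := `|peval p _|.
    have a0 : 0 <= a := normr_ge0 _; have b0 : 0 <= b := normr_ge0 _.
    (* AM-GM *)
    rewrite -(@ler_pM2l _ eta)// mulrDr mulVKf ?gt_eqF//.
    have := sqr_ge0 (a - eta * b); have := mulr_ge0 (ltW eta0) (mulr_ge0 a0 b0).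
    nra.
rewrite (@RintegralD _ _ _ mu _ _ _ mK i1' i2').
rewrite (@RintegralZl _ _ _ mu _ (fun t => e t ^+ 2) _ mK i1).
rewrite (@RintegralZl _ _ _ mu _ (fun t => peval (p * p) (col_of_tuple t)) _ mK i2).
rewrite lerD2r ler_wpM2l ?invr_ge0 ?(ltW eta0)//.
rewrite -lee_fin /Rintegral fineK; last exact: integrable_fin_num.
apply: le_trans (ltW ghd); rewrite /sqnormL2.
apply: ge0_subset_integral => //.
- by apply/measurable_realfun.measurable_EFinP; apply: measurable_realfun.measurable_funX; exact: gh.1.
- by move=> t _; rewrite lee_fin sqr_ge0.
Qed.

Lemma elem_int_load_cvg {I : Type} {G : set_system I} {FG : Filter G}
    (f : I -> 'cV[R]_d -> R) (g : 'cV[R]_d -> R) p : inL2 Om g ->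
  (\forall i \near G, inL2 Om (f i)) ->
  (fun i => sqnormL2 Om (fun x => f i x - g x)) @ G --> 0%E ->
  (fun i => elem_int pt K (fun x => f i x * peval p x)) @ G -->
    elem_int pt K (fun x => g x * peval p x).
Proof.
move=> gL2 fL2 fg; apply/cvgrPdist_le => e e0.
pose P := elem_int pt K (peval (p * p)).
have P0 : 0 <= P by apply: elem_int_ge0 => x _; rewrite pevalM -expr2 sqr_ge0.
(* With this [eta] and the [del] below, both terms of the estimate are at most e/2; adding 1 to [P]
   keeps the division valid when the polynomial part vanishes. *)
pose eta := e / 2 / (P + 1).
have P1 : 0 < P + 1 by rewrite ltr_wpDl.
have eta0 : 0 < eta by rewrite !divr_gt0.
pose del := eta * (e / 2).
have del0 : 0 < del by rewrite mulr_gt0 ?divr_gt0.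
have near_del : \forall i \near G, (sqnormL2 Om (fun x => f i x - g x)%R < del%:E)%E.
  apply: (fg [set y | (y < del%:E)%E]); apply: open_nbhs_nbhs; split.
    exact: open_ereal_lt_ereal.
  by rewrite /= lte_fin.
apply: filterS2 fL2 near_del => i fiL2 fid.
rewrite distrC (le_trans (elem_int_load_dist p fiL2 gL2 eta0 fid))//.
rewrite /del mulKf ?gt_eqF// -/P.
have : eta * P <= e / 2.
  rewrite /eta -mulrA ler_piMr ?divr_ge0 ?(ltW e0)//.
  by rewrite mulrC ler_pdivrMr// mul1r lerDl.
lra.
Qed.

End square_integrable_loads.

(** A polygonal domain is the interior of a finite, hence closed, union of simplices. That union
    contains the closure of the domain, so an open set inside the closure lies in the interior of
    the union; slits are thereby excluded. *)
Lemma polygonal_regular_open {R : realType} {d : nat} (Om U : set 'cV[R]_d) :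
  polygonal_domain Om -> open U -> U `<=` closure Om -> U `<=` Om.
Proof.
move=> [_ _ [N [pt [T [nT OmE]]]]] oU UOm; rewrite OmE -open_subsetE//.
apply: (subset_trans UOm); rewrite OmE.
have cC : closed (\bigcup_(K in [set K | K \in T]) hull pt K).
  apply: closed_bigcup; first exact: finite_finset.
  by move=> K /= KT; apply: closed_hull; exact: nT.
rewrite [X in _ `<=` X](closure_id _).1//; apply: closureS; exact: interior_subset.
Qed.

(** The Lipschitz bound is in Euclidean norms and continuity is entrywise: an entry is at most the
    Frobenius norm, and [normv] is continuous as the square root of a continuous function. *)
Lemma continuous_dispersion {R : realType} {d : nat} (D : 'cV[R]_d -> 'M[R]_d) (Dmin C : R) :
  dispersion_tensor D Dmin C -> continuous D.
Proof.
move=> [_ C0 _ _ DL]; apply: continuous_matrix => i j x.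
have cn : continuous (fun y : 'cV[R]_d => C * normv (x - y)).
  have cxy : continuous (fun y : 'cV[R]_d => x - y).
    by move=> z; apply: (@continuousB _ _ _ (cst x) id); [exact: cst_continuous|move=> A].
  have c1 := continuous_dotv cxy cxy.
  move=> y; have H := cvg_comp _ _ (c1 y) (@sqrt_continuous R (dotv (x - y) (x - y))).
  exact: (@cvgMl_tmp _ _ (nbhs y) (nbhs_filter y) _ C _ H).
have FF : Filter (nbhs x) := nbhs_filter x.
apply/(@cvgrPdist_lt _ _ _ _ FF) => e e0.
have : \forall y \near x, C * normv (x - y) < e.
  apply: (@cvgr_lt _ _ _ FF _ _ (cn x)).
  by rewrite subrr /normv dotv0r sqrtr0 mulr0.
apply: (@filterS _ _ FF) => y; apply: le_lt_trans.
apply: le_trans (DL x y); rewrite /normm.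
have -> : `|D x i j - D y i j| = Num.sqrt ((D x - D y) i j * (D x - D y) i j).
  by rewrite -expr2 sqrtr_sqr !mxE.
have H0 k l : 0 <= (D x - D y) k l * (D x - D y) k l by rewrite -expr2 sqr_ge0.
rewrite ler_sqrt; last by apply: sumr_ge0 => k _; apply: sumr_ge0.
rewrite /dotm (bigD1 i)//= (bigD1 j)//= -addrA lerDl addr_ge0// sumr_ge0// => k _.
by apply: sumr_ge0.
Qed.

(** * Facets of a simplicial mesh *)

Section mesh_facets.
Context {R : realType} {d : nat} {V : finType} (pt : V -> 'cV[R]_d).
Implicit Types (K F : {set V}) (T : {set {set V}}).

Lemma card_facet K v : Defs.nondegenerate pt K -> v \in K -> #|K :\ v| = d.
Proof. by move=> [cK _] vK; have := cardsD1 v K; rewrite vK cK add1n => -[]. Qed.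

Lemma affinely_independentS K F : F \subset K ->
  affinely_independent pt K -> affinely_independent pt F.
Proof.
move=> /fintype.subsetP FK aK a a0 a1 v vF.
have sumF (W : lmodType R) (h : V -> W) :
    \sum_(v in K) (if v \in F then a v else 0) *: h v = \sum_(v in F) a v *: h v.
  rewrite big_mkcond [RHS]big_mkcond /=; apply: eq_bigr => w _.
  have [wF|wF] := boolP (w \in F); first by rewrite FK.
  by case: ifP => //; rewrite scale0r.
have := aK (fun v => if v \in F then a v else 0).
rewrite sumF a1 => H; have := H _ erefl v (FK v vF); rewrite vF; apply.
(* The condition on the total weight is the same identity in the regular module, with constant
   vectors 1. *)
have := @sumF R^o (fun=> 1).
under eq_bigr do rewrite [_ *: _]mulr1.
by under [X in _ = X -> _]eq_bigr do rewrite [_ *: _]mulr1; move->.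
Qed.

Lemma facetP T F : (forall K, K \in T -> Defs.nondegenerate pt K) ->
  F \in facets (d := d) T -> exists K v, [/\ K \in T, v \in K & F = K :\ v].
Proof.
move=> nT; rewrite inE => /andP[/eqP cF /existsP[K /andP[KT FK]]].
have [v vK vF] : exists2 v, v \in K & v \notin F.
  apply/subsetPn; apply/negP => KF.
  have := subset_leq_card KF; rewrite cF (nT K KT).1 ltnn //.
exists K, v; split=> //; apply/eqP; rewrite eqEcard; apply/andP; split.
  apply/fintype.subsetP => w wF; rewrite !inE (fintype.subsetP FK)// andbT.
  by apply: contraNneq vF => <-.
by rewrite cF card_facet//; exact: nT.
Qed.

Lemma facet_mem T K v : Defs.nondegenerate pt K -> K \in T -> v \in K ->
  K :\ v \in facets (d := d) T.
Proof.
move=> nK KT vK; rewrite inE card_facet// eqxx /=.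
by apply/existsP; exists K; rewrite KT subD1set.
Qed.

Lemma facet_continuousW F (g : 'cV[R]_d -> R) : continuous g -> facet_continuous pt F g.
Proof. by move=> cg; exists g. Qed.

Lemma facet_continuousM F (g h : 'cV[R]_d -> R) :
  facet_continuous pt F g -> facet_continuous pt F h ->
  facet_continuous pt F (fun x => g x * h x).
Proof.
move=> [G cG gG] [H cH hH]; exists (fun x => G x * H x).
  by move=> x; exact: (@continuousM _ _ G H x (cG x) (cH x)).
by move=> x Fx; rewrite gG// hH.
Qed.

Lemma facet_continuousB F (g h : 'cV[R]_d -> R) :
  facet_continuous pt F g -> facet_continuous pt F h ->
  facet_continuous pt F (fun x => g x - h x).
Proof.
move=> [G cG gG] [H cH hH]; exists (fun x => G x - H x).
  by move=> x; exact: (@continuousB _ _ _ G H x (cG x) (cH x)).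
by move=> x Fx; rewrite gG// hH.
Qed.

Lemma elem_int0 K : elem_int pt K (fun=> 0) = 0.
Proof. by rewrite /elem_int /vol_int /Rintegral integral0. Qed.

Lemma facet_int0 F : facet_int pt F (fun=> 0) = 0.
Proof. by rewrite facet_intE /Rintegral integral0 mulr0. Qed.

End mesh_facets.

(** * The forms of the transport scheme *)

Section continuity_tools.
Context {R : realType} {T : topologicalType}.

Lemma continuous_mul (f g : T -> R) :
  continuous f -> continuous g -> continuous (fun x => f x * g x).
Proof. by move=> cf cg x; exact: (@continuousM _ _ f g x (cf x) (cg x)). Qed.

Lemma continuous_mulmx (m n p : nat) (A : T -> 'M[R]_(m, n)) (B : T -> 'M[R]_(n, p)) :
  continuous A -> continuous B -> continuous (fun x => A x *m B x).
Proof.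
move=> cA cB; apply: continuous_matrix => i j.
have -> : (fun x => (A x *m B x) i j) = fun x => \sum_k A x i k * B x k j.
  by apply/funext => x; rewrite mxE.
apply: continuous_sum => k _; apply: continuous_mul => x; apply: cvg_coord;
  [exact: cA|exact: cB].
Qed.

End continuity_tools.

Section bilinear_forms.
Context {R : realType} {d : nat} {V : finType} (pt : V -> 'cV[R]_d) (d0 : (0 < d)%N).
Context {X Y : lmodType R} (S1 : X -> Prop) (S2 : Y -> Prop).
Implicit Types b : X -> Y -> X -> Y -> R.

(** Linearity is joint in the pair of field and trace, since the jumps mix the two. It is restricted
    to the discrete spaces, where the traces are continuous on facets and the integrals are
    therefore additive. *)
Definition bilinear_on b : Prop :=
  (forall k x x' y y' w v, S1 x -> S1 x' -> S2 y -> S2 y' -> S1 w -> S2 v ->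
     b (k *: x + x') (k *: y + y') w v = k * b x y w v + b x' y' w v) /\
  (forall k x x' y y' w v, S1 x -> S1 x' -> S2 y -> S2 y' -> S1 w -> S2 v ->
     b w v (k *: x + x') (k *: y + y') = k * b w v x y + b w v x' y').

Lemma bilinear_onD b b' : bilinear_on b -> bilinear_on b' ->
  bilinear_on (fun x y w v => b x y w v + b' x y w v).
Proof.
move=> [H1 H2] [H1' H2']; split=> k x x' y y' w v *; [rewrite H1// H1'//|rewrite H2// H2'//];
by rewrite mulrDr addrACA.
Qed.

Lemma bilinear_onZ b (a : R) : bilinear_on b -> bilinear_on (fun x y w v => a * b x y w v).
Proof.
by move=> [H1 H2]; split=> k x x' y y' w v *; [rewrite H1//|rewrite H2//]; rewrite mulrDr mulrCA.
Qed.

Lemma bilinear_onN b : bilinear_on b -> bilinear_on (fun x y w v => - b x y w v).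
Proof.
by move=> [H1 H2]; split=> k x x' y y' w v *; [rewrite H1//|rewrite H2//]; rewrite opprD mulrN.
Qed.

Lemma bilinear_on_sum (I : finType) (P : pred I) (b : I -> X -> Y -> X -> Y -> R) :
  (forall i, P i -> bilinear_on (b i)) ->
  bilinear_on (fun x y w v => \sum_(i | P i) b i x y w v).
Proof.
move=> H; split=> k x x' y y' w v *; rewrite mulr_sumr -big_split /=;
  apply: eq_bigr => i Pi.
- by rewrite (H i Pi).1.
- by rewrite (H i Pi).2.
Qed.

Lemma bilinear_on_elem K (g : X -> Y -> X -> Y -> 'cV[R]_d -> R) :
  Defs.nondegenerate pt K ->
  (forall x y w v, S1 x -> S2 y -> S1 w -> S2 v -> continuous (g x y w v)) ->
  (forall z, bilinear_on (fun x y w v => g x y w v z)) ->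
  bilinear_on (fun x y w v => elem_int pt K (g x y w v)).
Proof.
move=> nK cg bg; split=> k x x' y y' w v *.
  rewrite -elem_int_lin//; [|exact: cg|exact: cg].
  by apply: elem_int_eq => z _; rewrite (bg z).1.
rewrite -elem_int_lin//; [|exact: cg|exact: cg].
by apply: elem_int_eq => z _; rewrite (bg z).2.
Qed.

Lemma bilinear_on_bdry K
    (g : X -> Y -> X -> Y -> 'cV[R]_d -> {set V} -> 'cV[R]_d -> R) :
  Defs.nondegenerate pt K ->
  (forall q, q \in K -> forall x y w v, S1 x -> S2 y -> S1 w -> S2 v ->
     facet_continuous pt (K :\ q) (g x y w v (normal pt K q) (K :\ q))) ->
  (forall n F z, bilinear_on (fun x y w v => g x y w v n F z)) ->
  bilinear_on (fun x y w v => bdry_int pt K (g x y w v)).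
Proof.
move=> nK cg bg; apply: bilinear_on_sum => q qK.
have cF := card_facet nK qK.
split=> k x x' y y' w v *.
  rewrite -facet_int_lin//; [|exact: cg|exact: cg].
  by apply: facet_int_eq => // z _; rewrite (bg _ _ z).1.
rewrite -facet_int_lin//; [|exact: cg|exact: cg].
by apply: facet_int_eq => // z _; rewrite (bg _ _ z).2.
Qed.

End bilinear_forms.

Section transport_forms.
Context {R : realType} {d : nat} {V : finType} (pt : V -> 'cV[R]_d) (d0 : (0 < d)%N).
Context (Ts Td : {set {set V}}) (l : nat).
Local Notation T := (Ts :|: Td).
Hypothesis nT : forall K, K \in T -> Defs.nondegenerate pt K.
Local Notation field := ({set V} -> mpoly d R).
Local Notation trace := ('cV[R]_d -> R).
Implicit Types (c w : field) (cb wb : trace).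

Lemma field_linE (k : R) c w K : (k *: c + w) K = k *: c K + w K.
Proof. by []. Qed.

Lemma trace_linE (k : R) cb wb x : (k *: cb + wb) x = k * cb x + wb x.
Proof. by []. Qed.

Lemma inCh_lin (k : R) c w : inCh Ts Td l c -> inCh Ts Td l w -> inCh Ts Td l (k *: c + w).
Proof. by move=> Hc Hw K KT; apply: inP_lin; [exact: Hc|exact: Hw]. Qed.

Lemma inCh0 : inCh Ts Td l (0 : field).
Proof. by move=> K _; exact: inP0. Qed.

Lemma inCbarh_lin (k : R) cb wb : inCbarh pt Ts Td l cb -> inCbarh pt Ts Td l wb ->
  inCbarh pt Ts Td l (k *: cb + wb).
Proof.
move=> [Pc cc] [Pw cw]; split.
  move=> F FT; have [p pl pE] := Pc F FT; have [q ql qE] := Pw F FT.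
  exists (k *: p + q); first exact: inP_lin.
  by move=> x Fx; rewrite trace_linE pE// qE// pevalD pevalZ.
move=> x; apply: cvgD; last exact: cw.
by apply: cvgZl_tmp; exact: cc.
Qed.

Lemma inCbarh0 : inCbarh pt Ts Td l (0 : trace).
Proof.
split; last by move=> x; exact: cvg_cst.
by move=> F _; exists 0; [exact: inP0|move=> x _; rewrite peval0].
Qed.

Lemma field_ext c w : (forall K x, K \in T -> hull pt K x -> peval (c K) x = peval (w K) x) ->
  forall K, K \in T -> c K = w K.
Proof.
move=> H K KT; apply/eqP; rewrite -subr_eq0; apply/eqP.
apply: (peval_eq0_open (open_hull_neq0 (nT KT)) (open_open_hull (nT KT))) => x Kx.
have -> : c K - w K = (-1) *: w K + c K by rewrite scaleN1r addrC.
by rewrite pevalD pevalZ H// ?mulN1r ?addNr//; exact: open_hullW.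
Qed.

Lemma trace_facet_continuous cb K q : inCbarh pt Ts Td l cb -> K \in T -> q \in K ->
  facet_continuous pt (K :\ q) cb.
Proof.
move=> [Pc _] KT qK; have [p _ pE] := Pc _ (facet_mem (nT KT) KT qK).
by exists (peval p) => //; exact: continuous_peval.
Qed.

Let J : finType := ({set V} * bmultinom d l.+1)%type.

(** The key is an arbitrary set of vertices, so one finite family spans both the elementwise
    polynomials and, facet by facet, the traces. *)
Definition pw_monomial (i : 'I_#|J|) (p : {set V} * 'cV[R]_d) : R :=
  let Km := enum_val i in
  if p.1 == Km.1 then peval (mpolyX R (bmnm Km.2)) p.2 else 0.

Lemma pw_monomial_span (P : field) K x : inP l (P K) ->
  peval (P K) x = \sum_(i < #|J|)
    mcoeff (bmnm (enum_val i).2) (P (enum_val i).1) * pw_monomial i (K, x).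
Proof.
move=> HP; rewrite (reindex (@enum_rank J)) /=; last exact/onW_bij/enum_rank_bij.
under [RHS]eq_bigr do rewrite /pw_monomial enum_rankK.
rewrite -(pair_bigA _ (fun K' (m : bmultinom d l.+1) => mcoeff (bmnm m) (P K') *
   (if K == K' then peval (mpolyX R (bmnm m)) x else 0))) /=.
rewrite (bigD1 K)//= [X in _ + X]big1 ?addr0; last first.
  move=> K' K'K; apply: big1 => m _.
  by rewrite eq_sym (negbTE K'K) mulr0.
rewrite {1}(mpolywE HP) peval_sum; apply: eq_bigr => m _.
by rewrite pevalZ eqxx.
Qed.

Section mass.
Context (rho : {set V} -> R).
Hypothesis rho0 : forall K, K \in T -> 0 < rho K.

Definition mass c w : R := \sum_(K in T)
  elem_int pt K (fun x => rho K * peval (c K) x * peval (w K) x).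

Let mass_bilinear : bilinear_on (inCh Ts Td l) (fun _ : trace => True) (fun c _ w _ => mass c w).
Proof.
apply: bilinear_on_sum => K KT; apply: (bilinear_on_elem (nT KT)).
  move=> c _ w _ _ _ _ _; apply: continuous_mul; last exact: continuous_peval.
  by apply: continuous_mul; [exact: cst_continuous|exact: continuous_peval].
by move=> z; split=> k x x' y y' w v *; rewrite field_linE pevalD pevalZ; ring.
Qed.

Lemma mass_linl k c c' w : inCh Ts Td l c -> inCh Ts Td l c' -> inCh Ts Td l w ->
  mass (k *: c + c') w = k * mass c w + mass c' w.
Proof. by move=> *; exact: (mass_bilinear.1 k c c' 0 0 w 0). Qed.

Lemma mass_linr k c c' w : inCh Ts Td l c -> inCh Ts Td l c' -> inCh Ts Td l w ->
  mass w (k *: c + c') = k * mass w c + mass w c'.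
Proof. by move=> *; exact: (mass_bilinear.2 k c c' 0 0 w 0). Qed.

Lemma mass_eq0 c : mass c c = 0 -> forall K, K \in T -> c K = 0.
Proof.
have ge0 K x : K \in T -> 0 <= rho K * peval (c K) x * peval (c K) x.
  by move=> KT; rewrite -mulrA mulr_ge0 ?(ltW (rho0 KT))// -expr2 sqr_ge0.
move/eqP; rewrite /mass psumr_eq0 => [/allP H|K KT]; last first.
  by apply: elem_int_ge0 => x _; exact: ge0.
move=> K KT; have /implyP/(_ KT)/eqP HK := H K (mem_index_enum K).
apply: (peval_eq0_open (open_hull_neq0 (nT KT)) (open_open_hull (nT KT))) => x Kx.
have cg : continuous (fun x => rho K * peval (c K) x * peval (c K) x).
  apply: continuous_mul; last exact: continuous_peval.
  by apply: continuous_mul; [exact: cst_continuous|exact: continuous_peval].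
have := elem_int_eq0 (nT KT) cg (fun x _ => ge0 K x KT) HK Kx.
by move=> /eqP; rewrite -mulrA mulf_eq0 gt_eqF ?rho0//= mulf_eq0 orbb => /eqP.
Qed.

End mass.

Section transport.
Context (betac : R) (betac0 : 0 < betac) (D : 'cV[R]_d -> 'M[R]_d) (Dmin C : R).
Hypothesis hD : dispersion_tensor D Dmin C.
Context (u : {set V} -> 'I_d -> mpoly d R).

Let cu K : continuous (veval (u K)).
Proof.
apply: continuous_matrix => i j.
have -> : (fun x => veval (u K) x i j) = peval (u K i) by apply/funext => x; rewrite mxE.
exact: continuous_peval.
Qed.

Let cD K : continuous (fun x => D (veval (u K) x)).
Proof.
move=> x; exact: (cvg_comp _ _ (@cu K x) (@continuous_dispersion _ _ _ _ _ hD (veval (u K) x))).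
Qed.

Let cgrad (p : mpoly d R) : continuous (pgrad p).
Proof.
apply: continuous_matrix => i j.
have -> : (fun x => pgrad p x i j) = peval (mderiv i p) by apply/funext => x; rewrite mxE.
exact: continuous_peval.
Qed.

Let cDgrad K p : continuous (fun x => D (veval (u K) x) *m pgrad p x).
Proof. by apply: continuous_mulmx; [exact: cD|exact: cgrad]. Qed.

Let cun K n : continuous (fun x => dotv (veval (u K) x) n).
Proof. by apply: continuous_dotv; [exact: cu|exact: cst_continuous]. Qed.

Let jump_continuous c cb K q : inCbarh pt Ts Td l cb -> K \in T -> q \in K ->
  facet_continuous pt (K :\ q) (fun x => peval (c K) x - cb x).
Proof.
move=> Hcb KT qK; apply: facet_continuousB; last exact: trace_facet_continuous.
by apply: facet_continuousW; exact: continuous_peval.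
Qed.

(** The jump of the inflow indicator is harmless because it is multiplied by the normal velocity:
    the product is the minimum of u . n and 0, which is continuous. *)
Let inflow_continuous c cb w wb K q n : inCbarh pt Ts Td l cb -> inCbarh pt Ts Td l wb ->
  K \in T -> q \in K -> facet_continuous pt (K :\ q)
  (fun x => if dotv (veval (u K) x) n < 0 then
     dotv (veval (u K) x) n * (peval (c K) x - cb x) * (peval (w K) x - wb x) else 0).
Proof.
move=> Hcb Hwb KT qK.
have -> : (fun x => if dotv (veval (u K) x) n < 0 then
     dotv (veval (u K) x) n * (peval (c K) x - cb x) * (peval (w K) x - wb x) else 0) =
  fun x => Num.min (dotv (veval (u K) x) n) 0 * (peval (c K) x - cb x) * (peval (w K) x - wb x).
  by apply/funext => x; rewrite /Order.min; case: ifP => _ //; rewrite !mul0r.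
apply: facet_continuousM; last exact: jump_continuous.
apply: facet_continuousM; last exact: jump_continuous.
apply: facet_continuousW => x.
by apply: (@continuous_min _ _ _ (cst 0) x); [exact: cun|exact: cst_continuous].
Qed.

Let penalty_continuous c cb w wb K q n : inCbarh pt Ts Td l cb -> inCbarh pt Ts Td l wb ->
  K \in T -> q \in K -> facet_continuous pt (K :\ q)
  (fun x => dotv ((peval (c K) x - cb x) *: (D (veval (u K) x) *m n))
              ((peval (w K) x - wb x) *: n)).
Proof.
move=> Hcb Hwb KT qK.
have -> : (fun x => dotv ((peval (c K) x - cb x) *: (D (veval (u K) x) *m n))
    ((peval (w K) x - wb x) *: n)) =
  fun x => (peval (c K) x - cb x) *
    ((peval (w K) x - wb x) * dotv (D (veval (u K) x) *m n) n).
  by apply/funext => x; rewrite dotvZl dotvZr.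
apply: facet_continuousM; first exact: jump_continuous.
apply: facet_continuousM; first exact: jump_continuous.
apply: facet_continuousW; apply: continuous_dotv; last exact: cst_continuous.
by apply: continuous_mulmx; [exact: cD|exact: cst_continuous].
Qed.

Let flux_continuous c w wb K q n : inCbarh pt Ts Td l wb ->
  K \in T -> q \in K -> facet_continuous pt (K :\ q)
  (fun x => dotv (D (veval (u K) x) *m pgrad (c K) x) n * (peval (w K) x - wb x)).
Proof.
move=> Hwb KT qK; apply: facet_continuousM; last exact: jump_continuous.
apply: facet_continuousW; apply: continuous_dotv; last exact: cst_continuous.
exact: cDgrad.
Qed.

Lemma Bh_bilinear : bilinear_on (inCh Ts Td l) (inCbarh pt Ts Td l)
  (fun c cb w wb => Bh pt Ts Td betac D u c cb w wb).
Proof.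
apply: bilinear_onD; apply: bilinear_on_sum => K KT; have nK := nT KT.
- apply: bilinear_onD; [apply: bilinear_onD|]; first apply: bilinear_onN.
  + apply: (bilinear_on_elem nK).
      move=> c cb w wb _ _ _ _.
      have -> : (fun x => dotv (peval (c K) x *: veval (u K) x) (pgrad (w K) x)) =
          fun x => peval (c K) x * dotv (veval (u K) x) (pgrad (w K) x).
        by apply/funext => x; rewrite dotvZl.
      apply: continuous_mul; first exact: continuous_peval.
      by apply: continuous_dotv; [exact: cu|exact: cgrad].
    move=> z; split=> k x x' y y' w v _ _ _ _ _ _; rewrite field_linE.
      by rewrite pevalD pevalZ !dotvZl; ring.
    by rewrite pgrad_lin dotv_linr.
  + apply: (bilinear_on_bdry d0 nK).
      move=> q qK c cb w wb _ Hcb _ Hwb.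
      apply: facet_continuousM; last exact: jump_continuous.
      apply: facet_continuousM; apply: facet_continuousW; first exact: continuous_peval.
      exact: cun.
    move=> n F z; split=> k x x' y y' w v _ _ _ _ _ _;
      rewrite field_linE ?trace_linE pevalD pevalZ; ring.
  + apply: bilinear_onN; apply: (bilinear_on_bdry d0 nK).
      by move=> q qK c cb w wb _ Hcb _ Hwb; exact: inflow_continuous.
    move=> n F z; split=> k x x' y y' w v _ _ _ _ _ _;
      rewrite field_linE trace_linE pevalD pevalZ; case: ifP => _; ring.
- apply: bilinear_onD; [apply: bilinear_onD; [apply: bilinear_onD|]|].
  + apply: (bilinear_on_elem nK).
      by move=> c cb w wb _ _ _ _; apply: continuous_dotv; [exact: cDgrad|exact: cgrad].
    move=> z; split=> k x x' y y' w v _ _ _ _ _ _; rewrite field_linE pgrad_lin.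
      by rewrite mulmxDr -scalemxAr dotv_linl.
    by rewrite dotv_linr.
  + apply: bilinear_onN; apply: (bilinear_on_bdry d0 nK).
      by move=> q qK c cb w wb _ Hcb _ Hwb; exact: flux_continuous.
    move=> n F z; split=> k x x' y y' w v _ _ _ _ _ _; rewrite field_linE.
      by rewrite pgrad_lin mulmxDr -scalemxAr dotv_linl; ring.
    by rewrite trace_linE pevalD pevalZ; ring.
  + apply: bilinear_onZ; apply: (bilinear_on_bdry d0 nK).
      by move=> q qK c cb w wb _ Hcb _ Hwb; exact: penalty_continuous.
    move=> n F z; split=> k x x' y y' w v _ _ _ _ _ _;
      rewrite field_linE trace_linE pevalD pevalZ !dotvZl !dotvZr; ring.
  + apply: bilinear_onN; apply: (bilinear_on_bdry d0 nK).
      by move=> q qK c cb w wb _ Hcb _ Hwb; exact: flux_continuous.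
    move=> n F z; split=> k x x' y y' w v _ _ _ _ _ _; rewrite field_linE.
      by rewrite trace_linE pevalD pevalZ; ring.
    by rewrite pgrad_lin mulmxDr -scalemxAr dotv_linl; ring.
Qed.

Lemma bdry_int_eq K (g h : 'cV[R]_d -> {set V} -> 'cV[R]_d -> R) : K \in T ->
  (forall q n x, q \in K -> hull pt (K :\ q) x -> g n (K :\ q) x = h n (K :\ q) x) ->
  bdry_int pt K g = bdry_int pt K h.
Proof.
move=> KT gh; apply: eq_bigr => q qK; apply: facet_int_eq => //.
  by apply: card_facet => //; exact: nT.
by move=> x Fx; exact: gh.
Qed.

Lemma Bh_eq c c' cb cb' w w' wb wb' :
  (forall K, K \in T -> c K = c' K) ->
  (forall F x, F \in facets (d := d) T -> hull pt F x -> cb x = cb' x) ->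
  (forall K, K \in T -> w K = w' K) ->
  (forall F x, F \in facets (d := d) T -> hull pt F x -> wb x = wb' x) ->
  Bh pt Ts Td betac D u c cb w wb = Bh pt Ts Td betac D u c' cb' w' wb'.
Proof.
move=> cc bb ww vv; rewrite /Bh /Bha /Bhd; congr (_ + _); apply: eq_bigr => K KT.
all: rewrite (cc K KT) (ww K KT).
all: have FT q : q \in K -> K :\ q \in facets (d := d) T
  by move=> qK; apply: facet_mem => //; exact: nT.
  congr (_ + _ - _); apply: bdry_int_eq => // q n x qK Fx.
    by rewrite (vv _ _ (FT q qK) Fx).
  by rewrite (vv _ _ (FT q qK) Fx) (bb _ _ (FT q qK) Fx).
congr (_ - _ + _ * _ - _); apply: bdry_int_eq => // q n x qK Fx.
- by rewrite (vv _ _ (FT q qK) Fx).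
- by rewrite (vv _ _ (FT q qK) Fx) (bb _ _ (FT q qK) Fx).
- by rewrite (bb _ _ (FT q qK) Fx).
Qed.

(* Testing with a trace only, the inflow and penalty terms are the only ones left; both
   are nonnegative, and the penalty is definite because D(u) n . n >= Dmin > 0. *)
Lemma Bh_trace_eq0 cb : inCbarh pt Ts Td l cb -> Bh pt Ts Td betac D u 0 cb 0 cb = 0 ->
  forall F x, F \in facets (d := d) T -> hull pt F x -> cb x = 0.
Proof.
move=> Hcb HB.
pose inflow K := bdry_int pt K (fun n F x => if dotv (veval (u K) x) n < 0 then
   dotv (veval (u K) x) n * (peval ((0 : field) K) x - cb x) *
     (peval ((0 : field) K) x - cb x) else 0).
pose penalty K := bdry_int pt K (fun n F x =>
   dotv ((peval ((0 : field) K) x - cb x) *: (D (veval (u K) x) *m n))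
        ((peval ((0 : field) K) x - cb x) *: n)).
have p0 K x : peval ((0 : field) K) x = 0 by exact: peval0.
have g0 K x : pgrad ((0 : field) K) x = 0 by exact: pgrad0.
have b0 K (g : 'cV[R]_d -> {set V} -> 'cV[R]_d -> R) : K \in T ->
    (forall n F x, g n F x = 0) -> bdry_int pt K g = 0.
  move=> KT gz; apply: big1 => q qK; rewrite -(facet_int0 pt (K :\ q)).
  apply: facet_int_eq => //; exact: card_facet (nT KT) qK.
have e0 K (g : 'cV[R]_d -> R) : (forall x, g x = 0) -> elem_int pt K g = 0.
  by move=> gz; rewrite -[RHS](elem_int0 pt K); apply: elem_int_eq.
(* A zero field removes every term that contains the field or its gradient undifferenced; what
   remains are the two terms quadratic in the jump. *)
have BE : \sum_(K in T) (- inflow K + betac / diam pt K * penalty K) = 0.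
  rewrite -[RHS]HB /Bh /Bha /Bhd -big_split /=; apply: eq_bigr => K KT.
  rewrite e0; last by move=> x; rewrite g0 dotv0r.
  rewrite b0//; last by move=> n F x; rewrite p0 !mul0r.
  rewrite e0; last by move=> x; rewrite g0 dotv0r.
  rewrite (b0 K (fun n F x => dotv (D (veval (u K) x) *m pgrad ((0 : field) K) x) n * _))//; last first.
    by move=> n F x; rewrite g0 mulmx0 dotv0l mul0r.
  by rewrite !oppr0 !add0r !addr0.
have Dn K q x : K \in T -> q \in K ->
    0 < dotv (D (veval (u K) x) *m normal pt K q) (normal pt K q).
  move=> KT qK; have [Dmin0 _ Dpos _ _] := hD.
  apply: lt_le_trans (Dpos _ _).
  by rewrite normv_sqr normal_unit// ?mulr1//; exact: nT.
have pen_ge0 K q x : K \in T -> q \in K ->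
    0 <= dotv ((peval ((0 : field) K) x - cb x) *: (D (veval (u K) x) *m normal pt K q))
        ((peval ((0 : field) K) x - cb x) *: normal pt K q).
  move=> KT qK; rewrite dotvZl dotvZr mulrA -expr2.
  by rewrite mulr_ge0 ?sqr_ge0// ltW// Dn.
have penalty_ge0 K : K \in T -> 0 <= penalty K.
  move=> KT; apply: sumr_ge0 => q qK; apply: facet_int_ge0 => //.
    exact: card_facet (nT KT) qK.
  by move=> x _; exact: pen_ge0.
have inflow_le0 K : K \in T -> inflow K <= 0.
  move=> KT; rewrite -oppr_ge0 /inflow /bdry_int -sumrN; apply: sumr_ge0 => q qK.
  have cF := card_facet (nT KT) qK.
  have H := facet_int_lin (-1) d0 cF
    (@inflow_continuous 0 cb 0 cb K q (normal pt K q) Hcb Hcb KT qK)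
    (facet_continuousW pt (K :\ q) (@cst_continuous _ _ (0 : R))).
  rewrite mulN1r [X in _ + X](facet_int0 pt (K :\ q)) addr0 in H; rewrite -H.
  apply: facet_int_ge0 => // x _; rewrite addr0 mulN1r oppr_ge0.
  case: ifP => // un0; rewrite -mulrA; apply: mulr_le0_ge0; first exact: ltW.
  by rewrite -expr2 sqr_ge0.
have bd K : K \in T -> 0 < betac / diam pt K.
  by move=> KT; rewrite divr_gt0// diam_gt0//; exact: nT.
(* All summands are nonnegative, so the vanishing of the sum descends to each element, then to its
   penalty part, then to each facet, where the integrand is continuous and hence zero. *)
move: BE => /eqP; rewrite psumr_eq0 => [/allP HK|K KT]; last first.
  by rewrite addr_ge0 ?oppr_ge0 ?inflow_le0// mulr_ge0 ?penalty_ge0// ltW// bd.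
move=> F x /(facetP nT)[K [q [KT qK ->]]] Fx.
have /implyP/(_ KT) := HK K (mem_index_enum K).
rewrite paddr_eq0 ?oppr_ge0 ?inflow_le0//; last first.
  by rewrite mulr_ge0 ?penalty_ge0// ltW// bd.
move=> /andP[_]; rewrite mulf_eq0 (gt_eqF (bd K KT)) /= /penalty /bdry_int.
rewrite psumr_eq0 => [/allP Hq|q' q'K]; last first.
  apply: facet_int_ge0 => //; first exact: card_facet (nT KT) q'K.
  by move=> y _; exact: pen_ge0.
have /implyP/(_ qK)/eqP Iq := Hq q (mem_index_enum q).
have cF := card_facet (nT KT) qK.
have aF : affinely_independent pt (K :\ q).
  by apply: (@affinely_independentS _ _ _ _ K); [exact: subD1set|exact: (nT KT).2].
have := facet_int_eq0 d0 cF aF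
  (@penalty_continuous 0 cb 0 cb K q (normal pt K q) Hcb Hcb KT qK)
  (fun y _ => pen_ge0 K q y KT qK) Iq Fx.
rewrite dotvZl dotvZr p0 sub0r => /eqP; rewrite !mulf_eq0 (gt_eqF (Dn K q x KT qK)) orbF.
by rewrite orbb oppr_eq0 => /eqP.
Qed.

End transport.
End transport_forms.

(** * Reduction of the transport scheme to the abstract semi-discrete problem *)

Theorem theorem5p1 (R : realType) (d : nat) (hd : d = 2%N \/ d = 3%N)
  (Om Oms Omd : set 'cV[R]_d) (hOm : domain_decomposition Om Oms Omd)
  (V : finType) (pt : V -> 'cV[R]_d) (Ts Td : {set {set V}}) (sigma : R)
  (hmesh : is_mesh pt Oms Omd Ts Td sigma)
  (mu kappa alpha : R) (hmu : 0 < mu) (hkappa : 0 < kappa) (halpha : 0 < alpha)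
  (fs : 'cV[R]_d -> 'cV[R]_d) (fd : 'cV[R]_d -> R)
  (hfs : forall i : 'I_d, inL2 Oms (fun x => fs x i 0)) (hfd : inL2 Omd fd)
  (k : nat) (hk : (0 < k)%N) (betaf : R) (hbetaf : 0 < betaf)
  (u : {set V} -> 'I_d -> mpoly d R) (ub : 'cV[R]_d -> 'cV[R]_d)
  (p : {set V} -> mpoly d R) (pbs pbd : {set V} -> 'cV[R]_d -> R)
  (hu : flow_solution pt Om Oms Omd Ts Td k mu kappa alpha betaf fs fd
          u ub p pbs pbd)
  (Tend : R) (hT : 0 < Tend)
  (phid : R) (hphid : 0 < phid <= 1)
  (D : 'cV[R]_d -> 'M[R]_d) (Dmin C : R) (hD : dispersion_tensor D Dmin C)
  (f : R -> 'cV[R]_d -> R) (hf : source_continuous Om Tend f)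
  (c0 : 'cV[R]_d -> R) (hc0 : inL2 Om c0)
  (l : nat) (betac : R) (hbetac : 0 < betac) :
  exists (c : R -> {set V} -> mpoly d R) (cb : R -> 'cV[R]_d -> R),
    transport_solution pt Ts Td l phid betac D u Tend f c0 c cb /\
    forall c' cb',
      transport_solution pt Ts Td l phid betac D u Tend f c0 c' cb' ->
      (forall t, t \in `[0, Tend] ->
         forall K, K \in Ts :|: Td -> c' t K = c t K) /\
      (forall t, t \in `]0, Tend] ->
         forall x, skeleton pt (Ts :|: Td) x -> cb' t x = cb t x).
Proof.
have d0 : (0 < d)%N by case: hd => ->.
have nT K : K \in Ts :|: Td -> Defs.nondegenerate pt K by exact: (mesh_simplex hmesh).
(* The hulls lie in the closure of [Om]; regularity of the polygonal domain puts their open parts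
   into [Om] itself, where the source and the initial datum are given. *)
have KOm K : K \in Ts :|: Td -> open_hull pt K `<=` Om.
  move=> KT; have [pOm _ _ _ clE] := hOm.
  apply: (polygonal_regular_open pOm (open_open_hull (nT K KT))).
  apply: (subset_trans (@open_hullW _ _ _ _ _)); rewrite -clE => x Kx.
  move: KT; rewrite inE => /orP[KTs|KTd]; [left; rewrite -(mesh_s hmesh)|right; rewrite -(mesh_d hmesh)];
  by exists K.
have rho0 K : K \in Ts :|: Td -> 0 < porosity Ts phid K.
  by move=> _; rewrite /porosity; case: ifP => // _; case/andP: hphid.
pose X := {set V} -> mpoly d R; pose Y := 'cV[R]_d -> R.
(* Fields are evaluated at pairs of an element and a point in it, because they take different values
   on the two sides of a facet. Agreement at all such pairs is equality of the polynomials on every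
   element. *)
pose A1 := {p : {set V} * 'cV[R]_d | p.1 \in Ts :|: Td /\ hull pt p.1 p.2}.
pose A2 := {p : {set V} * 'cV[R]_d | p.1 \in facets (d := d) (Ts :|: Td) /\ hull pt p.1 p.2}.
pose ev1 (c : X) (a : A1) : R := peval (c (sval a).1) (sval a).2.
pose ev2 (cb : Y) (a : A2) : R := cb (sval a).2.
pose M : X -> X -> R := mass pt Ts Td (porosity Ts phid).
pose M0 (c w : X) := \sum_(K in Ts :|: Td) elem_int pt K (fun x => peval (c K) x * peval (w K) x).
have M0E : M0 = mass pt Ts Td (fun=> 1).
  apply/funext => c; apply/funext => w; apply: eq_bigr => K _.
  by apply: elem_int_eq => x _; rewrite mul1r.
pose load (g : 'cV[R]_d -> R) (w : X) :=
  \sum_(K in Ts :|: Td) elem_int pt K (fun x => g x * peval (w K) x).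
pose B (c : X) (cb : Y) (w : X) (wb : Y) := Bh pt Ts Td betac D u c cb w wb.
have ev1_eq (c c' : X) : (forall a, ev1 c a = ev1 c' a) ->
    forall K, K \in Ts :|: Td -> c K = c' K.
  move=> H; apply: (field_ext nT) => K x KT Kx.
  exact: (H (exist _ (K, x) (conj KT Kx))).
have ev2_eq (cb cb' : Y) : (forall a, ev2 cb a = ev2 cb' a) ->
    forall F x, F \in facets (d := d) (Ts :|: Td) -> hull pt F x -> cb x = cb' x.
  by move=> H F x FT Fx; exact: (H (exist _ (F, x) (conj FT Fx))).
have mass_ok rho : (forall K, K \in Ts :|: Td -> 0 < rho K) ->
    mass_form (inCh Ts Td l) ev1 (mass pt Ts Td rho).
  move=> rpos; split.
  - by move=> r x y w *; exact: (mass_linl (l := l)).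
  - by move=> r x y w *; exact: (mass_linr (l := l)).
  - move=> x x' w w' _ _ _ _ /ev1_eq xx /ev1_eq ww; apply: eq_bigr => K KT.
    by rewrite (xx K KT) (ww K KT).
  - move=> x _ Mx0 [[K z] [KT Kz]]; rewrite /ev1 /=.
    by rewrite (mass_eq0 nT rpos Mx0 KT) peval0.
have load_ok g : inL2 Om g -> load_form (inCh Ts Td l) ev1 (load g).
  move=> gL2; split=> [r x y _ _|w w' _ _ /ev1_eq ww].
    rewrite /load mulr_sumr -big_split /=; apply: eq_bigr => K KT.
    by rewrite -(elem_int_load_lin (nT K KT) (KOm K KT))//.
  by apply: eq_bigr => K KT; rewrite (ww K KT).
have [Blin1 Blin2] := Bh_bilinear d0 l nT betac hD u.
have solP c cb : semidiscrete_solution (inCh Ts Td l) (inCbarh pt Ts Td l) ev1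
      M M0 B (fun t => load (f t)) (load c0) Tend c cb <->
    transport_solution pt Ts Td l phid betac D u Tend f c0 c cb.
  split=> [[H0 H1 H2]|[H0 H1 H2]]; split=> //.
  - by move=> K KT x Kx; exact: (H1 (exist _ (K, x) (conj KT Kx))).
  - move=> t tT; have [Hc Hcb [dc [Hdc Ddc Hw]]] := H2 t tT; split=> //.
    exists dc; split=> // K KT x Kx.
    exact: (Ddc (exist _ (K, x) (conj KT Kx))).
  - by move=> [[K x] [KT Kx]]; exact: H1.
  - move=> t tT; have [Hc Hcb [dc [Hdc Ddc Hw]]] := H2 t tT; split=> //.
    exists dc; split=> // -[[K x] [KT Kx]]; exact: Ddc.
have fin1 (x : X) : inCh Ts Td l x -> exists a : 'I_#|{: {set V} * bmultinom d l.+1}| -> R,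
    forall p, ev1 x p = \sum_i a i * pw_monomial i (sval p).
  move=> Sx; exists (fun i => mcoeff (bmnm (enum_val i).2) (x (enum_val i).1)).
  by move=> [[K z] [KT Kz]]; exact: (pw_monomial_span z (Sx K KT)).
have fin2 (y : Y) : inCbarh pt Ts Td l y ->
    exists a : 'I_#|{: {set V} * bmultinom d l.+1}| -> R,
    forall p, ev2 y p = \sum_i a i * pw_monomial i (sval p).
  move=> [Py _].
  (* A polynomial representative is chosen for each facet, which turns the trace into a family to
     which the span of the piecewise monomials applies. *)
  have /choice[P HP] F : exists q : mpoly d R, F \in facets (d := d) (Ts :|: Td) ->
      inP l q /\ forall x, hull pt F x -> y x = peval q x.
    have [FT|_] := boolP (F \in facets (d := d) (Ts :|: Td)); last by exists 0.
    by have [q ql qE] := Py F FT; exists q.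
  exists (fun i => mcoeff (bmnm (enum_val i).2) (P (enum_val i).1)).
  move=> [[F z] [FT Fz]]; rewrite /ev2 /= (HP F FT).2//.
  exact: (pw_monomial_span z (HP F FT).1).
have contF (w : X) : inCh Ts Td l w -> forall t, t \in `[0, Tend] ->
    (fun s => load (f s) w) @ within `[0, Tend]%classic (nbhs t) --> load (f t) w.
  move=> _ t tT; have FW : Filter (within `[0, Tend] (nbhs t)) by exact: within_filter.
  apply: (@cvg_sum _ _ _ _ FW) => K KT.
  have fL2 : within `[0, Tend]%classic (nbhs t) (fun s => inL2 Om (f s)).
    change (\forall s \near t, s \in `[0, Tend] -> inL2 Om (f s)).
    by apply: filterE => s sT; exact: (hf s sT).1.
  exact: (elem_int_load_cvg (nT K KT) (KOm K KT) (hf t tT).1 fL2 (hf t tT).2).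
have Bext (x x' : X) (y y' : Y) (w w' : X) (v v' : Y) :
    inCh Ts Td l x -> inCh Ts Td l x' -> inCbarh pt Ts Td l y -> inCbarh pt Ts Td l y' ->
    inCh Ts Td l w -> inCh Ts Td l w' -> inCbarh pt Ts Td l v -> inCbarh pt Ts Td l v' ->
    (forall a, ev1 x a = ev1 x' a) -> (forall a, ev2 y a = ev2 y' a) ->
    (forall a, ev1 w a = ev1 w' a) -> (forall a, ev2 v a = ev2 v' a) ->
    B x y w v = B x' y' w' v'.
  move=> _ _ _ _ _ _ _ _ /ev1_eq xx /ev2_eq yy /ev1_eq ww /ev2_eq vv.
  exact: Bh_eq.
have Bpos (y : Y) : inCbarh pt Ts Td l y -> B 0 y 0 y = 0 -> forall a, ev2 y a = 0.
  move=> Sy By [[F z] [FT Fz]]; rewrite /ev2 /=.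
  exact: (Bh_trace_eq0 d0 nT hbetac hD Sy By FT Fz).
have [c [cb [sol uniq]]] := @semidiscrete_unique_solution R X Y A1 A2
  (inCh Ts Td l) (inCbarh pt Ts Td l) ev1 ev2 _ _
  (fun i a => pw_monomial i (sval a)) (fun i a => pw_monomial i (sval a))
  (@inCh_lin _ _ _ _ _ _) (@inCbarh_lin _ _ _ _ _ _ _) (@inCh0 _ _ _ _ _ _) (@inCbarh0 _ _ _ _ _ _ _)
  ltac:(by move=> r x y a; rewrite /ev1 field_linE pevalD pevalZ)
  ltac:(by move=> r x y a; rewrite /ev2 trace_linE)
  fin1 fin2
  M M0 B (fun t => load (f t)) (load c0) Tend hT
  (mass_ok _ rho0)
  ltac:(by rewrite M0E; apply: mass_ok => K _; exact: ltr01)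
  (load_ok _ hc0)
  ltac:(by move=> t tT; apply: load_ok; exact: (hf t tT).1)
  contF Blin1 Blin2 Bext Bpos.
exists c, cb; split; first exact/solP.
move=> c' cb' /solP/uniq[H1 H2]; split=> t tT.
  by move=> K KT; exact: (ev1_eq _ _ (H1 t tT)).
move=> x [F FT Fx]; exact: (ev2_eq _ _ (H2 t tT) F x FT Fx).
Qed.
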